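(* Let $K\subset\hat{\mathbb{C}}$ be a compactum and $x\ne y\in K$. Then $(x,y)\in\overline{R_K}$ if and only if, for every $0<r<\frac{\rho(x,y)}{2}$, the set $K\setminus(D_r(x)\cup D_r(y))$ has infinitely many components intersecting both $\partial D_r(x)$ and $\partial D_r(y)$.
   Context: $\rho$ is the spherical distance on $\hat{\mathbb{C}}$ and $D_r(z)$ is the open $\rho$-ball of radius $r$ centered at $z$. For disjoint simple closed curves $J_1,J_2\subset\hat{\mathbb{C}}$, $U(J_1,J_2)$ is the component of $\hat{\mathbb{C}}\setminus(J_1\cup J_2)$ with boundary $J_1\cup J_2$. The Schönflies relation $R_K\subset K\times K$: $x\ne y$ satisfy $(x,y)\in R_K$ if there exist disjoint simple closed curves $J_1\ni x$, $J_2\ni y$ such that $\overline{U(J_1,J_2)}\cap K$ contains an infinite sequence of distinct components $P_n$ each meeting both $J_1$ and $J_2$ whose Hausdorff limit contains $\{x,y\}$. $\overline{R_K}$ is the closure of $R_K$ in $K\times K$. *)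

(* Defs.v *)
From HB Require Import structures.
From mathcomp Require Import all_boot all_order all_algebra.
From mathcomp Require Import all_classical all_reals all_analysis.
Set Implicit Arguments. Unset Strict Implicit. Unset Printing Implicit Defensive.
Import Order.TTheory GRing.Theory Num.Theory.
Import numFieldNormedType.Exports.
Local Open Scope classical_set_scope.
Local Open Scope ring_scope.

(* The Riemann sphere \hat C is modelled as the unit sphere S^2 in R^3
   (via stereographic projection), inside the ambient space R*R*R. *)
Notation pt R := (R * R * R)%type.

Section Sphere.
Variable R : realType.

Definition dotp (p q : pt R) : R := p.1.1 * q.1.1 + p.1.2 * q.1.2 + p.2 * q.2.

Definition sphere : set (pt R) := [set p | dotp p p = 1].

Definition rho (p q : pt R) : R := acos (dotp p q).

Definition Dr (r : R) (z : pt R) : set (pt R) := [set w | sphere w /\ rho z w < r].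

(* boundary, relative to the sphere, of a set A contained in the sphere:
   closure (sphere is closed in R^3) minus relative interior *)
Definition sbd (A : set (pt R)) : set (pt R) :=
  closure A `\` [set z | A z /\ exists e : R, 0 < e /\ Dr e z `<=` A].

Definition circle : set (R * R) := [set p | p.1 ^+ 2 + p.2 ^+ 2 = 1].

Definition simple_closed_curve (J : set (pt R)) : Prop :=
  J `<=` sphere /\
  exists f : R * R -> pt R,
    {within circle, continuous f} /\ set_inj circle f /\ f @` circle = J.

Definition component_of (A C : set (pt R)) : Prop :=
  exists z, A z /\ C = connected_component A z.

Definition is_U (J1 J2 U : set (pt R)) : Prop :=
  component_of (sphere `\` (J1 `|` J2)) U /\ sbd U = J1 `|` J2.

Definition nbhd_rho (e : R) (A : set (pt R)) : set (pt R) :=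
  [set z | sphere z /\ exists2 w, A w & rho z w < e].

Definition hausdorff_limit (P : nat -> set (pt R)) (L : set (pt R)) : Prop :=
  L `<=` sphere /\ compact L /\ L !=set0 /\
  forall e : R, 0 < e -> exists N, forall n, (N <= n)%N ->
    P n `<=` nbhd_rho e L /\ L `<=` nbhd_rho e (P n).

Definition RK (K : set (pt R)) : set (pt R * pt R) :=
  [set xy | let x := xy.1 in let y := xy.2 in
    K x /\ K y /\ x <> y /\
    exists J1 J2 U : set (pt R),
      simple_closed_curve J1 /\ simple_closed_curve J2 /\
      J1 `&` J2 = set0 /\ J1 x /\ J2 y /\ is_U J1 J2 U /\
      exists P : nat -> set (pt R),
        injective P /\
        (forall n, component_of (closure U `&` K) (P n) /\
                   P n `&` J1 !=set0 /\ P n `&` J2 !=set0) /\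
        exists L, hausdorff_limit P L /\ L x /\ L y].

Definition RK_closure (K : set (pt R)) : set (pt R * pt R) :=
  closure (RK K) `&` (K `*` K).

End Sphere.

(* Main.v *)
(* Proof idea.  Both directions compare the curves of the Schoenflies relation with the
   circles of radius [r] around [x] and [y].  If infinitely many components of the part
   of [K] between these circles meet both of them, the circles themselves are admissible
   curves, and a Hausdorff convergent subsequence (Blaschke) puts a pair of points of the
   two circles in the relation; let [r] tend to 0.
     Conversely let [P_n] be the components given by a pair of the relation near [(x, y)],
   and suppose that one component [C] of the part of [K] between the circles contains
   crossing pieces of infinitely many [P_n].  As the [P_n] are distinct components of
   the closure of [U] intersected with [K], [C] must leave the closure of [U] near each
   of these pieces, through a point [p_n] of one curve [J] of the two.  At an accumulation
   point [p] of the [p_n] the complement of [J] has locally at most two sides: this is a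
   winding number computation with arguments (Eilenberg's criterion).  Hence three of the
   exits, taken from five, end in one connected set outside the closure of [U], and
   this set together with the two discs and the three disjoint crossing continua forms a
   complete bipartite graph on 3 + 3 vertices in the sphere, which is impossible by van
   Kampen's parity count of the rotation of differences of points on disjoint edges. *)

Require Import Defs.
From HB Require Import structures.
From mathcomp Require Import all_boot all_order all_algebra.
From mathcomp Require Import all_classical all_reals all_analysis.
From mathcomp Require Import ring lra zify.
Import Order.TTheory GRing.Theory Num.Theory.
Import numFieldNormedType.Exports.
Local Open Scope classical_set_scope.
Local Open Scope ring_scope.
Set Implicit Arguments. Unset Strict Implicit. Unset Printing Implicit Defensive.

(** * Arguments of planar vectors *)

(** No form of the Jordan curve theorem is used: separation by a curve and nonplanarity both rest on
    lifting arguments of nowhere zero planar functions along homotopies over compact sets. Two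
    levels [c < c'] occur, where [c] is the cosine of [r]. The three continua of the graph have to
    touch the hubs, so they cross between the smaller discs of level [c']. The component [C] lies
    between the circles of level [c], so each accumulation point of exits has a neighbourhood free
    of the smaller discs, and the third hub is built in it. The gap between the levels exists
    because the pair of the relation can be taken strictly inside the open discs around [x] and [y].
    Discs are handled as half-spaces [c <= dotp x w]. In the stereographic chart with pole [x], the
    disc around [x] is the exterior of a round disc and the disc around [y] is convex; the spokes
    from these two hubs are therefore explicit spirals and segments. *)

Section Arguments.
Variable R : realType.
Implicit Types (z w : R * R) (a b : R).

Definition dot2 z w : R := z.1 * w.1 + z.2 * w.2.
Definition cross2 z w : R := z.1 * w.2 - z.2 * w.1.
Definition cmul z w : R * R := (z.1 * w.1 - z.2 * w.2, z.1 * w.2 + z.2 * w.1).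
Definition conj2 z : R * R := (z.1, - z.2).

(** Arguments are real numbers, not classes modulo [pi *+ 2], so that they can vary continuously;
    the positive factor leaves the zero vector without an argument. *)
Definition is_arg z a : Prop := exists2 c, 0 < c & z = (c * cos a, c * sin a).

Lemma is_arg_neq0 z a : is_arg z a -> z <> 0.
Proof.
move=> [c c0 ->] [/eqP + /eqP]; rewrite !mulf_eq0 (gt_eqF c0)/= => /eqP h1 /eqP h2.
by have := cos2Dsin2 a; rewrite h1 h2 expr0n/= addr0 => /eqP; rewrite eq_sym oner_eq0.
Qed.

Lemma dot2_gt0 z : z <> 0 -> 0 < dot2 z z.
Proof.
case: z => u v /= h; rewrite /dot2 /= -!expr2 lt0r paddr_eq0 ?sqr_ge0// !sqrf_eq0.
rewrite addr_ge0 ?sqr_ge0// andbT; apply/negP => /andP[/eqP h1 /eqP h2].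
by apply: h; rewrite h1 h2.
Qed.

Lemma is_arg_ex z : z <> 0 -> exists a, is_arg z a.
Proof.
move=> z0; have d0 := dot2_gt0 z0.
set r := Num.sqrt (dot2 z z); have r0 : 0 < r by rewrite sqrtr_gt0.
have rr : r ^+ 2 = z.1 ^+ 2 + z.2 ^+ 2 by rewrite sqr_sqrtr ?ltW// /dot2 -!expr2.
set t := z.1 / r; have zt : z.1 = r * t by rewrite /t mulrC divfK// gt_eqF.
have t2 : t ^+ 2 <= 1.
  rewrite /t expr_div_n ler_pdivrMr ?exprn_gt0// mul1r rr lerDl sqr_ge0//.
have t1 : -1 <= t <= 1 by rewrite -ler_norml -(@ler_pXn2r _ 2)// ?nnegrE// expr1n real_normK ?num_real.
have tI : t \in `[-1, 1] by rewrite in_itv.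
have z2 : r * Num.sqrt (1 - t ^+ 2) = `|z.2|.
  rewrite -sqrtr_sqr -[in LHS](gtr0_norm r0) -sqrtr_sqr -sqrtrM ?sqr_ge0//; congr Num.sqrt.
  by rewrite mulrBr mulr1 -exprMn -zt rr addrC addKr.
case: (lerP 0 z.2) => h.
- exists (acos t), r => //; rewrite acosK// sin_acos// z2 -zt ger0_norm//.
  by case: (z).
- exists (- acos t), r => //; rewrite cosN sinN acosK// sin_acos// mulrN z2 -zt ltr0_norm// opprK.
  by case: (z).
Qed.

(** The floor of [a / (pi *+ 2)] reduces [a] to one period; [cos_inj] settles its first half, and a
    reflection brings the second half back to the first. *)
Lemma cos_eq1 a : cos a = 1 -> exists n : int, a = n%:~R * (pi *+ 2).
Proof.
move=> ca; have p2 : 0 < (pi : R) *+ 2 by rewrite mulrn_wgt0// pi_gt0.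
pose n := Num.floor (a / (pi *+ 2)); exists n.
have /andP[n1 n2] : n%:~R <= a / (pi *+ 2) < (n + 1)%:~R.
  by rewrite ge_floor/= -floor_lt_int ltzD1.
rewrite ler_pdivlMr// in n1; rewrite ltr_pdivrMr// in n2.
set b := a - n%:~R * (pi *+ 2); have b0 : 0 <= b by rewrite subr_ge0.
have b1 : b < pi *+ 2 by rewrite ltrBlDr (lt_le_trans n2)// intrD mulrDl mul1r addrC.
have perN (m : nat) c : cos (c + m%:R * (pi *+ 2)) = cos c.
  elim: m c => [|m IH] c; first by rewrite mul0r addr0.
  by rewrite -natr1 mulrDl mul1r addrA cosD2pi IH.
have cb : cos b = 1.
  rewrite -ca /b; case: (n) => m.
    by rewrite -[in RHS](subrK (m%:~R * (pi *+ 2)) a) perN.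
  by rewrite NegzE mulrNz mulNr opprK perN.
apply/eqP; rewrite -subr_eq0 -/b; apply/eqP.
have [bpi|bpi] := lerP b pi.
  by apply: (@cos_inj R); rewrite ?in_itv/= ?b0 ?bpi ?lexx ?pi_ge0// cos0.
have : cos (pi *+ 2 - b) = 1 by rewrite cosB cos2pi sin2pi cb mul1r mul0r addr0.
have h2 : pi *+ 2 - b <= pi by rewrite lerBlDr mulr2n lerD2l ltW.
rewrite -cos0 => /cos_inj; rewrite !in_itv/= subr_ge0 (ltW b1) h2 lexx pi_ge0.
by move=> /(_ isT isT)/eqP; rewrite subr_eq0 (gt_eqF b1).
Qed.

Lemma is_arg_uniq z a b : is_arg z a -> is_arg z b ->
  exists n : int, a = b + n%:~R * (pi *+ 2).
Proof.
move=> [c c0 ->] [d d0 [h1 h2]].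
have cd : c = d.
  have e : c ^+ 2 = d ^+ 2.
    rewrite -[LHS]mulr1 -[RHS]mulr1 -{1}(cos2Dsin2 a) -(cos2Dsin2 b).
    by rewrite !mulrDr -!exprMn h1 h2.
  by apply/eqP; rewrite -(@eqrXn2 _ 2)// ?ltW// e.
rewrite -cd in h1 h2.
have [n hn] : exists n : int, a - b = n%:~R * (pi *+ 2).
  apply: cos_eq1; rewrite cosB.
  have -> : cos a = cos b by apply: (mulfI _ h1); rewrite gt_eqF.
  have -> : sin a = sin b by apply: (mulfI _ h2); rewrite gt_eqF.
  by rewrite -!expr2 cos2Dsin2.
by exists n; rewrite -hn addrC subrK.
Qed.

Lemma is_arg2pi z a (n : int) : is_arg z a -> is_arg z (a + n%:~R * (pi *+ 2)).
Proof.
have perN (m : nat) c : is_arg z c <-> is_arg z (c + m%:R * (pi *+ 2)).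
  elim: m c => [|m IH] c; first by rewrite mul0r addr0.
  rewrite -natr1 mulrDl mul1r addrA; split.
    by move/IH => [d d0 e]; exists d; rewrite // cosD2pi sinD2pi.
  by move=> [d d0]; rewrite cosD2pi sinD2pi => e; apply/IH; exists d.
case: n => m h; first exact: (perN m a).1.
by rewrite NegzE mulrNz mulNr; apply: (perN m.+1 _).2; rewrite subrK.
Qed.

Lemma is_argM z w a b : is_arg z a -> is_arg w b -> is_arg (cmul z w) (a + b).
Proof.
move=> [c c0 ->] [d d0 ->]; exists (c * d); first exact: mulr_gt0.
by rewrite /cmul/= cosD sinD; congr pair; ring.
Qed.

Lemma is_arg_conj z a : is_arg z a -> is_arg (conj2 z) (- a).
Proof. by move=> [c c0 ->]; exists c => //; rewrite /conj2/= cosN sinN mulrN. Qed.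

Lemma is_argN z a : is_arg z a -> is_arg (- z) (a + pi).
Proof.
by move=> [c c0 ->]; exists c => //; rewrite cosDpi sinDpi !mulrN.
Qed.

Lemma is_argZ z a c : 0 < c -> is_arg z a -> is_arg (c * z.1, c * z.2) a.
Proof.
by move=> c0 [d d0 ->]; exists (c * d); rewrite ?mulr_gt0//= !mulrA.
Qed.

(** The product of [w] with the conjugate of [z] has real part [dot2 z w > 0] and imaginary part
    [cross2 z w], so the arctangent is an argument of it, continuous in both vectors. *)
Lemma is_arg_near z w a : 0 < dot2 z w -> is_arg z a ->
  is_arg w (a + atan (cross2 z w / dot2 z w)).
Proof.
move=> d0 za; have za' := za; case: za => c c0 ez.
set t := cross2 z w / dot2 z w.
have s0 : 0 < Num.sqrt (1 + t ^+ 2) by rewrite sqrtr_gt0 ltr_pwDl// sqr_ge0.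
have ct : cos (atan t) = (Num.sqrt (1 + t ^+ 2))^-1 by rewrite cos_atan.
have ct0 : cos (atan t) != 0 by rewrite ct invr_eq0 gt_eqF.
have st : sin (atan t) = t * (Num.sqrt (1 + t ^+ 2))^-1.
  by rewrite -ct; apply: (mulIf (invr_neq0 ct0)); rewrite mulfK//; exact: atanK.
have h : is_arg (dot2 z w, cross2 z w) (atan t).
  exists (dot2 z w * Num.sqrt (1 + t ^+ 2)); first exact: mulr_gt0.
  rewrite ct st; congr pair; first by rewrite mulfK// gt_eqF.
  by rewrite mulrCA mulfK ?gt_eqF// /t divfK// gt_eqF.
have := is_argM za' h.
have z0 : 0 < dot2 z z by apply: dot2_gt0; apply: is_arg_neq0 za'.
have -> : cmul z (dot2 z w, cross2 z w) = (dot2 z z * w.1, dot2 z z * w.2).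
  by rewrite /cmul /dot2 /cross2/=; congr pair; ring.
move/(is_argZ (_ : 0 < (dot2 z z)^-1)); rewrite invr_gt0 => /(_ z0) /=.
by rewrite !mulKf ?gt_eqF//; case: (w).
Qed.

End Arguments.

(** * Continuity of composite functions *)

Section ContinuityRules.
Variables (R : realType) (T : topologicalType).
Implicit Types (f g : T -> R).

Lemma continuous_fun_add (f g : T -> R) : continuous f -> continuous g -> continuous (fun x => f x + g x).
Proof. by move=> cf cg x; apply: cvgD; [exact: cf|exact: cg]. Qed.

Lemma continuous_fun_opp (f : T -> R) : continuous f -> continuous (fun x => - f x).
Proof. by move=> cf x; apply: cvgN; exact: cf. Qed.

Lemma continuous_fun_mul (f g : T -> R) : continuous f -> continuous g -> continuous (fun x => f x * g x).
Proof. by move=> cf cg x; apply: cvgM; [exact: cf|exact: cg]. Qed.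

Lemma continuous_fun_const (U : topologicalType) (a : U) : continuous (fun _ : T => a).
Proof. by move=> x; exact: cvg_cst. Qed.

Lemma continuous_fun_id : continuous (fun x : T => x).
Proof. by move=> x; exact: cvg_id. Qed.

Lemma continuous_fun_pair (U V : topologicalType) (f : T -> U) (g : T -> V) :
  continuous f -> continuous g -> continuous (fun x => (f x, g x)).
Proof. by move=> cf cg x; apply: cvg_pair; [exact: cf|exact: cg]. Qed.

Lemma continuous_fun_fst (U V : topologicalType) (f : T -> U * V) : continuous f -> continuous (fun x => (f x).1).
Proof. by move=> cf x; apply: cvg_comp (cf x) _; exact: cvg_fst. Qed.

Lemma continuous_fun_snd (U V : topologicalType) (f : T -> U * V) : continuous f -> continuous (fun x => (f x).2).
Proof. by move=> cf x; apply: cvg_comp (cf x) _; exact: cvg_snd. Qed.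

Lemma continuous_fun_comp (U V : topologicalType) (f : T -> U) (g : U -> V) :
  continuous g -> continuous f -> continuous (fun x => g (f x)).
Proof. by move=> cg cf x; apply: cvg_comp (cf x) _; exact: cg. Qed.

Lemma continuous_fun_addv (V : normedModType R) (f g : T -> V) : continuous f -> continuous g -> continuous (fun x => f x + g x).
Proof. by move=> cf cg x; apply: cvgD; [exact: cf|exact: cg]. Qed.

Lemma continuous_fun_oppv (V : normedModType R) (f : T -> V) : continuous f -> continuous (fun x => - f x).
Proof. by move=> cf x; apply: cvgN; exact: cf. Qed.

Lemma continuous_fun_scale (V : normedModType R) (f : T -> R) (g : T -> V) :
  continuous f -> continuous g -> continuous (fun x => f x *: g x).
Proof. by move=> cf cg x; apply: cvgZ; [exact: cf|exact: cg]. Qed.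

Lemma continuous_fun_exp n (f : T -> R) : continuous f -> continuous (fun x => f x ^+ n).
Proof.
move=> cf; elim: n => [|n IH]; first by move=> x; exact: cvg_cst.
by under eq_fun do rewrite exprS; exact: continuous_fun_mul.
Qed.

Lemma continuous_fun_min (f g : T -> R) : continuous f -> continuous g -> continuous (fun x => Num.min (f x) (g x)).
Proof. by move=> cf cg x; apply: continuous_min; [exact: cf|exact: cg]. Qed.

Lemma continuous_fun_max (f g : T -> R) : continuous f -> continuous g -> continuous (fun x => Num.max (f x) (g x)).
Proof. by move=> cf cg x; apply: continuous_max; [exact: cf|exact: cg]. Qed.

End ContinuityRules.

Ltac continuity_step := match goal with
  | |- continuous (fun x => ?c) => apply: continuous_fun_const
  | |- continuous (fun x => x) => apply: continuous_fun_id
  | |- continuous (fun x => (_, _)) => apply: continuous_fun_pair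
  | |- continuous (fun x => (_).1) => apply: continuous_fun_fst
  | |- continuous (fun x => (_).2) => apply: continuous_fun_snd
  | |- continuous (fun x => _ + _) => first [apply: continuous_fun_add | apply: continuous_fun_addv]
  | |- continuous (fun x => - _) => first [apply: continuous_fun_opp | apply: continuous_fun_oppv]
  | |- continuous (fun x => _ * _) => apply: continuous_fun_mul
  | |- continuous (fun x => _ *: _) => apply: continuous_fun_scale
  | |- continuous (fun x => _ ^+ _) => apply: continuous_fun_exp
  | |- continuous (fun x => Num.min _ _) => apply: continuous_fun_min
  | |- continuous (fun x => Num.max _ _) => apply: continuous_fun_max
  | |- continuous (fun x => cos _) => apply: (continuous_fun_comp (@continuous_cos _))
  | |- continuous (fun x => sin _) => apply: (continuous_fun_comp (@continuous_sin _))
  | h : continuous ?g |- continuous (fun x => ?g _) => apply: (continuous_fun_comp h)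
  | |- continuous ?f => lazymatch f with
      | (fun x => _) => fail
      | _ => change (continuous (fun x => f x))
      end
  end.
Ltac continuity := repeat first [assumption | continuity_step].

(** * Continuous arguments along homotopies *)

Section HomotopyOfArguments.
Variable R : realType.

Definition has_arg (T : topologicalType) (X : set T) (f : T -> R * R) : Prop :=
  exists phi : T -> R, {within X, continuous phi} /\ forall x, X x -> is_arg (f x) (phi x).

Lemma dot2_continuous (T : topologicalType) (f g : T -> R * R) :
  continuous f -> continuous g -> continuous (fun x => dot2 (f x) (g x)).
Proof. by move=> cf cg; rewrite /dot2; continuity. Qed.



Lemma dot2C (z w : R * R) : dot2 z w = dot2 w z.
Proof. by rewrite /dot2 mulrC [z.2 * _]mulrC. Qed.

Lemma has_arg_near (T : topologicalType) (X : set T) (f g : T -> R * R) :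
  continuous f -> continuous g -> (forall x, X x -> 0 < dot2 (f x) (g x)) ->
  has_arg X f -> has_arg X g.
Proof.
move=> cf cg fg [phi [cphi fphi]].
exists (fun x => phi x + atan (cross2 (f x) (g x) / dot2 (f x) (g x))); split; last first.
  by move=> x Xx; apply: is_arg_near; [exact: fg|exact: fphi].
have h : {within X, continuous (fun x => atan (cross2 (f x) (g x) / dot2 (f x) (g x)))}.
  apply: continuous_in_subspaceT => x; rewrite inE => Xx.
  apply: (@continuous_comp _ _ _ (fun x => cross2 (f x) (g x) / dot2 (f x) (g x)) (@atan R)); last exact: continuous_atan.
  apply: cvgM; first by have : continuous (fun x => cross2 (f x) (g x)) by [rewrite /cross2; continuity]; exact.
  by apply: cvgV; [rewrite gt_eqF// fg|exact: (dot2_continuous cf cg)].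
by move=> x; apply: cvgD; [exact: cphi|exact: h].
Qed.

Lemma clopen_setT (S : set R) (a b : R) : open S -> closed S -> S a -> S b.
Proof.
move=> oS cS Sa; have /connected_intervalP cT : is_interval [set: R] by [].
by rewrite (cT S) //; [exists a|exists S => //; rewrite setTI|exists S => //; rewrite setTI].
Qed.

(** By compactness of [X], the vectors [H t0 x] and [H t x] form an acute angle for all [x] in [X]
    at once when [t] is near [t0]; the times at which an argument exists thus form an open and
    closed set. *)
Lemma arg_homotopy (T : topologicalType) (X : set T) (H : R -> T -> R * R) :
  compact X -> continuous (fun p : R * T => H p.1 p.2) ->
  (forall t x, 0 <= t <= 1 -> X x -> H t x <> 0) ->
  has_arg X (H 0) -> has_arg X (H 1).
Proof.
move=> cX cH H0.
(* Clamping the time to [0, 1] extends the homotopy to the whole line, whose connectedness is then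
   applied. *)
pose c (t : R) : R := Num.max 0 (Num.min t 1).
have cc : continuous c by rewrite /c; continuity.
have c01 t : 0 <= c t <= 1 by rewrite /c le_max lexx ge_max ler01 ge_min lexx orbT.
pose G t x := H (c t) x.
have cG : continuous (fun p : R * T => G p.1 p.2).
  by apply: (continuous_fun_comp cH (f := fun p : R * T => (c p.1, p.2))); continuity.
have cGt t : continuous (G t).
  by apply: (continuous_fun_comp cG (f := fun x : T => (t, x))); continuity.
have -> : H 0 = G 0 by rewrite /G /c /Num.min ltr01 /Num.max ltxx.
have -> : H 1 = G 1 by rewrite /G /c /Num.min ltxx /Num.max ltr01.
have loc t0 : \forall t \near t0, forall x, X x -> 0 < dot2 (G t0 x) (G t x).
  apply: ((compact_near_coveringP X).1 cX R (nbhs t0) (fun t x => 0 < dot2 (G t0 x) (G t x))) => x Xx.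
  have cD : continuous (fun p : T * R => dot2 (G t0 p.1) (G p.2 p.1)).
    apply: dot2_continuous; first by apply: (continuous_fun_comp (cGt t0)); continuity.
    by apply: (continuous_fun_comp cG (f := fun p : T * R => (p.2, p.1))); continuity.
  have d0 : 0 < dot2 (G t0 x) (G t0 x) by apply/dot2_gt0/H0.
  exact: (cvgr_gt _ (cD (x, t0)) _ d0).
move=> h0; apply: (@clopen_setT [set t | has_arg X (G t)] 0 1) => //.
- rewrite openE => t ht; rewrite /interior; near=> u; rewrite /=.
  apply: has_arg_near ht => //; near: u; exact: loc.
- rewrite -openC openE => t ht; rewrite /interior; near=> u; rewrite /=.
  move=> hu; apply: ht => /=; apply: has_arg_near hu => // x Xx.
  by rewrite dot2C; move: x Xx; near: u; exact: loc.
Unshelve. all: by end_near.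
Qed.

(** [f (h t x)] is a homotopy to [f] from a constant function, which has a constant argument. *)
Lemma has_arg_contractible (T : topologicalType) (X : set T) (f : T -> R * R)
    (h : R -> T -> T) (x0 : T) :
  compact X -> X !=set0 -> continuous f -> continuous (fun p : R * T => h p.1 p.2) ->
  (forall t x, 0 <= t <= 1 -> X x -> X (h t x)) ->
  (forall x, h 0 x = x0) -> (forall x, h 1 x = x) ->
  (forall x, X x -> f x <> 0) -> has_arg X f.
Proof.
move=> cX [x Xx] cf ch hX h0 h1 f0.
have -> : f = (fun x => f (h 1 x)) by apply/funext => y; rewrite h1.
apply: (@arg_homotopy _ _ (fun t x => f (h t x))) => //.
- exact: (continuous_fun_comp cf).
- by move=> t y t01 Xy; apply/f0/hX.
have [a ha] : exists a, is_arg (f x0) a.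
  by apply/is_arg_ex/f0; rewrite -(h0 x); apply: hX; rewrite ?lexx ?ler01.
by exists (fun=> a); split; [exact/continuous_subspaceT/continuous_fun_const|move=> y _; rewrite h0].
Qed.

End HomotopyOfArguments.

(** * Winding numbers and separation in the plane *)

Section WithinContinuity.
Variables (S T U : topologicalType).

Lemma within_comp (Y : set S) (X : set T) (g : S -> T) (f : T -> U) :
  {within Y, continuous g} -> (forall s, Y s -> X (g s)) ->
  {within X, continuous f} -> {within Y, continuous (f \o g)}.
Proof.
move=> cg gX cf; apply/continuousP => W oW.
have /open_subspaceP[V oV VW] := (continuousP _).1 cf _ oW.
have /open_subspaceP[V' oV' VV'] := (continuousP _).1 cg _ oV.
apply/open_subspaceP; exists V' => //; rewrite VV'.
rewrite predeqE => s; split => -[h Ys]; split => //.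
- have : (V `&` X) (g s) by split=> //; exact: gX.
  by rewrite VW => -[].
- have : (from_subspace X f @^-1` W `&` X) (g s) by split=> //; exact: gX.
  by rewrite -VW => -[].
Qed.

End WithinContinuity.

Section Winding.
Variable R : realType.
Implicit Types z w : R * R.

Lemma closed_bounded_compact2 (X : set (R * R)) (M : R) :
  closed X -> (forall z, X z -> `|z.1| <= M /\ `|z.2| <= M) -> compact X.
Proof.
move=> cX bX.
apply: (subclosed_compact cX (compact_setX (@segment_compact R (-M) M) (@segment_compact R (-M) M))).
by move=> z /bX[h1 h2]; split; rewrite /= in_itv/= -ler_norml.
Qed.

Lemma closed_eq_fun (T : topologicalType) (f g : T -> R) :
  continuous f -> continuous g -> closed [set x | f x = g x].
Proof.
move=> cf cg; rewrite (_ : [set x | _] = (fun x => f x - g x) @^-1` [set 0]).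
  by apply: preimage_closed; [move=> x _; exact: (continuous_fun_add cf (continuous_fun_opp cg))|exact: closed_eq].
by apply/seteqP; split => x /= => [->|/eqP]; rewrite ?subrr// subr_eq0 => /eqP.
Qed.

Lemma circle_compact : compact (@circle R).
Proof.
apply: (@closed_bounded_compact2 _ 1).
  by apply: closed_eq_fun; continuity.
move=> z h; have k (s t : R) : s ^+ 2 + t ^+ 2 = 1 -> `|s| <= 1.
  move=> e; rewrite -(@ler_pXn2r _ 2)// ?nnegrE// expr1n real_normK ?num_real//.
  by rewrite -e lerDl sqr_ge0.
by split; [exact: k h|apply: k; rewrite addrC; exact: h].
Qed.

Lemma cos_sin_circle t : @circle R (cos t, sin t).
Proof. exact: cos2Dsin2. Qed.

(** Two different values would differ by at least [pi *+ 2]; the image, an interval, would then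
    contain [psi x + pi], which is no multiple of [pi *+ 2]. *)
Lemma integral_valued_constant (T : topologicalType) (X : set T) (psi : T -> R) :
  connected X -> {within X, continuous psi} ->
  (forall x, X x -> exists n : int, psi x = n%:~R * (pi *+ 2)) ->
  forall x y, X x -> X y -> psi x = psi y.
Proof.
move=> cX cpsi hpsi.
have p0 : 0 < (pi : R) by exact: pi_gt0.
have key x y : X x -> X y -> psi x < psi y -> False.
  move=> Xx Xy xy.
  have /connected_intervalP cI := connected_continuous_connected cX cpsi.
  have [n en] := hpsi _ Xx; have [m em] := hpsi _ Xy.
  have nm : (n + 1 <= m)%R.
    rewrite lezD1 -(@ltr_int R).
    by move: xy; rewrite en em ltr_pM2r// mulrn_wgt0.
  have [] := cI (psi x) (psi y) _ _ (psi x + pi).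
  - by exists x.
  - by exists y.
  - rewrite lerDl ltW//= em en (le_trans (_ : _ <= (n + 1)%:~R * (pi *+ 2)))//.
      by rewrite intrD mulrDl mul1r mulr2n lerD2l lerDl ltW.
    by rewrite ler_wpM2r ?ler_int// mulrn_wge0// ltW.
  - move=> z Xz ez; have [k ek] := hpsi _ Xz.
    move: ez; rewrite ek en => e.
    have : (k - n)%:~R * 2 = 1 :> R.
      apply: (mulIf (lt0r_neq0 p0)); rewrite mul1r intrB.
      have {2}-> : (pi : R) = k%:~R * (pi *+ 2) - n%:~R * (pi *+ 2) by rewrite e; ring.
      by ring.
    rewrite -[2]/(2%:~R) -intrM -[1]/(1%:~R) => /eqP; rewrite eqr_int => /eqP h.
    by have := congr1 (fun i : int => (i %% 2)%Z) h; rewrite modzMl.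
move=> x y Xx Xy; case: (ltgtP (psi x) (psi y)) => // h; exfalso; apply: key h => //.
Qed.

Fixpoint cpow z n := if n is n.+1 then cmul z (cpow z n) else (1, 0).

Lemma is_argX z a n : is_arg z a -> is_arg (cpow z n) (n%:R * a).
Proof.
move=> za; elim: n => [|n IH]; first by exists 1; rewrite // mul0r cos0 sin0 mulr1 mulr0.
by rewrite -natr1 mulrDl mul1r addrC; exact: is_argM.
Qed.

Lemma cpow_neq0 z n : z <> 0 -> cpow z n <> 0.
Proof. by move=> /is_arg_ex[a /(is_argX n)/is_arg_neq0]. Qed.

Lemma cmul_neq0 z w : z <> 0 -> w <> 0 -> cmul z w <> 0.
Proof. by move=> /is_arg_ex[a ha] /is_arg_ex[b hb]; apply: is_arg_neq0 (is_argM ha hb). Qed.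

Lemma conj2_neq0 z : z <> 0 -> conj2 z <> 0.
Proof. by move=> /is_arg_ex[a /is_arg_conj/is_arg_neq0]. Qed.

Lemma continuous_cmul (T : topologicalType) (f g : T -> R * R) :
  continuous f -> continuous g -> continuous (fun x => cmul (f x) (g x)).
Proof. by move=> cf cg; rewrite /cmul; continuity. Qed.

Lemma continuous_conj2 (T : topologicalType) (f : T -> R * R) :
  continuous f -> continuous (fun x => conj2 (f x)).
Proof. by move=> cf; rewrite /conj2; continuity. Qed.

Lemma continuous_cpow (T : topologicalType) n (f : T -> R * R) :
  continuous f -> continuous (fun x => cpow (f x) n).
Proof.
by move=> cf; elim: n => [|n IH] /=; [exact: continuous_fun_const|exact: continuous_cmul].
Qed.

(** Along [t -> (cos t, sin t)] an argument differs from [n * t] by a constant, yet it takes the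
    same value at 0 and at [pi *+ 2]. *)
Lemma circle_winding n : has_arg (@circle R) (fun z => cpow z n) -> n = 0%N.
Proof.
move=> [phi [cphi hphi]].
pose psi t := phi (cos t, sin t) - n%:R * t.
have cpsi : {within setT, continuous psi}.
  have c2 : continuous (fun t : R => n%:R * t) by continuity.
  apply/continuous_subspaceT => t; apply: cvgB; last exact: c2.
  have h : {within setT, continuous (phi \o (fun t => (cos t, sin t)))}.
    apply: within_comp cphi; last by move=> s _; exact: cos_sin_circle.
    by apply: continuous_subspaceT; continuity.
  by move: (h t); rewrite /continuous_at nbhs_subspaceT.
have cT : connected [set: R] by apply/connected_intervalP.
have H : psi (pi *+ 2) = psi 0.
  apply: (integral_valued_constant cT cpsi) => // t _.
  have [||m e] := @is_arg_uniq R (cpow (cos t, sin t) n) (phi (cos t, sin t)) (n%:R * t).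
  - exact/hphi/cos_sin_circle.
  - by apply: is_argX; exists 1; rewrite ?mul1r.
  - by exists m; rewrite /psi e addrC addKr.
move: H; rewrite /psi cos2pi sin2pi cos0 sin0 mulr0 subr0 => /eqP.
rewrite subr_eq addrC -subr_eq subrr eq_sym => /eqP H.
have p2 : (pi *+ 2 : R) != 0 by rewrite mulrn_eq0/= gt_eqF// pi_gt0.
by move/eqP: H; rewrite mulf_eq0 (negbTE p2) orbF pnatr_eq0 => /eqP.
Qed.

Definition unit2 z : R * R := ((Num.sqrt (dot2 z z))^-1 * z.1, (Num.sqrt (dot2 z z))^-1 * z.2).

Lemma is_arg_unit2 z a : is_arg z a -> unit2 z = (cos a, sin a).
Proof.
move=> [c c0 ->]; rewrite /unit2 /dot2/=.
have -> : c * cos a * (c * cos a) + c * sin a * (c * sin a) = c ^+ 2.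
  by rewrite -[RHS]mulr1 -(cos2Dsin2 a); ring.
by rewrite sqrtr_sqr gtr0_norm// !mulKf// gt_eqF.
Qed.

Lemma continuous_unit2 z : z <> 0 -> {for z, continuous unit2}.
Proof.
move=> z0; have d0 := dot2_gt0 z0.
have cs : (fun w => (Num.sqrt (dot2 w w))^-1) @ z --> (Num.sqrt (dot2 z z))^-1.
  apply: cvgV; first by rewrite gt_eqF// sqrtr_gt0.
  apply: (@continuous_comp _ _ _ (fun w => dot2 w w) (@Num.sqrt R)); last exact: sqrt_continuous.
  exact: (dot2_continuous (@continuous_fun_id _) (@continuous_fun_id _)).
have c1 : (fun w : R * R => w.1) @ z --> z.1 by exact: cvg_fst.
have c2 : (fun w : R * R => w.2) @ z --> z.2 by exact: cvg_snd.
exact: (cvg_pair (cvgM cs c1) (cvgM cs c2)).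
Qed.

Lemma within_glue (T U : topologicalType) (A B : set T) (f g : T -> U) :
  closed A -> closed B -> {within A, continuous f} -> {within B, continuous g} ->
  (forall x, A x -> B x -> f x = g x) ->
  {within A `|` B, continuous (fun x => if pselect (A x) then f x else g x)}.
Proof.
move=> cA cB cf cg fg; set h := fun x => _.
have hA x : A x -> h x = f x by rewrite /h; case: pselect.
have hB x : B x -> h x = g x by rewrite /h; case: pselect => // Ax Bx; exact: fg.
apply: withinU_continuous => //.
  by apply: subspace_eq_continuous cf => x; rewrite inE => /hA e; exact: esym e.
by apply: subspace_eq_continuous cg => x; rewrite inE => /hB e; exact: esym e.
Qed.

(* Otherwise [g/|g|], continued outside [V] by the direction of [(z - a)^n], would
   contract the winding [n] of [(z - a)^n] along a large circle. *)
Lemma boundary_winding (V : set (R * R)) (a : R * R) (M : R) (n : nat) (g : R * R -> R * R) :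
  open V -> V a -> (forall z, V z -> dot2 (z - a) (z - a) < M) -> continuous g ->
  (forall z, closure V z -> g z <> 0) ->
  (forall z, closure V z -> ~ V z -> exists2 t, is_arg (g z) t & is_arg (cpow (z - a) n) t) ->
  n = 0%N.
Proof.
move=> oV Va VM cg g0 gb; apply: circle_winding.
have M0 : 0 < M by apply: le_lt_trans (VM _ Va); rewrite subrr /dot2/= !mulr0 addr0.
pose h z := if pselect (closure V z) then unit2 (g z) else unit2 (cpow (z - a) n).
have ch : continuous h.
  have : {within closure V `|` ~` V, continuous h}.
    apply: within_glue.
    - exact: closed_closure.
    - exact: open_closedC.
    - apply: continuous_in_subspaceT => z; rewrite inE => Vz.
      by apply: (@continuous_comp _ _ _ g unit2); [exact: cg|apply/continuous_unit2/g0].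
    - apply: continuous_in_subspaceT => z; rewrite inE => Vz.
      apply: (@continuous_comp _ _ _ (fun z => cpow (z - a) n) unit2); first by apply: continuous_cpow; continuity.
      by apply/continuous_unit2/cpow_neq0 => /eqP; rewrite subr_eq0 => /eqP e; apply: Vz; rewrite e.
    - by move=> z Vz nVz; have [t /is_arg_unit2 -> /is_arg_unit2 ->] := gb _ Vz nVz.
  have -> : closure V `|` ~` V = setT.
    by rewrite -subTset => z _; case: (pselect (V z)) => Vz; [left; exact: subset_closure|right].
  by move=> c x; move: (c x); rewrite /continuous_at nbhs_subspaceT.
have h0 z : h z <> 0.
  have u0 w : w <> 0 -> unit2 w <> 0.
    by move=> /is_arg_ex[t ht]; rewrite (is_arg_unit2 ht); apply: (@is_arg_neq0 _ _ t); exists 1; rewrite ?mul1r.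
  rewrite /h; case: pselect => Vz; first exact/u0/g0.
  apply/u0/cpow_neq0 => /eqP; rewrite subr_eq0 => /eqP e.
  by apply: Vz; rewrite e; exact: subset_closure.
(* [M] bounds the squared distance to [a], so the circle of radius [M + 1] lies off [closure V],
   where [h] is the direction of [cpow (z - a) n]. [H] shrinks this circle to the point [a]. *)
pose S := M + 1; have S0 : 0 < S by rewrite addr_gt0.
pose H t x := h (a + (t * S) *: x).
have : has_arg (@circle R) (H 1).
  apply: (arg_homotopy circle_compact).
  - by apply: (continuous_fun_comp ch); continuity.
  - by move=> t x _ _; exact: h0.
  - have [t ht] := is_arg_ex (h0 a).
    by exists (fun=> t); split=> [|x _]; [exact/continuous_subspaceT/continuous_fun_const|rewrite /H mul0r scale0r addr0].
move=> [phi [cphi hphi]]; exists phi; split=> // x cx.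
have := hphi x cx; rewrite /H /h mul1r [a + _]addrC addrK.
case: pselect => [Vx|nVx]; last first.
  have x0 : S *: x <> 0.
    move=> /eqP; rewrite scaler_eq0 (gt_eqF S0)/= => /eqP ex.
    by move: cx; rewrite ex /circle/= expr0n/= addr0 => /eqP; rewrite eq_sym oner_eq0.
  have [t ht] := is_arg_ex x0; rewrite (is_arg_unit2 (is_argX n ht)).
  have := @is_argZ R (S *: x) t S^-1 _ ht; rewrite invr_gt0 => /(_ S0) /=.
  rewrite !mulKf ?gt_eqF//; have -> : (x.1, x.2) = x by case: (x).
  move=> /(is_argX n)[c c0 ->] [d d0 e]; exists (c * d); first exact: mulr_gt0.
  by case: e => -> ->; rewrite !mulrA.
have : closure [set z | dot2 (z - a) (z - a) <= M] (S *: x + a).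
  by apply: closureS Vx => z /VM/ltW.
have cM : closed [set z : R * R | dot2 (z - a) (z - a) <= M].
  apply: (@closed_comp _ _ (fun z => dot2 (z - a) (z - a)) [set t | t <= M]); last exact: closed_le.
  by move=> z _; apply: dot2_continuous; continuity.
rewrite -(closure_id _).1//= addrK /dot2/=.
have -> : S *: x.1 * (S *: x.1) + S *: x.2 * (S *: x.2) = S ^+ 2.
  by rewrite -[RHS]mulr1 -cx; rewrite /GRing.scale/=; ring.
by rewrite /S; nra.
Qed.

End Winding.

(** * Paths in open sets *)

Section Joined.
Variables (R : realType) (V : normedModType R).
Implicit Types (O : set V) (a b z : V).

(** Paths are continuous on the whole line and constrained only over [0, 1], which avoids subspace
    topologies. *)
Definition joined O a b : Prop := exists f : R -> V,
  [/\ continuous f, f 0 = a, f 1 = b & forall t, 0 <= t <= 1 -> O (f t)].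

Lemma joined_refl O a : O a -> joined O a a.
Proof. by move=> Oa; exists (fun=> a); split => //; exact: continuous_fun_const. Qed.

Lemma joined_sym O a b : joined O a b -> joined O b a.
Proof.
move=> [f [cf f0 f1 fO]]; exists (fun t => f (1 - t)); split.
- by continuity.
- by rewrite subr0.
- by rewrite subrr.
- by move=> t /andP[t0 t1]; apply: fO; rewrite subr_ge0 t1 lerBlDr lerDl.
Qed.

Lemma joined_sub O O' a b : O `<=` O' -> joined O a b -> joined O' a b.
Proof. by move=> OO [f [cf f0 f1 fO]]; exists f; split => // t /fO/OO. Qed.

Lemma joined_trans O a b z : joined O a b -> joined O b z -> joined O a z.
Proof.
move=> [f [cf f0 f1 fO]] [g [cg g0 g1 gO]].
(* At every time one of the first two terms equals [b]; subtracting [b] leaves the concatenation,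
   whose continuity needs no gluing. *)
exists (fun t => f (Num.min (t + t) 1) + g (Num.max (t + t - 1) 0) - b); split.
- by continuity.
- rewrite add0r sub0r (min_idPl _) ?ler01// (max_idPr _) ?lerN10//.
  by rewrite f0 g0 addrK.
- rewrite (min_idPr _) ?lerDl ?ler01// addrK (max_idPl _) ?ler01//.
  by rewrite f1 g1 addrAC subrr add0r.
- move=> t /andP[t0 t1]; have [h|h] := lerP (t + t) 1.
    rewrite (max_idPr _) ?subr_le0// g0 addrK; apply: fO.
    by rewrite h addr_ge0.
  rewrite f1 addrAC subrr add0r (max_idPl _) ?subr_ge0 1?ltW//; apply: gO.
  by rewrite subr_ge0 (ltW h)/= lerBlDr lerD.
Qed.

Lemma joined_segment O a b :
  (forall t, 0 <= t <= 1 -> O (a + t *: (b - a))) -> joined O a b.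
Proof.
move=> h; exists (fun t => a + t *: (b - a)); split => //.
- by continuity.
- by rewrite scale0r addr0.
- by rewrite scale1r addrC subrK.
Qed.

Lemma segment_ball (z : V) (e : R) a b t : `|a - z| < e -> `|b - z| < e -> 0 <= t <= 1 ->
  `|a + t *: (b - a) - z| < e.
Proof.
move=> ae be /andP[t0 t1].
have -> : a + t *: (b - a) - z = (1 - t) *: (a - z) + t *: (b - z).
  rewrite [in RHS]scalerBl scale1r -[in RHS]addrA [- (_ *: _) + _]addrC -scalerBr.
  by rewrite opprB addrA subrK addrAC; congr (_ + _ *: _).
apply: (le_lt_trans (ler_normD _ _)); rewrite !normrZ (ger0_norm t0) ger0_norm ?subr_ge0//.
have [->|tn] := eqVneq t 0; first by rewrite subr0 mul1r mul0r addr0.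
have tp : 0 < t by rewrite lt_def tn.
have -> : e = (1 - t) * e + t * e by rewrite -mulrDl subrK mul1r.
apply: ler_ltD; last by rewrite ltr_pM2l.
by apply: ler_wpM2l; [rewrite subr_ge0|exact: ltW].
Qed.

Lemma joined_ball O (z : V) (e : R) a b : (forall w, `|w - z| < e -> O w) ->
  `|a - z| < e -> `|b - z| < e -> joined O a b.
Proof. by move=> h ae be; apply: joined_segment => t t01; apply/h/segment_ball. Qed.

Lemma open_norm_ball O z : open O -> O z -> exists2 e : R, 0 < e & forall w, `|w - z| < e -> O w.
Proof.
move=> oO Oz; have /nbhs_ballP[e e0 he] : nbhs z O by exact: open_nbhs_nbhs.
by exists e => // w h; apply: he; rewrite -ball_normE /= distrC.
Qed.

Lemma open_joined O a : open O -> open [set z | joined O a z].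
Proof.
move=> oO; rewrite openE => z az; have Oz : O z by case: az => f [_ _ <- fO]; apply: fO; rewrite ler01 lexx.
have [e e0 he] := open_norm_ball oO Oz.
rewrite /interior; apply/nbhs_ballP; exists e => // w; rewrite -ball_normE/= => zw.
by apply: joined_trans az _; apply: (joined_ball he); rewrite ?subrr ?normr0// distrC.
Qed.

Lemma closure_joined O a z : open O -> closure [set z | joined O a z] z -> O z -> joined O a z.
Proof.
move=> oO cz Oz; have [e e0 he] := open_norm_ball oO Oz.
have [w [aw]] := cz _ (nbhsx_ballx z e e0); rewrite -ball_normE/= => zw.
by apply: joined_trans aw _; apply: (joined_ball he); rewrite ?subrr ?normr0// distrC.
Qed.

(** The points reachable from [a] inside [O] form an open and relatively closed subset of [O]. The
    path obtained runs in [O] and may leave [T]. *)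
Lemma connected_joined (T O : set V) a b :
  connected T -> open O -> T `<=` O -> T a -> T b -> joined O a b.
Proof.
move=> cT oO TO Ta Tb.
suff e : T `&` [set z | joined O a z] = T by move: Tb; rewrite -{1}e => -[].
apply: cT.
- by exists a; split => //; exact/joined_refl/TO.
- by exists [set z | joined O a z] => //; exact: open_joined.
- exists (closure [set z | joined O a z]); first exact: closed_closure.
  apply/seteqP; split => z [Tz h]; split => //; first exact: subset_closure.
  exact: closure_joined h (TO _ Tz).
Qed.

End Joined.

(** * Eilenberg's criterion for separation *)

Section ArgumentRelations.
Variable R : realType.
Implicit Types z w : R * R.

(** Negative powers use the conjugate in place of the inverse: the argument is the same, and the
    function stays polynomial, hence continuous at 0 too. *)
Definition cpowz z (k : int) : R * R :=
  match k with Posz n => cpow z n | Negz n => cpow (conj2 z) n.+1 end.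

Lemma is_argXz z a k : is_arg z a -> is_arg (cpowz z k) (k%:~R * a).
Proof.
case: k => n za; first exact: is_argX.
by rewrite NegzE mulrNz mulNr -mulrN; apply: is_argX; exact: is_arg_conj.
Qed.

Lemma cpowz_neq0 z k : z <> 0 -> cpowz z k <> 0.
Proof. by move=> /is_arg_ex[a /(is_argXz k)/is_arg_neq0]. Qed.

Lemma continuous_cpowz (T : topologicalType) k (f : T -> R * R) :
  continuous f -> continuous (fun x => cpowz (f x) k).
Proof.
by move=> cf; case: k => n; apply: continuous_cpow => //; exact: continuous_conj2.
Qed.

Lemma compact_closed2 (X : set (R * R)) : compact X -> closed X.
Proof. by apply: compact_closed; exact: norm_hausdorff. Qed.

Lemma tietze2 (X : set (R * R)) (phi : R * R -> R) : compact X -> {within X, continuous phi} ->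
  exists2 psi : R * R -> R, continuous psi & forall z, X z -> psi z = phi z.
Proof.
move=> cX cphi; have /compact_bounded[M [Mr hM]] := continuous_compact cphi cX.
have [||||psi [e cpsi _]] := @continuous_bounded_extension (R * R)%type R (@pseudometric_normal _ _) X _ phi (`|M| + 1).
- exact: compact_closed2.
- by rewrite ltr_wpDl.
- exact: cphi.
- move=> z Xz; have MM : M < `|M| + 1 by apply: (le_lt_trans (ler_norm M)); rewrite ltrDl ltr01.
  by apply: (hM _ MM); exists z.
- by exists psi => // z Xz; rewrite e// inE.
Qed.

(* Eilenberg's criterion: a multiplicative relation with continuous logarithm on [X]
   between the functions [z - q_i] is trivial at points [q_i] separated by [X]. *)
Lemma arg_relation (X : set (R * R)) (phi : R * R -> R) (q0 q1 q2 : R * R) (k0 k1 k2 : int) (M : R) :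
  compact X -> ~ X q0 -> {within X, continuous phi} ->
  (forall z, joined (~` X) q0 z -> dot2 (z - q0) (z - q0) < M) ->
  ~ X q1 -> ~ joined (~` X) q0 q1 -> ~ X q2 -> ~ joined (~` X) q0 q2 ->
  (forall z t0 t1 t2, X z -> is_arg (z - q0) t0 -> is_arg (z - q1) t1 -> is_arg (z - q2) t2 ->
    exists l : int, phi z = k0%:~R * t0 + k1%:~R * t1 + k2%:~R * t2 + l%:~R * (pi *+ 2)) ->
  k0 = 0.
Proof.
move=> cX Xq0 cphi bM Xq1 q01 Xq2 q02 rel.
(* Negating the whole relation makes [k0] nonnegative, as required by winding numbers with natural
   exponent. *)
wlog : phi k0 k1 k2 cphi rel / exists n : nat, k0 = n.
  move=> W; case: k0 rel => n rel; first by apply: (W phi n k1 k2) => //; exists n.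
  apply: oppr_inj; rewrite oppr0; apply: (W (fun z => - phi z) _ (- k1) (- k2)).
  - by move=> z; apply: cvgN; exact: cphi.
  - move=> z t0 t1 t2 Xz h0 h1 h2; have [l ->] := rel _ _ _ _ Xz h0 h1 h2; exists (- l).
    by rewrite !mulrNz; ring.
  - by exists n.+1; rewrite NegzE opprK.
move=> [n kn]; have [psi cpsi epsi] := tietze2 cX cphi.
have oX : open (~` X) := closed_openC (compact_closed2 cX).
pose V := [set z | joined (~` X) q0 z].
have nV q : ~ X q -> ~ joined (~` X) q0 q -> ~ closure V q.
  by move=> Xq nq /(closure_joined oX)/(_ Xq).
(* On the frontier of the component of [q0], which lies in [X], the function with arguments
   [psi z - k1 * t1 - k2 * t2] points in the direction of [(z - q0)^n]. It can vanish only at [q1]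
   and [q2], which are off the closure of this component. *)
rewrite kn; congr Posz; apply: (@boundary_winding R V q0 M n
  (fun z => cmul (cos (psi z), sin (psi z)) (cmul (cpowz (z - q1) (- k1)) (cpowz (z - q2) (- k2))))).
- exact: open_joined.
- exact: joined_refl.
- exact: bM.
- apply: continuous_cmul; first by continuity.
  by apply: continuous_cmul; apply: continuous_cpowz; continuity.
- move=> z Vz; apply: cmul_neq0.
    by apply: (@is_arg_neq0 _ _ (psi z)); exists 1; rewrite ?mul1r.
  by apply: cmul_neq0; apply: cpowz_neq0 => /eqP; rewrite subr_eq0 => /eqP e; move: Vz; rewrite e; apply: nV.
- move=> z Vz nVz; have Xz : X z.
    by apply: contrapT => Xz; apply: nVz; exact: (closure_joined oX).
  have ne q : ~ X q -> z - q <> 0 by move=> Xq /eqP; rewrite subr_eq0 => /eqP e; apply: Xq; rewrite -e.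
  have [t0 h0] := is_arg_ex (ne _ Xq0).
  have [t1 h1] := is_arg_ex (ne _ Xq1).
  have [t2 h2] := is_arg_ex (ne _ Xq2).
  have [l el] := rel _ _ _ _ Xz h0 h1 h2.
  exists (n%:R * t0 + l%:~R * (pi *+ 2)); last exact/is_arg2pi/is_argX.
  have -> : n%:R * t0 + l%:~R * (pi *+ 2) = psi z + ((- k1)%:~R * t1 + (- k2)%:~R * t2).
    rewrite epsi// el kn !mulrNz; ring.
  apply: is_argM; first by exists 1; rewrite ?mul1r.
  by apply: is_argM; exact: is_argXz.
Qed.

End ArgumentRelations.

(** * An arc has locally at most two sides *)

Section LocalSides.
Variable R : realType.
Implicit Types z w p q : R * R.

Lemma dot2_norm_le z (e : R) : `|z| <= e -> dot2 z z <= e ^+ 2 + e ^+ 2.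
Proof.
have k (x : R) : `|x| <= e -> x ^+ 2 <= e ^+ 2.
  by move=> h; rewrite -[x ^+ 2]real_normK ?num_real// lerXn2r// nnegrE (le_trans _ h).
by rewrite prod_normE ge_max => /andP[h1 h2]; rewrite /dot2 -!expr2 lerD// k.
Qed.

Lemma path_in_ball (f : R -> R * R) p (e : R) : continuous f -> `|f 0 - p| < e ->
  (forall t, 0 <= t <= 1 -> `|f t - p| <> e) -> forall t, 0 <= t <= 1 -> `|f t - p| < e.
Proof.
move=> cf f0 fe t /andP[t0 t1]; rewrite ltNge; apply/negP => h.
have cn : {within `[0, t], continuous (fun t => `|f t - p|)}.
  apply: continuous_subspaceT => s.
  apply: (@continuous_comp _ _ _ (fun t => f t - p) (fun z => `|z|)); last exact: norm_continuous.
  by apply: cvgB; [exact: cf|exact: cvg_cst].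
have [|c] := IVT t0 cn (v := e).
  by rewrite ge_min le_max (ltW f0) h orbT.
rewrite in_itv/= => /andP[c0 ct] ec; apply: (fe c) => //.
by rewrite c0 (le_trans ct).
Qed.

(** Images of closed subsets of [0, 1] are compact, hence closed, so the inverse of the injection is
    continuous. *)
Lemma arc_inverse (alpha : R -> R * R) : continuous alpha ->
  (forall s t, 0 <= s <= 1 -> 0 <= t <= 1 -> alpha s = alpha t -> s = t) ->
  exists2 beta : R * R -> R, {within alpha @` `[0, 1], continuous beta} &
    forall s, 0 <= s <= 1 -> beta (alpha s) = s.
Proof.
move=> ca ia.
have inv z : exists s, (alpha @` `[0, 1]) z -> 0 <= s <= 1 /\ alpha s = z.
  have [[s s01 e]|n] := pselect ((alpha @` `[0, 1]) z); last by exists 0.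
  by exists s => _; split; rewrite // -?in_itv/=; move: s01; rewrite /= in_itv.
have [beta hb] := choice inv; exists beta; last first.
  move=> s s01; have [|b01 e] := hb (alpha s); first by exists s; rewrite //= in_itv.
  exact: ia.
apply/continuous_closedP => W cW; apply/closed_subspaceP.
exists (alpha @` (`[0, 1] `&` W)).
  apply: compact_closed2; apply: continuous_compact; first exact: continuous_subspaceT.
  by apply: compact_closedI => //; exact: segment_compact.
apply/seteqP; split => z [h zA]; split => //.
- case: h => s [s01 Ws] e; have [b01 eb] := hb _ zA.
  have bs : beta z = s by apply: ia; rewrite ?e//; move: s01; rewrite /= in_itv.
  by rewrite /preimage/= /from_subspace bs.
- by have [b01 eb] := hb _ zA; exists (beta z) => //; split; rewrite //= in_itv.
Qed.

Lemma arc_has_arg (alpha : R -> R * R) q : continuous alpha ->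
  (forall s, 0 <= s <= 1 -> alpha s <> q) -> has_arg (T := R) `[0, 1] (fun s => alpha s - q).
Proof.
move=> ca aq; apply: (@has_arg_contractible _ _ _ _ (fun t s => t * s) 0).
- exact: segment_compact.
- by exists 0; rewrite /= in_itv/= lexx ler01.
- by continuity.
- by continuity.
- move=> t s /andP[t0 t1]; rewrite /= !in_itv/= => /andP[s0 s1].
  by rewrite mulr_ge0//= mulr_ile1.
- by move=> s; rewrite mul0r.
- by move=> s; rewrite mul1r.
- by move=> s; rewrite /= in_itv/= => /aq h /eqP; rewrite subr_eq0 => /eqP.
Qed.

(** Moving [q] to [q'] along a segment in the ball free of [X] is a homotopy through nonzero
    functions; at its end [z - q'] is multiplied by its own conjugate, which gives a positive
    number. *)
Lemma quotient_has_arg (X : set (R * R)) p q q' (d : R) : compact X ->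
  (forall z, `|z - p| < d -> ~ X z) -> `|q - p| < d -> `|q' - p| < d ->
  has_arg X (fun z => cmul (z - q) (conj2 (z - q'))).
Proof.
move=> cX dX qd q'd.
pose H (t : R) z := cmul (z - (q' + t *: (q - q'))) (conj2 (z - q')).
have -> : (fun z => cmul (z - q) (conj2 (z - q'))) = H 1.
  by apply/funext => z; rewrite /H scale1r [q' + _]addrC subrK.
have ne z w : `|w - p| < d -> X z -> z - w <> 0.
  by move=> wd Xz /eqP; rewrite subr_eq0 => /eqP e; apply: (dX w) => //; rewrite -e.
apply: (arg_homotopy cX).
- by apply: continuous_cmul; [continuity|apply: continuous_conj2; continuity].
- move=> t z t01 Xz; apply: cmul_neq0; first by apply: ne => //; exact: segment_ball.
  by apply/conj2_neq0/ne.
- exists (fun=> 0); split => [|z Xz]; first exact/continuous_subspaceT/continuous_fun_const.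
  rewrite /H scale0r addr0; exists (dot2 (z - q') (z - q')); first exact/dot2_gt0/ne.
  by rewrite cos0 sin0 mulr1 mulr0 /cmul /conj2 /dot2 /=; congr pair; ring.
Qed.

(* The functions [z - q_i] have arguments on the arc, their quotients on [X1]; comparing the
   two at the two ends of the arc gives integers [m], [n], and some nontrivial combination
   of the quotients of [z - q0], [z - q1], [z - q2] then has an argument on the union. *)
Lemma local_sides (alpha : R -> R * R) (X1 : set (R * R)) p (d e : R) q0 q1 q2 :
  continuous alpha ->
  (forall s t, 0 <= s <= 1 -> 0 <= t <= 1 -> alpha s = alpha t -> s = t) ->
  compact X1 -> X1 (alpha 0) -> X1 (alpha 1) -> (forall s, 0 < s < 1 -> ~ X1 (alpha s)) ->
  (forall z, `|z - p| = e -> X1 z) -> d <= e -> (forall z, `|z - p| < d -> ~ X1 z) ->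
  `|q0 - p| < d -> `|q1 - p| < d -> `|q2 - p| < d ->
  (forall s, 0 <= s <= 1 -> [/\ alpha s <> q0, alpha s <> q1 & alpha s <> q2]) ->
  let O := ~` (X1 `|` alpha @` `[0, 1]) in
  [\/ joined O q0 q1, joined O q0 q2 | joined O q1 q2].
Proof.
move=> ca ia cX1 Xa0 Xa1 Xas eX de dX q0d q1d q2d aq O.
have [//|n01] := pselect (joined O q0 q1); first by constructor 1.
have [//|n02] := pselect (joined O q0 q2); first by constructor 2.
have [//|n12] := pselect (joined O q1 q2); first by constructor 3.
exfalso.
have I0 : 0 <= (0 : R) <= 1 by rewrite lexx ler01.
have I1 : 0 <= (1 : R) <= 1 by rewrite lexx ler01.
set A := alpha @` `[0, 1].
have cA : compact A by apply: continuous_compact; [exact: continuous_subspaceT|exact: segment_compact].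
have Aq s : 0 <= s <= 1 -> A (alpha s) by exists s; rewrite //= in_itv.
have cX : compact (X1 `|` A) by exact: compactU.
have [beta cbeta hbeta] := arc_inverse ca ia.
have [a0 [ca0 ha0]] : has_arg (T := R) `[0, 1] (fun s => alpha s - q0) by apply: arc_has_arg => // s /aq[].
have [a1 [ca1 ha1]] : has_arg (T := R) `[0, 1] (fun s => alpha s - q1) by apply: arc_has_arg => // s /aq[].
have [a2 [ca2 ha2]] : has_arg (T := R) `[0, 1] (fun s => alpha s - q2) by apply: arc_has_arg => // s /aq[].
have [f [cf hf]] := quotient_has_arg cX1 dX q0d q1d.
have [g [cg hg]] := quotient_has_arg cX1 dX q1d q2d.
have itv (s : R) : 0 <= s <= 1 -> `[0, 1]%classic s by rewrite /= in_itv.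
have jump (h b b' : _ -> R) q q' s : 0 <= s <= 1 -> X1 (alpha s) ->
    (forall x, X1 x -> is_arg (cmul (x - q) (conj2 (x - q'))) (h x)) ->
    (forall x, `[0, 1]%classic x -> is_arg (alpha x - q) (b x)) ->
    (forall x, `[0, 1]%classic x -> is_arg (alpha x - q') (b' x)) ->
    exists m : int, b s - b' s = h (alpha s) + m%:~R * (pi *+ 2).
  move=> s01 Xs hh hb hb'; apply: is_arg_uniq (hh _ Xs).
  by apply: is_argM; [exact/hb/itv|apply: is_arg_conj; exact/hb'/itv].
have [m0 em0] := jump f a0 a1 q0 q1 0 I0 Xa0 hf ha0 ha1.
have [m1 em1] := jump f a0 a1 q0 q1 1 I1 Xa1 hf ha0 ha1.
have [n0 en0] := jump g a1 a2 q1 q2 0 I0 Xa0 hg ha1 ha2.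
have [n1 en1] := jump g a1 a2 q1 q2 1 I1 Xa1 hg ha1 ha2.
(* One homogeneous linear equation in two integer unknowns has a nontrivial solution. *)
have [c [d' [cd cdn]]] : exists c d' : int, c * (m0 - m1) + d' * (n0 - n1) = 0 /\ ~ (c = 0 /\ d' = 0).
  have [e0|e0] := eqVneq (n0 - n1) 0; last first.
    exists (n0 - n1), (- (m0 - m1)); split; first by rewrite mulNr mulrC subrr.
    by move=> [/eqP]; rewrite (negbTE e0).
  by exists 0, 1; rewrite e0 mul0r mulr0 addr0; split => // -[_ /eqP]; rewrite oner_eq0.
(* [F] and [P] form the same combination from the arguments of the quotients on [X1] and from those
   of the differences along the arc. The constant in [P] makes them agree at [alpha 0]; the choice
   of [c] and [d'] makes them agree at [alpha 1]. *)
pose F z := c%:~R * f z + d'%:~R * g z.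
pose P s := c%:~R * (a0 s - a1 s) + d'%:~R * (a1 s - a2 s) - (c * m0 + d' * n0)%:~R * (pi *+ 2).
pose phi z := if pselect (X1 z) then F z else (P \o beta) z.
have cphi : {within X1 `|` A, continuous phi}.
  apply: within_glue.
  - exact: compact_closed2.
  - exact: compact_closed2.
  - by move=> z; apply: cvgD; apply: cvgM; [exact: cvg_cst|exact: cf|exact: cvg_cst|exact: cg].
  - have cP : {within (`[0, 1]%classic : set R), continuous P}; last first.
      by apply: (within_comp cbeta _ cP) => z [s]; rewrite /= in_itv/= => s01 <-; rewrite hbeta.
    move=> s; apply: cvgB; last exact: cvg_cst.
    by apply: cvgD; apply: cvgM; [exact: cvg_cst|apply: cvgB; [exact: ca0|exact: ca1]|
      exact: cvg_cst|apply: cvgB; [exact: ca1|exact: ca2]].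
  - move=> z Xz [s]; rewrite /= in_itv/= => /andP[s0 s1] ez; rewrite -ez hbeta ?s0//.
    move: s0; rewrite le_eqVlt => /orP[/eqP s0|s0].
      by rewrite -s0 /F /P em0 en0 intrD !intrM; ring.
    move: s1; rewrite le_eqVlt => /orP[/eqP s1|s1]; last first.
      by exfalso; apply: (Xas s); rewrite ?s0 ?s1// ez.
    rewrite s1 /F /P em1 en1.
    have : (c * (m0 - m1) + d' * (n0 - n1))%:~R * (pi *+ 2) = 0 :> R by rewrite cd mul0r.
    rewrite !(intrD, intrM, mulrNz) => h.
    by rewrite -[LHS]subr0 -h; ring.
have rel z t0 t1 t2 : (X1 `|` A) z -> is_arg (z - q0) t0 -> is_arg (z - q1) t1 -> is_arg (z - q2) t2 ->
    exists l : int, phi z = c%:~R * t0 + (d' - c)%:~R * t1 + (- d')%:~R * t2 + l%:~R * (pi *+ 2).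
  move=> Xz h0 h1 h2; rewrite /phi; case: pselect => Xz1.
    have [l el] := is_arg_uniq (hf _ Xz1) (is_argM h0 (is_arg_conj h1)).
    have [l' el'] := is_arg_uniq (hg _ Xz1) (is_argM h1 (is_arg_conj h2)).
    exists (c * l + d' * l'); rewrite /F el el' !(intrD, intrM, mulrNz); ring.
  case: Xz => // -[s]; rewrite /= in_itv/= => s01 ez; rewrite -ez hbeta//.
  rewrite -ez in h0 h1 h2.
  have [l0 e0] := is_arg_uniq (ha0 _ (itv _ s01)) h0.
  have [l1 e1] := is_arg_uniq (ha1 _ (itv _ s01)) h1.
  have [l2 e2] := is_arg_uniq (ha2 _ (itv _ s01)) h2.
  exists (c * (l0 - l1) + d' * (l1 - l2) - (c * m0 + d' * n0)).
  rewrite /P e0 e1 e2 !(intrD, intrM, mulrNz); ring.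
have Oq q : `|q - p| < d -> (forall s, 0 <= s <= 1 -> alpha s <> q) -> ~ (X1 `|` A) q.
  move=> qd qa [/(dX _ qd)//|[s]]; rewrite /= in_itv/= => s01; exact: qa.
have O0 : ~ (X1 `|` A) q0 by apply: Oq => // s /aq[].
have O1 : ~ (X1 `|` A) q1 by apply: Oq => // s /aq[].
have O2 : ~ (X1 `|` A) q2 by apply: Oq => // s /aq[].
(* A path that avoids [X1] cannot cross the boundary of the ball of radius [e], which belongs to
   [X1]; so the component of [q] is bounded. *)
have bd q z : `|q - p| < d -> joined O q z ->
    dot2 (z - q) (z - q) < (e + e) ^+ 2 + (e + e) ^+ 2 + 1.
  move=> qd [h [ch h0 h1 hO]].
  have hz : `|z - p| < e.
    rewrite -h1; apply: (path_in_ball ch); rewrite ?h0 ?(lt_le_trans qd) ?lexx ?ler01//.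
    by move=> t /hO Oht /eX Xht; apply: Oht; left.
  apply: (@le_lt_trans _ _ ((e + e) ^+ 2 + (e + e) ^+ 2)); last by rewrite ltrDl.
  apply: dot2_norm_le; rewrite -(subrK p z) -addrA.
  apply: (le_trans (ler_normD _ _)); apply: lerD; first exact: ltW.
  by rewrite distrC ltW// (lt_le_trans qd).
have sy q q' : ~ joined O q q' -> ~ joined O q' q by move=> h /joined_sym.
(* The coefficients of the relation are [c], [d' - c] and [- d']: the criterion at [q0] kills [c],
   and at [q2] it kills [d']. *)
apply: cdn; split.
- by apply: (@arg_relation _ _ phi q0 q1 q2 _ _ _ _ cX O0 cphi (fun z => @bd q0 z q0d)) rel.
- apply: oppr_inj; rewrite oppr0.
  apply: (@arg_relation _ _ phi q2 q0 q1 _ c (d' - c) _ cX O2 cphi (fun z => @bd q2 z q2d)) => //.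
  + exact: sy.
  + exact: sy.
  + move=> z t2 t0 t1 Xz h2 h0 h1; have [l ->] := rel _ _ _ _ Xz h0 h1 h2; exists l; ring.
Qed.

End LocalSides.

(** * Nonplanarity of the complete bipartite graph on 3 + 3 vertices *)

Section Increments.
Variable R : realType.
Implicit Types (f g h : R -> R * R).

Definition increment f (d : R) : Prop := exists phi : R -> R,
  [/\ {within (`[0, 1]%classic : set R), continuous phi},
      forall s, 0 <= s <= 1 -> is_arg (f s) (phi s) & d = phi 1 - phi 0].

Lemma increment_uniq f d d' : increment f d -> increment f d' -> d = d'.
Proof.
move=> [phi [cphi hphi ->]] [psi [cpsi hpsi ->]].
have e : phi 0 - psi 0 = phi 1 - psi 1.
  apply: (@integral_valued_constant R _ _ (fun s => phi s - psi s) (@segment_connected R 0 1)).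
  - by move=> s; apply: cvgB; [exact: cphi|exact: cpsi].
  - move=> s; rewrite /= in_itv/= => s01.
    by have [n ->] := is_arg_uniq (hphi _ s01) (hpsi _ s01); exists n; rewrite addrC addKr.
  - by rewrite /= in_itv/= lexx ler01.
  - by rewrite /= in_itv/= lexx ler01.
by lra.
Qed.

Lemma increment_opp f d : increment f d -> increment (fun s => - f s) d.
Proof.
move=> [phi [cphi hphi ->]]; exists (fun s => phi s + pi); split.
- by move=> s; apply: cvgD; [exact: cphi|exact: cvg_cst].
- by move=> s /hphi; exact: is_argN.
- by rewrite opprD addrACA subrr addr0.
Qed.

Lemma increment_mod f d a b : increment f d -> is_arg (f 0) a -> is_arg (f 1) b ->
  exists n : int, d = b - a + n%:~R * (pi *+ 2).
Proof.
move=> [phi [cphi hphi ->]] h0 h1.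
have [|n0 e0] := is_arg_uniq (hphi 0 _) h0; first by rewrite lexx ler01.
have [|n1 e1] := is_arg_uniq (hphi 1 _) h1; first by rewrite lexx ler01.
by exists (n1 - n0); rewrite e0 e1 intrD mulrNz; ring.
Qed.

Lemma within_slice (phi : R * R -> R) (l : R -> R * R) : continuous l ->
  (forall s, 0 <= s <= 1 -> 0 <= (l s).1 <= 1 /\ 0 <= (l s).2 <= 1) ->
  {within (`[0, 1] `*` `[0, 1])%classic, continuous phi} ->
  {within (`[0, 1]%classic : set R), continuous (phi \o l)}.
Proof.
move=> cl hl cphi; apply: within_comp cphi; first exact: continuous_subspaceT.
by move=> s; rewrite /= !in_itv/= => /hl.
Qed.

(** [f s - g t] has an argument on the whole square, so its changes along the four sides sum to zero
    around the boundary. *)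
Lemma increment_square f g : continuous f -> continuous g ->
  (forall s t, 0 <= s <= 1 -> 0 <= t <= 1 -> f s <> g t) ->
  exists d0 d1 e0 e1,
    [/\ increment (fun s => f s - g 0) d0, increment (fun s => f s - g 1) d1,
        increment (fun s => g s - f 0) e0, increment (fun s => g s - f 1) e1 & d0 + e1 = e0 + d1].
Proof.
move=> cf cg fg.
have I0 : 0 <= (0 : R) <= 1 by rewrite lexx ler01.
have I1 : 0 <= (1 : R) <= 1 by rewrite lexx ler01.
have [phi [cphi hphi]] : has_arg (T := (R * R)%type) (`[0, 1] `*` `[0, 1])%classic (fun p => f p.1 - g p.2).
  apply: (@has_arg_contractible R (R * R)%type _ _ (fun t p => (t * p.1, t * p.2)) (0, 0)).
  - by apply: compact_setX; exact: segment_compact.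
  - by exists (0, 0); split; rewrite /= in_itv/= lexx ler01.
  - by continuity.
  - by continuity.
  - move=> t s /andP[t0 t1] [/=]; rewrite !in_itv/= => /andP[s0 s1] /andP[s2 s3].
    by rewrite !mulr_ge0//= !mulr_ile1.
  - by move=> s; rewrite !mul0r.
  - by move=> s; rewrite !mul1r; case: s.
  - move=> s [/=]; rewrite !in_itv/= => h1 h2 /eqP; rewrite subr_eq0 => /eqP; exact: fg.
have ph s t : 0 <= s <= 1 -> 0 <= t <= 1 -> is_arg (f s - g t) (phi (s, t)).
  by move=> s01 t01; apply: (hphi (s, t)); split; rewrite /= in_itv.
exists (phi (1, 0) - phi (0, 0)), (phi (1, 1) - phi (0, 1)),
  (phi (0, 1) - phi (0, 0)), (phi (1, 1) - phi (1, 0)); split.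
- exists (phi \o (fun s => (s, 0))); split => //; last by move=> s s01; exact: ph.
  by apply: within_slice cphi => //; continuity.
- exists (phi \o (fun s => (s, 1))); split => //; last by move=> s s01; exact: ph.
  by apply: within_slice cphi => //; continuity.
- have -> : (fun s => g s - f 0) = (fun s => - (f 0 - g s)) by apply/funext => s; rewrite opprB.
  apply: increment_opp; exists (phi \o (fun s => (0, s))); split => //; last by move=> s s01; exact: ph.
  by apply: within_slice cphi => //; continuity.
- have -> : (fun s => g s - f 1) = (fun s => - (f 1 - g s)) by apply/funext => s; rewrite opprB.
  apply: increment_opp; exists (phi \o (fun s => (1, s))); split => //; last by move=> s s01; exact: ph.
  by apply: within_slice cphi => //; continuity.
- by ring.
Qed.

(* The squares [e x e'] over the 18 pairs of disjoint edges give 18 relations between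
   angle increments; modulo 2 the sum of the integral parts is odd on one side only. *)
Lemma no_planar_K33 (a b : nat -> R * R) (g : nat -> nat -> R -> R * R) :
  (forall i j, (i < 3)%N -> (j < 3)%N -> [/\ continuous (g i j), g i j 0 = a i & g i j 1 = b j]) ->
  ~ (forall i j k l s t, (i < 3)%N -> (j < 3)%N -> (k < 3)%N -> (l < 3)%N -> i != k -> j != l ->
     0 <= s <= 1 -> 0 <= t <= 1 -> g i j s <> g k l t).
Proof.
move=> hg dis.
have I0 : 0 <= (0 : R) <= 1 by rewrite lexx ler01.
have I1 : 0 <= (1 : R) <= 1 by rewrite lexx ler01.
have oth i : exists l, (l < 3)%N /\ i != l by case: i => [|i]; [exists 1%N|exists 0%N].
have sq i j k l : (i < 3)%N -> (j < 3)%N -> (k < 3)%N -> (l < 3)%N -> i != k -> j != l ->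
    exists d0 d1 e0 e1 : R, [/\ increment (fun s => g i j s - a k) d0, increment (fun s => g i j s - b l) d1,
      increment (fun s => g k l s - a i) e0, increment (fun s => g k l s - b j) e1 & d0 + e1 = e0 + d1].
  move=> i3 j3 k3 l3 ik jl.
  have [c1 <- <-] := hg i j i3 j3; have [c2 <- <-] := hg k l k3 l3.
  by apply: increment_square => // s t; exact: dis.
have [A hA] : exists A : nat -> nat -> nat -> R, forall i j k, (i < 3)%N -> (j < 3)%N -> (k < 3)%N ->
    i != k -> increment (fun s => g i j s - a k) (A i j k).
  have ex (p : nat * nat * nat) : exists d : R, (p.1.1 < 3)%N -> (p.1.2 < 3)%N -> (p.2 < 3)%N ->
      p.1.1 != p.2 -> increment (fun s => g p.1.1 p.1.2 s - a p.2) d.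
    case: p => -[i j] k /=; have [l [l3 jl]] := oth j.
    case: (boolP [&& i < 3, j < 3, k < 3 & i != k])%N => [/and4P[i3 j3 k3 ik]|n].
      by have [d [_ [_ [_ [h _ _ _ _]]]]] := sq _ _ _ _ i3 j3 k3 l3 ik jl; exists d.
    by exists 0 => i3 j3 k3 ik; rewrite i3 j3 k3 ik in n.
  by have [A hA] := choice ex; exists (fun i j k => A (i, j, k)) => i j k; exact: (hA (i, j, k)).
have [B hB] : exists B : nat -> nat -> nat -> R, forall i j l, (i < 3)%N -> (j < 3)%N -> (l < 3)%N ->
    j != l -> increment (fun s => g i j s - b l) (B i j l).
  have ex (p : nat * nat * nat) : exists d : R, (p.1.1 < 3)%N -> (p.1.2 < 3)%N -> (p.2 < 3)%N ->
      p.1.2 != p.2 -> increment (fun s => g p.1.1 p.1.2 s - b p.2) d.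
    case: p => -[i j] l /=; have [k [k3 ik]] := oth i.
    case: (boolP [&& i < 3, j < 3, l < 3 & j != l])%N => [/and4P[i3 j3 l3 jl]|n].
      by have [_ [d [_ [_ [_ h _ _ _]]]]] := sq _ _ _ _ i3 j3 k3 l3 ik jl; exists d.
    by exists 0 => i3 j3 l3 jl; rewrite i3 j3 l3 jl in n.
  by have [B hB] := choice ex; exists (fun i j k => B (i, j, k)) => i j k; exact: (hB (i, j, k)).
have sub0 (z w : R * R) : z <> w -> z - w <> 0 by move=> n /eqP; rewrite subr_eq0 => /eqP.
have argex (z : nat -> nat -> R * R) (P : nat -> nat -> Prop) :
    (forall i j, P i j -> z i j <> 0) -> exists t : nat -> nat -> R, forall i j, P i j -> is_arg (z i j) (t i j).
  move=> hz; have ex (p : nat * nat) : exists t, P p.1 p.2 -> is_arg (z p.1 p.2) t.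
    have [h|n] := pselect (P p.1 p.2); last by exists 0.
    by have [t ht] := is_arg_ex (hz _ _ h); exists t.
  by have [t ht] := choice ex; exists (fun i j => t (i, j)) => i j; exact: (ht (i, j)).
have [|al0 hal0] := argex (fun i k => a i - a k) (fun i k => [/\ (i < 3)%N, (k < 3)%N & i != k]).
  move=> i k [i3 k3 ik]; apply: sub0; have [_ <- _] := hg i 0%N i3 isT; have [_ <- _] := hg k 1%N k3 isT.
  exact: dis.
have [|be0 hbe0] := argex (fun i k => b i - b k) (fun i k => [/\ (i < 3)%N, (k < 3)%N & i != k]).
  move=> j l [j3 l3 jl]; apply: sub0; have [_ _ <-] := hg 0%N j isT j3; have [_ _ <-] := hg 1%N l isT l3.
  exact: dis.
have [|ga hga] := argex (fun k j => b j - a k) (fun k j => (k < 3)%N /\ (j < 3)%N).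
  move=> k j [k3 j3]; have [i [i3 ki]] := oth k; have [l [l3 jl]] := oth j.
  apply: sub0; have [_ _ <-] := hg i j i3 j3; have [_ <- _] := hg k l k3 l3.
  by apply: dis => //; rewrite eq_sym.
(* The arguments of two opposite differences are chosen exactly [pi] apart, according to the order
   of the indices; these half turns produce the odd parity. *)
pose al i k := if (i < k)%N then al0 i k else al0 k i + pi.
pose be i k := if (i < k)%N then be0 i k else be0 k i + pi.
have hal i k : (i < 3)%N -> (k < 3)%N -> i != k -> is_arg (a i - a k) (al i k).
  move=> i3 k3 ik; rewrite /al; case: ifP => _; first exact: hal0.
  by rewrite -opprB; apply: is_argN; apply: hal0; split; rewrite // eq_sym.
have hbe i k : (i < 3)%N -> (k < 3)%N -> i != k -> is_arg (b i - b k) (be i k).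
  move=> i3 k3 ik; rewrite /be; case: ifP => _; first exact: hbe0.
  by rewrite -opprB; apply: is_argN; apply: hbe0; split; rewrite // eq_sym.
have [m hm] : exists m : nat * nat * nat -> int, forall p, (p.1.1 < 3)%N -> (p.1.2 < 3)%N -> (p.2 < 3)%N ->
    p.1.1 != p.2 -> A p.1.1 p.1.2 p.2 = ga p.2 p.1.2 - al p.1.1 p.2 + (m p)%:~R * (pi *+ 2).
  suff ex (p : nat * nat * nat) : exists n : int, (p.1.1 < 3)%N -> (p.1.2 < 3)%N -> (p.2 < 3)%N ->
      p.1.1 != p.2 -> A p.1.1 p.1.2 p.2 = ga p.2 p.1.2 - al p.1.1 p.2 + n%:~R * (pi *+ 2).
    by have [m hm] := choice ex; exists m.
  case: p => -[i j] k /=.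
  case: (boolP [&& i < 3, j < 3, k < 3 & i != k])%N => [/and4P[i3 j3 k3 ik]|n]; last first.
    by exists 0 => i3 j3 k3 ik; rewrite i3 j3 k3 ik in n.
  have [_ g0 g1] := hg i j i3 j3.
  have [||n hn] := increment_mod (hA i j k i3 j3 k3 ik) (a := al i k) (b := ga k j).
  - by rewrite g0; exact: hal.
  - by rewrite g1; exact: hga.
  - by exists n.
have [m' hm'] : exists m : nat * nat * nat -> int, forall p, (p.1.1 < 3)%N -> (p.1.2 < 3)%N -> (p.2 < 3)%N ->
    p.1.2 != p.2 -> B p.1.1 p.1.2 p.2 = be p.1.2 p.2 - (ga p.1.1 p.2 + pi) + (m p)%:~R * (pi *+ 2).
  suff ex (p : nat * nat * nat) : exists n : int, (p.1.1 < 3)%N -> (p.1.2 < 3)%N -> (p.2 < 3)%N ->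
      p.1.2 != p.2 -> B p.1.1 p.1.2 p.2 = be p.1.2 p.2 - (ga p.1.1 p.2 + pi) + n%:~R * (pi *+ 2).
    by have [m' hm'] := choice ex; exists m'.
  case: p => -[i j] l /=.
  case: (boolP [&& i < 3, j < 3, l < 3 & j != l])%N => [/and4P[i3 j3 l3 jl]|n]; last first.
    by exists 0 => i3 j3 l3 jl; rewrite i3 j3 l3 jl in n.
  have [_ g0 g1] := hg i j i3 j3.
  have [||n hn] := increment_mod (hB i j l i3 j3 l3 jl) (a := ga i l + pi) (b := be j l).
  - by rewrite g0 -opprB; apply: is_argN; exact: hga.
  - by rewrite g1; exact: hbe.
  - by exists n.
have p2 : (pi *+ 2 : R) != 0 by rewrite mulrn_eq0/= gt_eqF// pi_gt0.
(* In the square relation the angles cancel up to half turns: the differences of the [a] contribute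
   [pi], those of the [b] contribute [pi] if [j < l] and [- pi] otherwise, in total one full turn or
   none. *)
have eqn i j k l : (i < 3)%N -> (j < 3)%N -> (k < 3)%N -> (l < 3)%N -> (i < k)%N -> j != l ->
    m (i, j, k) + m' (k, l, j) - m (k, l, i) - m' (i, j, l) = - ((j < l)%N : nat)%:Z.
  move=> i3 j3 k3 l3 ik jl; have ik' : i != k by rewrite neq_ltn ik.
  have [d0 [d1 [e0 [e1 [h1 h2 h3 h4 e]]]]] := sq _ _ _ _ i3 j3 k3 l3 ik' jl.
  move: e; rewrite (increment_uniq h1 (hA _ _ _ i3 j3 k3 ik')) (increment_uniq h2 (hB _ _ _ i3 j3 l3 jl)).
  have ki : k != i by rewrite eq_sym.
  have lj : l != j by rewrite eq_sym.
  rewrite (increment_uniq h3 (hA _ _ _ k3 l3 i3 ki)) (increment_uniq h4 (hB _ _ _ k3 l3 j3 lj)).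
  rewrite (hm (i, j, k))// (hm (k, l, i))// (hm' (i, j, l))// (hm' (k, l, j))//=.
  rewrite /al /be ik (ltnNge k i) (ltnW ik)/=.
  have -> : (l < j)%N = ~~ (j < l)%N by rewrite ltnNge leq_eqVlt (negbTE jl).
  move=> e; set x := m (i, j, k) + _ - _ - _.
  suff h u : u = (j < l)%N -> (x + (u : nat)%:Z)%:~R * (pi *+ 2) = 0 :> R.
    move/eqP: (h _ erefl); rewrite mulf_eq0 (negbTE p2) orbF intr_eq0 addr_eq0 => /eqP ->.
    by [].
  move=> ue; rewrite -ue in e; move/eqP: e; rewrite -subr_eq0 => /eqP e; rewrite -{}e.
  by case: u {ue} => /=; rewrite /x !(intrD, mulrNz); ring.
(* Summed over [i < k] and [j != l], each [m] and each [m'] occurs twice up to sign, so the left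
   sides have an even sum; the right sides sum to - 9. *)
have E i j k l i3 j3 k3 l3 ik jl := eqn i j k l i3 j3 k3 l3 ik jl.
have := (E 0 1 1 0 isT isT isT isT isT isT, E 0 2 1 0 isT isT isT isT isT isT, E 0 2 1 1 isT isT isT isT isT isT)%N.
have := (E 0 0 1 1 isT isT isT isT isT isT, E 0 0 1 2 isT isT isT isT isT isT, E 0 1 1 2 isT isT isT isT isT isT)%N.
have := (E 0 1 2 0 isT isT isT isT isT isT, E 0 2 2 0 isT isT isT isT isT isT, E 0 2 2 1 isT isT isT isT isT isT)%N.
have := (E 0 0 2 1 isT isT isT isT isT isT, E 0 0 2 2 isT isT isT isT isT isT, E 0 1 2 2 isT isT isT isT isT isT)%N.
have := (E 1 1 2 0 isT isT isT isT isT isT, E 1 2 2 0 isT isT isT isT isT isT, E 1 2 2 1 isT isT isT isT isT isT)%N.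
have := (E 1 0 2 1 isT isT isT isT isT isT, E 1 0 2 2 isT isT isT isT isT isT, E 1 1 2 2 isT isT isT isT isT isT)%N.
move=> /= [[? ?] ?] [[? ?] ?] [[? ?] ?] [[? ?] ?] [[? ?] ?] [[? ?] ?].
lia.
Qed.

End Increments.

(** * From paths to continua *)

Section K33Continua.
Variable R : realType.

Definition trace (f : R -> R * R) : set (R * R) := f @` `[0, 1]%classic.

Lemma traceP (f : R -> R * R) s : 0 <= s <= 1 -> trace f (f s).
Proof. by exists s; rewrite //= in_itv. Qed.

Lemma closed_trace (f : R -> R * R) : continuous f -> closed (trace f).
Proof.
move=> cf; apply: compact_closed2; apply: continuous_compact; last exact: segment_compact.
exact: continuous_subspaceT.
Qed.

Section Configuration.
Variables (e : nat -> nat -> R -> R * R).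
Hypothesis ce : forall i j, (i < 3)%N -> (j < 3)%N -> continuous (e i j).

(* [e i j] runs from the i-th hub to the continuum [T j]; replacing each [T j] in turn by
   the tripod of paths [h i] in a neighbourhood of it leaves a graph made of paths only. *)
Definition spokes (T : nat -> set (R * R)) : Prop :=
  [/\ forall i j, (i < 3)%N -> (j < 3)%N -> T j (e i j 1),
      forall j, (j < 3)%N -> closed (T j),
      forall j l, (j < 3)%N -> (l < 3)%N -> j != l -> T j `&` T l = set0 &
      forall i j l, (i < 3)%N -> (j < 3)%N -> (l < 3)%N -> j != l -> trace (e i j) `&` T l = set0].

(** [T j] lies in the open complement [O] of the other two continua and their spokes, so its three
    attaching points are joined inside [O]. The tripod may cross the spokes of [T j] itself: such
    edges share the vertex [j]. *)
Lemma spokes_tripod T j : spokes T -> (j < 3)%N -> connected (T j) ->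
  exists T', [/\ spokes T', forall l, l != j -> T' l = T l &
    exists t, forall i, (i < 3)%N -> joined (T' j) (e i j 1) t].
Proof.
move=> [Te Tc Td Tt] j3 cT.
have [l1 [l2 [l13 l23 l1j l2j hl]]] : exists l1 l2, [/\ (l1 < 3)%N, (l2 < 3)%N, l1 != j, l2 != j &
    forall l, (l < 3)%N -> l != j -> l = l1 \/ l = l2].
  case: j j3 {Te Tc Td Tt cT} => [|[|[|//]]] _.
  - by exists 1%N, 2%N; split => // -[|[|[|//]]] //; [left|right].
  - by exists 0%N, 2%N; split => // -[|[|[|//]]] //; [left|right].
  - by exists 0%N, 1%N; split => // -[|[|[|//]]] //; [left|right].
pose C l := T l `|` (trace (e 0%N l) `|` (trace (e 1%N l) `|` trace (e 2%N l))).
have cC l : (l < 3)%N -> closed (C l).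
  by move=> l3; apply: closedU; [exact: Tc|do ![apply: closedU|apply: closed_trace; exact: ce]].
have Ce i l : (i < 3)%N -> trace (e i l) `<=` C l.
  by move=> + z hz; case: i hz => [|[|[|//]]] hz _; right; [left|right; left|right; right].
have CT l : (l < 3)%N -> l != j -> T j `&` C l = set0.
  move=> l3 lj; rewrite -subset0 => z [Tz [Tlz|ez]].
    by have : (T l `&` T j) z by []; rewrite Td.
  have [i [i3 ei]] : exists i, (i < 3)%N /\ trace (e i l) z.
    by case: ez => [?|[?|?]]; [exists 0%N|exists 1%N|exists 2%N].
  by have : (trace (e i l) `&` T j) z by []; rewrite Tt.
pose O := ~` (C l1 `|` C l2).
have oO : open O by apply/closed_openC/closedU; exact: cC.
have TO : T j `<=` O.
  move=> z Tz [h|h]; first by have : (T j `&` C l1) z by []; rewrite CT.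
  by have : (T j `&` C l2) z by []; rewrite CT.
pose t := e 0%N j 1.
have ex (i : nat) : exists h : R -> R * R, (i < 3)%N -> [/\ continuous h, h 0 = e i j 1, h 1 = t & trace h `<=` O].
  have [i3|i3] := boolP (i < 3)%N; last by exists (fun=> 0).
  have [h [ch h0 h1 hO]] := connected_joined cT oO TO (Te i j i3 j3) (Te 0%N j isT j3).
  by exists h => _; split => // z [s]; rewrite /= in_itv/= => /hO + <-.
have [h hh] := choice ex.
pose W := trace (h 0%N) `|` (trace (h 1%N) `|` trace (h 2%N)).
have WO : W `<=` O by move=> z [?|[?|?]]; [have [_ _ _] := hh 0%N isT|have [_ _ _] := hh 1%N isT|have [_ _ _] := hh 2%N isT]; exact.
have hW i : (i < 3)%N -> trace (h i) `<=` W.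
  by move=> + z hz; case: i hz => [|[|[|//]]] hz _; [left|right; left|right; right].
have WC l z : (l < 3)%N -> l != j -> W z -> C l z -> False.
  by move=> l3 lj /WO Oz Cz; apply: Oz; have [<-|<-] := hl _ l3 lj; [left|right].
exists (fun l => if l == j then W else T l); split; last 2 first.
- by move=> l /negbTE ->.
- exists t => i i3; rewrite eqxx; have [ch h0 h1 _] := hh i i3; exists (h i); split => // s s01.
  exact/(hW _ i3)/traceP.
split.
- move=> i l i3 l3; case: eqP => [->|_]; last exact: Te.
  have [_ <- _ _] := hh i i3; apply/(hW _ i3)/traceP; by rewrite lexx ler01.
- move=> l l3; case: eqP => _; last exact: Tc.
  have c i : (i < 3)%N -> closed (trace (h i)) by move=> i3; apply: closed_trace; have [] := hh i i3.
  by do 2?[apply: closedU]; exact: c.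
- move=> l l' l3 l'3; case: (eqVneq l j) => [lj|lj]; case: (eqVneq l' j) => [l'j|l'j] ll'.
  + by rewrite lj l'j eqxx in ll'.
  + by rewrite -subset0 => z [Wz Tz]; apply: (WC l' z) => //; left.
  + by rewrite -subset0 => z [Tz Wz]; apply: (WC l z) => //; left.
  + exact: Td.
- move=> i l l' i3 l3 l'3; case: (eqVneq l' j) => [l'j|l'j] ll'; last exact: Tt.
  rewrite l'j in ll'; by rewrite -subset0 => z [ez Wz]; apply: (WC l z) => //; exact: (Ce i).
Qed.

(** The continua are replaced one after the other, since each tripod has to avoid those already
    built. *)
Lemma no_spokes_K33 T : spokes T -> (forall j, (j < 3)%N -> connected (T j)) ->
  (forall i j, (i < 3)%N -> (j < 3)%N -> e i j 0 = e i 0%N 0) ->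
  ~ (forall i j k l, (i < 3)%N -> (j < 3)%N -> (k < 3)%N -> (l < 3)%N -> i != k -> j != l ->
       trace (e i j) `&` trace (e k l) = set0).
Proof.
move=> ST cT e0 dis.
have [T0 [ST0 T0l [t0 P0]]] := spokes_tripod ST (isT : (0 < 3)%N) (cT 0%N isT).
have [|T1 [ST1 T1l [t1 P1]]] := spokes_tripod ST0 (isT : (1 < 3)%N).
  by rewrite T0l//; exact: cT.
have [|T2 [ST2 T2l [t2 P2]]] := spokes_tripod ST1 (isT : (2 < 3)%N).
  by rewrite T1l// T0l//; exact: cT.
have [Te Tc Td Tt] := ST2.
pose t j := nth 0 [:: t0; t1; t2] j.
have ex (p : nat * nat) : exists g : R -> R * R, (p.1 < 3)%N -> (p.2 < 3)%N ->
    [/\ continuous g, g 0 = e p.1 0%N 0, g 1 = t p.2 & forall s, 0 <= s <= 1 -> (trace (e p.1 p.2) `|` T2 p.2) (g s)].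
  case: p => i j /=; have [i3|_] := boolP (i < 3)%N; last by exists (fun=> 0).
  have [j3|_] := boolP (j < 3)%N; last by exists (fun=> 0).
  suff [g [cg g0 g1 gO]] : joined (trace (e i j) `|` T2 j) (e i 0%N 0) (t j) by exists g.
  apply: (@joined_trans _ _ _ _ (e i j 1)).
    rewrite -(e0 i j i3 j3); exists (e i j); split => //; first exact: ce.
    by move=> s s01; left; exact: traceP.
  apply: (@joined_sub _ _ (T2 j)); first by move=> z; right.
  case: j j3 => [|[|[|//]]] _ /=.
  - by rewrite T2l// T1l//; exact: P0.
  - by rewrite T2l//; exact: P1.
  - exact: P2.
have [g hg] := choice ex.
apply: (@no_planar_K33 R (fun i => e i 0%N 0) t (fun i j => g (i, j))).
  by move=> i j i3 j3; have [] := hg (i, j) i3 j3.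
move=> i j k l s u i3 j3 k3 l3 ik jl s01 u01 E.
have [_ _ _ /(_ _ s01)/= h1] := hg (i, j) i3 j3.
have [_ _ _ /(_ _ u01)/= h2] := hg (k, l) k3 l3.
move: h1 h2; rewrite -E => -[h1|h1] [h2|h2].
- by have : (trace (e i j) `&` trace (e k l)) (g (i, j) s) by []; rewrite dis.
- by have : (trace (e i j) `&` T2 l) (g (i, j) s) by []; rewrite Tt.
- by have : (trace (e k l) `&` T2 j) (g (i, j) s) by []; rewrite Tt // eq_sym.
- by have : (T2 j `&` T2 l) (g (i, j) s) by []; rewrite Td.
Qed.

End Configuration.
End K33Continua.

(** * Components of compact sets *)

Section Continua.
Variables (R : realType) (T : normedModType R).
Implicit Types (A B C F G K P X : set T) (a z : T).

Lemma compact_closed_normed X : compact X -> closed X.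
Proof. by apply: compact_closed; exact: norm_hausdorff. Qed.

Lemma closed_cover_connected P A B : connected P -> closed A -> closed B ->
  A `&` B = set0 -> P = A `|` B -> A !=set0 -> B = set0.
Proof.
move=> cP cA cB AB PAB A0.
have e : A = P.
  apply: cP => //; last by exists A; rewrite // PAB setUK.
  exists (~` B); first exact: closed_openC.
  rewrite PAB setIUl setICr setU0; apply/esym/setIidl => z Az Bz.
  by have : (A `&` B) z by []; rewrite AB.
rewrite -subset0 => z Bz; rewrite -AB; split => //.
by rewrite e PAB; right.
Qed.

(** Otherwise the differences of [K] and the members of [GG] generate a proper filter; it has a
    cluster point in [K], and the member of [GG] around that point is a contradiction. *)
Lemma directed_cover K (GG : set (set T)) : compact K -> GG !=set0 ->
  (forall G G', GG G -> GG G' -> GG (G `|` G')) ->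
  (forall a, K a -> exists2 G, GG G & exists2 V, open V & V a /\ V `&` K `<=` G) ->
  exists2 G, GG G & K `<=` G.
Proof.
move=> cK [G0 GG0] GGU cov; apply: contrapT => no.
pose FF := filter_from GG (fun G => K `\` G).
have PF : ProperFilter FF.
  apply: filter_from_proper; last first.
    move=> G hG; apply/set0P/negP => /eqP e; apply: no; exists G => //.
    by rewrite -setD_eq0.
  apply: filter_from_filter; first by exists G0.
  move=> G G' hG hG'; exists (G `|` G'); first exact: GGU.
  by rewrite setDUr.
have [z [Kz cz]] : K `&` cluster FF !=set0 by apply: cK; exists G0 => // z [].
have [G hG [V oV [Vz VG]]] := cov z Kz.
have [w [[Kw nGw] Vw]] : (K `\` G) `&` V !=set0.
  by apply: cz; [exists G|exact: open_nbhs_nbhs].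
by apply: nGw; apply: VG.
Qed.

Definition clopen_in X G : Prop := [/\ closed G, G `<=` X & closed (X `\` G)].

Lemma clopen_inU X G G' : clopen_in X G -> clopen_in X G' -> clopen_in X (G `|` G').
Proof.
move=> [c1 s1 d1] [c2 s2 d2]; split; first exact: closedU.
- by rewrite subUset.
- by rewrite setDUr; exact: closedI.
Qed.

Lemma clopen_in_compl X G : closed X -> clopen_in X G -> clopen_in X (X `\` G).
Proof.
move=> cX [c1 s1 d1]; split => //.
by rewrite setDD setIC (setIidl s1).
Qed.

Lemma clopen_in_nbhs X G a : clopen_in X G -> G a -> exists2 V, open V & V a /\ V `&` X `<=` G.
Proof.
move=> [c1 s1 d1] Ga; exists (~` (X `\` G)); first exact: closed_openC.
split; first by case.
by move=> z [nz Xz]; apply: contrapT => nG; apply: nz.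
Qed.

(* In a compact set components coincide with quasi-components. *)
Lemma component_clopen X F a : compact X -> X a -> closed F ->
  connected_component X a `&` F = set0 ->
  exists G, [/\ clopen_in X G, connected_component X a `<=` G & G `&` F = set0].
Proof.
move=> cX Xa cF CF; have clX := compact_closed_normed cX.
pose GG := [set G | clopen_in X G /\ ~ G a].
have GG0 : GG set0 by split => //; split; [exact: closed0|exact: sub0set|rewrite setD0].
have GGU G G' : GG G -> GG G' -> GG (G `|` G').
  by move=> [c1 n1] [c2 n2]; split; [exact: clopen_inU|case].
(* The quasi-component of [a]. Once connected, it lies in the component, and compactness then gives
   a single clopen set that misses [F]. *)
pose Q := \bigcap_(G in GG) (X `\` G).
have QX : Q `<=` X by move=> z /(_ _ GG0)[].
have Qa : Q a by move=> G [_ nGa].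
have clQ : closed Q by apply: closed_bigI => G [[]].
have away K : closed K -> K `&` Q = set0 -> exists2 G, GG G & X `&` K `<=` G.
  move=> cK KQ; apply: directed_cover => //; first exact: compact_closedI.
    by exists set0.
  move=> z [Xz Kz]; have [G hG Gz] : exists2 G, GG G & G z.
    apply: contrapT => nz; have : (K `&` Q) z; last by rewrite KQ.
    by split => // G hG; split => // Gz; apply: nz; exists G.
  exists G => //; have [V oV [Vz VG]] := clopen_in_nbhs hG.1 Gz.
  by exists V => //; split => // w [Vw [Xw _]]; exact: VG.
(* Disjoint open sets [U], [V] around the two parts of a splitting of [Q] cover [X] up to a clopen
   [G] that misses [a]. What remains of [X] off [G] and [U] is then clopen, misses [a] and contains
   [A2], whereas [Q] meets no such set. *)
have split0 A1 A2 : closed A1 -> closed A2 -> A1 `&` A2 = set0 -> Q = A1 `|` A2 -> A1 a -> A2 = set0.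
  move=> c1 c2 A12 QA A1a.
  have [U [V [oU oV AU AV UV]]] := (@normal_openP R T).1 (@pseudometric_normal R T) A1 A2 c1 c2 A12.
  have [G hG XG] : exists2 G, GG G & X `&` ~` (U `|` V) `<=` G.
    apply: away; first exact/open_closedC/openU.
    rewrite -subset0 QA => z [nz [/AU Uz|/AV Vz]]; apply: nz; [by left|by right].
  have HUV z : X z -> ~ G z -> U z \/ V z.
    by move=> Xz nGz; apply: contrapT => h; apply: nGz; apply: XG; split.
  have nUV z : U z -> V z -> False by move=> Uz Vz; have : (U `&` V) z by []; rewrite UV.
  have [[cG sG dG] nGa] := hG.
  have hW : GG ((X `\` G) `\` U).
    split; last by move=> [_]; apply; exact: AU.
    split; first by rewrite setDE; apply: closedI => //; exact: open_closedC.
    - by move=> z [[]].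
    - have -> : X `\` ((X `\` G) `\` U) = G `|` ((X `\` G) `\` V).
        apply/seteqP; split => z.
          move=> [Xz nz]; have [Gz|nGz] := pselect (G z); first by left.
          right; split => // Vz; apply: nz; split => // Uz; exact: nUV Uz Vz.
        move=> [Gz|[[Xz nGz] nVz]]; split; first exact: sG.
        - by move=> [[]].
        - by [].
        - by move=> [_]; have [] := HUV z Xz nGz.
      by apply: closedU => //; rewrite setDE; apply: closedI => //; exact: open_closedC.
  rewrite -subset0 => z A2z; have Qz : Q z by rewrite QA; right.
  have [_ nW] := Qz _ hW; apply: nW; split; first exact: (Qz _ hG).
  by move=> Uz; exact: nUV Uz (AV _ A2z).
have cQ : connected Q.
  move=> B [b Bb] [W oW BO] [D cD BD].
  have cB : closed B by rewrite BD; exact: closedI.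
  have cB' : closed (Q `\` B).
    have -> : Q `\` B = Q `&` ~` W.
      by rewrite BO setDIr setDv set0U.
    by apply: closedI => //; exact: open_closedC.
  have BQ : B `<=` Q by rewrite BO => z [].
  have e : Q = B `|` (Q `\` B) by rewrite setDUK.
  have [Ba|nBa] := pselect (B a).
    have := split0 _ _ cB cB' (setDIK _ _) e Ba => h.
    by rewrite [RHS]e h setU0.
  have : B = set0.
    apply: (split0 _ _ cB' cB) => //; first by rewrite setIC setDIK.
    by rewrite setUC.
  by move=> B0; move: Bb; rewrite B0.
have QC : Q `<=` connected_component X a by exact: connected_component_max.
have [G hG XG] : exists2 G, GG G & X `&` F `<=` G.
  apply: away => //; rewrite -subset0 => z [Fz Qz]; rewrite -CF; split => //; exact: QC.
have hG' := clopen_in_compl clX hG.1.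
exists (X `\` G); split => //.
- have clC := @component_closed _ X a clX.
  have e : connected_component X a `&` G = set0.
    apply: (@closed_cover_connected (connected_component X a) (connected_component X a `&` (X `\` G))).
    - exact: component_connected.
    - by apply: closedI => //; case: hG'.
    - by apply: closedI => //; case: hG => -[].
    - by rewrite -subset0 => z [[_ [_ nGz]] [_ Gz]].
    - rewrite -setIUr setUC setDUK; first by rewrite setIidl //; exact: connected_component_sub.
      by case: hG => -[].
    - by exists a; split; [exact: connected_component_refl|split => //; case: hG].
  move=> z Cz; split; first exact: connected_component_sub Cz.
  by move=> Gz; have : (connected_component X a `&` G) z by []; rewrite e.
- by rewrite -subset0 => z [[Xz nGz] Fz]; apply: nGz; apply: XG.
Qed.

(** Each point of [F1] has a clopen set from [component_clopen] around it; clopen sets that miss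
    [F2] are stable under unions, so by compactness one of them suffices. *)
Lemma cut_wire X F1 F2 : compact X -> closed F1 -> closed F2 ->
  (forall a, X a -> F1 a -> connected_component X a `&` F2 = set0) ->
  exists G, [/\ clopen_in X G, X `&` F1 `<=` G & G `&` F2 = set0].
Proof.
move=> cX c1 c2 h.
have [||||G [cG G2] XG] := @directed_cover (X `&` F1) [set G | clopen_in X G /\ G `&` F2 = set0].
- exact: compact_closedI.
- by exists set0; split; [split; [exact: closed0|exact: sub0set|rewrite setD0; exact: compact_closed_normed]|rewrite set0I].
- move=> G G' [cG G2] [cG' G2']; split; first exact: clopen_inU.
  by rewrite setIUl G2 G2' setU0.
- move=> a [Xa F1a]; have [G [cG CG GF]] := component_clopen cX Xa c2 (h a Xa F1a).
  exists G => //; have [V oV [Va VG]] := clopen_in_nbhs cG (CG _ (connected_component_refl Xa)).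
  by exists V => //; split => // z [Vz [Xz _]]; exact: VG.
- by exists G.
Qed.

Lemma component_compact X a : compact X -> compact (connected_component X a).
Proof.
move=> cX; apply: (subclosed_compact _ cX); last exact: connected_component_sub.
by apply: component_closed; exact: compact_closed_normed.
Qed.

(** If no component of the part of [P] below both levels reached both of them, a clopen [G] would
    cut this part in two; adding to each half what lies beyond its level would split the connected
    [P]. *)
Lemma crossing_continuum P (f1 f2 : T -> R) (c : R) : compact P -> connected P ->
  continuous f1 -> continuous f2 ->
  (exists2 z, P z & c < f1 z) -> (exists2 z, P z & c < f2 z) ->
  (forall z, P z -> c <= f1 z -> c <= f2 z -> False) ->
  exists Q, [/\ Q `<=` P, compact Q, connected Q,
    forall z, Q z -> f1 z <= c /\ f2 z <= c &
    (exists2 z, Q z & f1 z = c) /\ (exists2 z, Q z & f2 z = c)].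
Proof.
move=> cP conP cf1 cf2 [z1 Pz1 h1] [z2 Pz2 h2] dis.
have le (f : T -> R) : continuous f -> closed [set z | f z <= c].
  by move=> cf; apply: (@closed_comp _ _ f [set t | t <= c]); [move=> ? _; exact: cf|exact: closed_le].
have ge (f : T -> R) : continuous f -> closed [set z | c <= f z].
  by move=> cf; apply: (@closed_comp _ _ f [set t | c <= t]); [move=> ? _; exact: cf|exact: closed_ge].
pose X := P `&` ([set z | f1 z <= c] `&` [set z | f2 z <= c]).
have cX : compact X by apply: compact_closedI => //; apply: closedI; exact: le.
pose F1 := [set z | c <= f1 z]; pose F2 := [set z | c <= f2 z].
have [[a [Xa F1a [b [Cb F2b]]]]|no] :=
    pselect (exists a, [/\ X a, F1 a & connected_component X a `&` F2 !=set0]).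
  have CX : connected_component X a `<=` X by exact: connected_component_sub.
  exists (connected_component X a); split.
  - by move=> z /CX[].
  - exact: component_compact.
  - exact: component_connected.
  - by move=> z /CX[_ []].
  - split; first by exists a; [exact: connected_component_refl|apply: le_anti; rewrite F1a andbT; case: Xa => _ []].
    by exists b => //; apply: le_anti; rewrite F2b andbT; have [_ [_ ]] := CX _ Cb.
exfalso.
have [a Xa F1a|G [[cG GX cG'] FG GF]] := @cut_wire X F1 F2 cX (ge _ cf1) (ge _ cf2).
  by rewrite -subset0 => z h; apply: no; exists a; split => //; exists z.
have clP := compact_closed_normed cP.
have : (X `\` G) `|` (P `&` F2) = set0.
  apply: (@closed_cover_connected P (G `|` (P `&` F1)) _ conP).
  - by apply: closedU => //; apply: closedI => //; exact: ge.
  - by apply: closedU => //; apply: closedI => //; exact: ge.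
  - rewrite -subset0 => z [[Gz|[Pz F1z]] [[Xz nGz]|[_ F2z]]] //.
    + by have : (G `&` F2) z by []; rewrite GF.
    + by apply: nGz; apply: FG.
    + exact: dis F1z F2z.
  - apply/seteqP; split => z.
      move=> Pz; have [Gz|nGz] := pselect (G z); first by left; left.
      have [F1z|/negP n1] := boolP (c <= f1 z); first by left; right.
      have [F2z|/negP n2] := boolP (c <= f2 z); first by right; right.
      by right; left; split => //; split => //; split; rewrite /= leNgt; apply/negP => /ltW.
    by move=> [[/GX[]|[]]|[[[]]|[]]].
  - by exists z1; right; split => //; exact: ltW.
move=> e; have : ((X `\` G) `|` (P `&` F2)) z2 by right; split => //; exact: ltW.
by rewrite e.
Qed.

(** Boundary bumping: a clopen piece of the intersection of [C] and [E] that misses the closure of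
    the rest of [C] would be open and closed in [C]. *)
Lemma component_meets_closure C E a : compact C -> connected C -> closed E -> C a -> E a ->
  ~ (C `<=` E) -> connected_component (C `&` E) a `&` closure (C `\` E) !=set0.
Proof.
move=> cC conC cE Ca Ea CE; apply/set0P/negP => /eqP e.
have cX : compact (C `&` E) by exact: compact_closedI.
have XA : (C `&` E) a by [].
have [G [[cG GX cG'] CG GF]] := component_clopen cX XA (@closed_closure _ _) e.
have clC := compact_closed_normed cC.
have h : ((C `&` E) `\` G) `|` (C `&` closure (C `\` E)) = set0.
  apply: (@closed_cover_connected C G _ conC) => //.
  - by apply: closedU => //; apply: closedI => //; exact: closed_closure.
  - rewrite -subset0 => z [Gz [[_ nGz]|[_ cz]]] //.
    by have : (G `&` closure (C `\` E)) z by []; rewrite GF.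
  - apply/seteqP; split => z.
      move=> Cz; have [Gz|nGz] := pselect (G z); first by left.
      have [Ez|nEz] := pselect (E z); first by right; left.
      by right; right; split => //; apply: subset_closure.
    by move=> [/GX[]|[[[]]|[]]].
  - by exists a; apply: CG; exact: connected_component_refl.
apply: CE => z Cz; apply: contrapT => nEz.
suff : ((C `&` E) `\` G `|` C `&` closure (C `\` E)) z by rewrite h.
by right; split => //; apply: subset_closure.
Qed.

End Continua.

(** * The sphere and its stereographic charts *)

Section SphereGeometry.
Variable R : realType.
Implicit Types (p q w x y z : pt R).

Lemma dotpC p q : dotp p q = dotp q p.
Proof. by rewrite /dotp; ring. Qed.

Lemma dotpDl p q w : dotp (p + q) w = dotp p w + dotp q w.
Proof. by rewrite /dotp/=; ring. Qed.

Lemma dotpDr p q w : dotp p (q + w) = dotp p q + dotp p w.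
Proof. by rewrite /dotp/=; ring. Qed.

Lemma dotpZl (a : R) p q : dotp (a *: p) q = a * dotp p q.
Proof. by rewrite /dotp/= /GRing.scale/=; ring. Qed.

Lemma dotpZr (a : R) p q : dotp p (a *: q) = a * dotp p q.
Proof. by rewrite /dotp/= /GRing.scale/=; ring. Qed.

Lemma continuous_dotp (T : topologicalType) (f g : T -> pt R) :
  continuous f -> continuous g -> continuous (fun t => dotp (f t) (g t)).
Proof. by move=> cf cg; rewrite /dotp; continuity. Qed.

Lemma continuous_dotpr x : continuous (dotp x).
Proof. by apply: continuous_dotp; [exact: continuous_fun_const|exact: continuous_fun_id]. Qed.

Lemma closed_bounded_compact3 (X : set (pt R)) (M : R) :
  closed X -> (forall z, X z -> [/\ `|z.1.1| <= M, `|z.1.2| <= M & `|z.2| <= M]) -> compact X.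
Proof.
move=> cX bX; pose I := (`[- M, M]%classic : set R).
have cI : compact I by exact: segment_compact.
apply: (subclosed_compact cX (compact_setX (compact_setX cI cI) cI)).
by move=> z /bX[h1 h2 h3]; split; [split|]; rewrite /I /= in_itv/= -ler_norml.
Qed.

Lemma closed_sphere : closed (@sphere R).
Proof. by apply: closed_eq_fun; [apply: continuous_dotp; exact: continuous_fun_id|exact: continuous_fun_const]. Qed.

Lemma compact_sphere : compact (@sphere R).
Proof.
apply: (@closed_bounded_compact3 _ 1 closed_sphere) => z; rewrite /sphere /dotp /= => h.
have k (t : R) : t ^+ 2 <= 1 -> `|t| <= 1.
  by move=> t1; rewrite -(@ler_pXn2r _ 2)// ?nnegrE// expr1n real_normK ?num_real.
by split; apply: k; nra.
Qed.

Lemma dotp_itv x y : sphere x -> sphere y -> -1 <= dotp x y <= 1.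
Proof.
rewrite /sphere /= => hx hy.
have h1 : 0 <= dotp (x + y) (x + y) by rewrite /dotp -!expr2 !addr_ge0// sqr_ge0.
have h2 : 0 <= dotp (x + (-1) *: y) (x + (-1) *: y) by rewrite /dotp -!expr2 !addr_ge0// sqr_ge0.
move: h1 h2; rewrite !dotpDl !dotpDr !dotpZl !dotpZr (dotpC y x) hx hy => h1 h2.
by apply/andP; split; lra.
Qed.

Lemma dotp_eq1 x y : sphere x -> sphere y -> dotp x y = 1 -> x = y.
Proof.
rewrite /sphere /= => hx hy h.
have : dotp (x + (-1) *: y) (x + (-1) *: y) = 0.
  by rewrite !dotpDl !dotpDr !dotpZl !dotpZr (dotpC y x) hx hy h; ring.
rewrite /dotp -!expr2 => /eqP; rewrite !paddr_eq0 ?addr_ge0 ?sqr_ge0// !sqrf_eq0.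
rewrite /= !scaleN1r => /andP[/andP[/eqP h1 /eqP h2] /eqP h3].
move: (subr0_eq h1) (subr0_eq h2) (subr0_eq h3).
by case: x y {hx hy h h1 h2 h3} => [[a b] c] [[a' b'] c'] /= -> -> ->.
Qed.

Lemma dotp_lt1 x y : sphere x -> sphere y -> x <> y -> dotp x y < 1.
Proof.
move=> hx hy xy; have /andP[_] := dotp_itv hx hy; rewrite le_eqVlt => /orP[/eqP h|//].
by case: xy; exact: dotp_eq1.
Qed.

Lemma cos_rho x y : sphere x -> sphere y -> cos (rho x y) = dotp x y.
Proof. by move=> hx hy; rewrite /rho acosK// in_itv/= dotp_itv. Qed.

Lemma rho_itv x y : sphere x -> sphere y -> 0 <= rho x y <= pi.
Proof. by move=> hx hy; rewrite acos_ge0 ?acos_lepi ?dotp_itv. Qed.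

Lemma rho_lt x y (e : R) : sphere x -> sphere y -> 0 <= e <= pi ->
  (rho x y < e) = (cos e < dotp x y).
Proof.
by move=> hx hy he; rewrite -cos_rho// ltr_cos// in_itv//= rho_itv.
Qed.

Lemma rho_le x y (e : R) : sphere x -> sphere y -> 0 <= e <= pi ->
  (rho x y <= e) = (cos e <= dotp x y).
Proof.
by move=> hx hy he; rewrite leNgt [RHS]leNgt -cos_rho// ltr_cos// in_itv//= rho_itv.
Qed.

Lemma rhoC x y : rho x y = rho y x.
Proof. by rewrite /rho dotpC. Qed.

Lemma rho_triangle x y w : sphere x -> sphere w -> sphere y -> rho x y <= rho x w + rho w y.
Proof.
move=> hx hw hy; have /andP[a0 api] := rho_itv hx hw; have /andP[b0 bpi] := rho_itv hw hy.
have [h|h] := lerP (rho x w + rho w y) pi; last first.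
  by apply: le_trans (ltW h); case/andP: (rho_itv hx hy).
rewrite rho_le ?addr_ge0// cosD !cos_rho// /rho !sin_acos ?dotp_itv//.
rewrite lerBlDr -lerBlDl -sqrtrM; last first.
  by have /andP[h1 h2] := dotp_itv hx hw; nra.
set G := _ * _; rewrite (le_trans (ler_norm _))//.
rewrite -sqrtr_sqr ler_sqrt; last first.
  have /andP[h1 h2] := dotp_itv hx hw; have /andP[h3 h4] := dotp_itv hw hy.
  by rewrite /G mulr_ge0//; nra.
(* The Gram determinant of [x], [w], [y] is the square of their determinant; its sign is the
   inequality wanted. *)
have : 0 <= (x.1.1 * (w.1.2 * y.2 - w.2 * y.1.2) - x.1.2 * (w.1.1 * y.2 - w.2 * y.1.1)
   + x.2 * (w.1.1 * y.1.2 - w.1.2 * y.1.1)) ^+ 2 by exact: sqr_ge0.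
have -> : (x.1.1 * (w.1.2 * y.2 - w.2 * y.1.2) - x.1.2 * (w.1.1 * y.2 - w.2 * y.1.1)
   + x.2 * (w.1.1 * y.1.2 - w.1.2 * y.1.1)) ^+ 2 =
   dotp x x * dotp w w * dotp y y + 2 * dotp x w * dotp w y * dotp x y
   - dotp x x * dotp w y ^+ 2 - dotp w w * dotp x y ^+ 2 - dotp y y * dotp x w ^+ 2.
  by rewrite /dotp; ring.
have -> : dotp x x = 1 by exact: hx.
have -> : dotp w w = 1 by exact: hw.
have -> : dotp y y = 1 by exact: hy.
by rewrite /G => h0; rewrite -subr_ge0; apply: le_trans h0 _; rewrite le_eqVlt; apply/orP; left; apply/eqP; ring.
Qed.

Lemma Dr_sub_open (O : set (pt R)) z : open O -> sphere z -> O z -> exists2 e : R, 0 < e & Dr e z `<=` O.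
Proof.
move=> oO hz Oz; have [e e0 he] := open_norm_ball oO Oz.
(* On the sphere the squared chord is [2 - 2 * dotp z w], so [dotp z w > 1 - e ^+ 2 / 2] means a
   chord below [e]; the maximum keeps [t] in the domain of [acos]. *)
pose t := Num.max (1 - e ^+ 2 / 2) 0.
have t1 : -1 <= t < 1.
  apply/andP; split; first by rewrite le_max lerN10 orbT.
  by rewrite gt_max ltr01 andbT gtrBl divr_gt0// exprn_gt0.
exists (acos t); first exact: acos_gt0.
move=> w [hw]; have tI : -1 <= t <= 1 by case/andP: t1 => -> /ltW ->.
rewrite rho_lt ?acos_ge0 ?acos_lepi// acosK ?in_itv//= => h.
have {h} h : 1 - e ^+ 2 / 2 < dotp z w by apply: le_lt_trans h; rewrite /t le_max lexx.
have {}h : dotp (w + (-1) *: z) (w + (-1) *: z) < e ^+ 2.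
  by rewrite !dotpDl !dotpDr !dotpZl !dotpZr (dotpC w z) hw hz; lra.
apply: he; rewrite scaleN1r /dotp -!expr2 in h.
have k (s : R) : s ^+ 2 < e ^+ 2 -> `|s| < e.
  by move=> s1; rewrite -(@ltr_pXn2r _ 2)// ?nnegrE ?ltW// real_normK ?num_real.
have h1 := sqr_ge0 (w - z).1.1; have h2 := sqr_ge0 (w - z).1.2; have h3 := sqr_ge0 (w - z).2.
by rewrite !prod_normE /= !gt_max !k //; lra.
Qed.

Lemma Dr_nbhs z (e : R) : sphere z -> 0 < e -> exists V, [/\ open V, V z & V `&` @sphere R `<=` Dr e z].
Proof.
move=> hz e0; pose f := Num.min e pi.
have f0 : 0 < f by rewrite lt_min e0 pi_gt0.
have fI : 0 <= f <= pi by rewrite ltW//= ge_min lexx orbT.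
exists [set w | cos f < dotp z w]; split.
- by apply: (@open_comp _ _ (dotp z) [set t | cos f < t]); [move=> ? _; exact: continuous_dotpr|exact: open_gt].
- by rewrite /= -rho_lt// /rho hz acos1.
- move=> w [/= h hw]; split => //; apply: (@lt_le_trans _ _ f); last by rewrite ge_min lexx.
  by rewrite rho_lt.
Qed.

Lemma DrE (r : R) z : sphere z -> 0 <= r <= pi ->
  Dr r z = [set w | sphere w /\ cos r < dotp z w].
Proof.
by move=> hz hr; apply/seteqP; split => w [hw]; rewrite ?rho_lt// => h; split => //; rewrite rho_lt.
Qed.

Lemma sphere_coordinates x : sphere x -> exists u v s c : R,
  [/\ u ^+ 2 + v ^+ 2 = 1, s ^+ 2 + c ^+ 2 = 1 & x = (s * u, s * v, c)].
Proof.
case: x => [[a b] c]; rewrite /sphere /dotp /= => h.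
have s0 : 0 <= a ^+ 2 + b ^+ 2 by rewrite addr_ge0 ?sqr_ge0.
have sq : Num.sqrt (a ^+ 2 + b ^+ 2) ^+ 2 = a ^+ 2 + b ^+ 2 by rewrite sqr_sqrtr.
set s := Num.sqrt _ in sq.
have [e|n] := eqVneq s 0.
  exists 1, 0, 0, c; rewrite e expr0n/= in sq.
  move: sq => /esym/eqP; rewrite paddr_eq0 ?sqr_ge0// !sqrf_eq0 => /andP[/eqP ea /eqP eb].
  split; [by ring|rewrite -h ea eb; ring|by rewrite ea eb !mul0r].
exists (a / s), (b / s), s, c; split.
- by rewrite !expr_div_n -mulrDl -sq divff// expf_neq0.
- by rewrite sq -h; ring.
- by rewrite ![s * _]mulrC !divfK.
Qed.

(** The unit tangent vectors along the parallel and the meridian in spherical coordinates; at a pole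
    the longitude is chosen arbitrarily. *)
Lemma frame x : sphere x -> exists e1 e2,
  [/\ [/\ dotp x e1 = 0, dotp x e2 = 0 & dotp e1 e2 = 0], dotp e1 e1 = 1, dotp e2 e2 = 1 &
      forall w, w = dotp x w *: x + dotp e1 w *: e1 + dotp e2 w *: e2].
Proof.
move=> /sphere_coordinates[u [v [s [c [uv sc ->]]]]].
exists (- v, u, 0), (- c * u, - c * v, s); rewrite /dotp/=; split.
- split; [by ring| |by ring].
  by transitivity (s * c * (1 - (u ^+ 2 + v ^+ 2))); [ring|rewrite uv subrr mulr0].
- by rewrite -uv; ring.
- by transitivity (c ^+ 2 * (u ^+ 2 + v ^+ 2) + s ^+ 2); [ring|rewrite uv mulr1 addrC].
- move=> [[a b] d] /=; congr (_, _, _); rewrite /= /GRing.scale/=.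
  + transitivity (a + (s ^+ 2 + c ^+ 2 - 1) * (u ^+ 2 * a + u * v * b) + (u ^+ 2 + v ^+ 2 - 1) * a); last by ring.
    by rewrite uv sc subrr !mul0r !addr0.
  + transitivity (b + (s ^+ 2 + c ^+ 2 - 1) * (v ^+ 2 * b + u * v * a) + (u ^+ 2 + v ^+ 2 - 1) * b); last by ring.
    by rewrite uv sc subrr !mul0r !addr0.
  + transitivity (d + (s ^+ 2 + c ^+ 2 - 1) * d); last by ring.
    by rewrite sc subrr !mul0r !addr0.
Qed.

End SphereGeometry.

(** * Stereographic projection *)

Section Stereographic.
Variable R : realType.
Implicit Types (p q w x y : pt R) (z : R * R).

Lemma dotp_frame (x e1 e2 y w : pt R) :
  (forall w, w = dotp x w *: x + dotp e1 w *: e1 + dotp e2 w *: e2) ->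
  dotp y w = dotp x w * dotp y x + dotp e1 w * dotp y e1 + dotp e2 w * dotp y e2.
Proof. by move=> h; rewrite {1}(h w) !dotpDr !dotpZr. Qed.

(** The pole of the projection is [x]. The last clause turns every function [dotp y] into a
    quadratic polynomial over [dot2 z z + 1], with leading coefficient [dotp x y]; discs of the
    sphere thus become quadratic inequalities. *)
Lemma stereographic x : sphere x -> exists (sig : pt R -> R * R) (tau : R * R -> pt R),
  [/\ continuous tau /\ (forall z, sphere (tau z)),
      forall z, sig (tau z) = z,
      forall w, sphere w -> w <> x -> tau (sig w) = w,
      forall w, dotp x w <> 1 -> {for w, continuous sig} &
      (forall z, dotp x (tau z) * (dot2 z z + 1) = dot2 z z - 1) /\
      forall y, exists y1 y2 : R, forall z,
        dotp y (tau z) * (dot2 z z + 1) = 2 * (z.1 * y1 + z.2 * y2) + (dot2 z z - 1) * dotp x y].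
Proof.
move=> hx; have [e1 [e2 [[x1 x2 e12] e11 e22 comp]]] := frame hx.
have xx : dotp x x = 1 by [].
have d0 (z : R * R) : dot2 z z + 1 != 0.
  by rewrite gt_eqF// ltr_wpDl// /dot2 addr_ge0// -expr2 sqr_ge0.
have [c [cE cc]] : exists c : R * R -> R, (forall z, c z = (dot2 z z + 1)^-1) /\ continuous c.
  exists (fun z => (dot2 z z + 1)^-1); split => // z; apply: cvgV => //.
  by apply: cvgD; [exact: (dot2_continuous (@continuous_fun_id _) (@continuous_fun_id _))|exact: cvg_cst].
pose tau (z : R * R) : pt R := (c z * 2 * z.1) *: e1 + (c z * 2 * z.2) *: e2 + (c z * (dot2 z z - 1)) *: x.
pose sig (w : pt R) : R * R := ((1 - dotp x w)^-1 * dotp e1 w, (1 - dotp x w)^-1 * dotp e2 w).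
have tx z : dotp x (tau z) = c z * (dot2 z z - 1).
  by rewrite /tau !dotpDr !dotpZr x1 x2 xx; ring.
have t1 z : dotp e1 (tau z) = c z * 2 * z.1.
  by rewrite /tau !dotpDr !dotpZr e11 e12 (dotpC e1 x) x1; ring.
have t2 z : dotp e2 (tau z) = c z * 2 * z.2.
  by rewrite /tau !dotpDr !dotpZr e22 (dotpC e2 e1) e12 (dotpC e2 x) x2; ring.
have cz z : c z * (dot2 z z + 1) = 1 by rewrite cE mulVf.
have ct : continuous tau.
  by rewrite /tau /dot2; continuity.
have sph z : sphere (tau z).
  rewrite /sphere /= (dotp_frame (tau z) (tau z) comp) !(dotpC (tau z)) tx t1 t2.
  transitivity ((c z * (dot2 z z + 1)) ^+ 2); last by rewrite cz expr1n.
  by rewrite /dot2; move: (c z) => k; ring.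
have one z : 1 - dotp x (tau z) = c z * 2.
  by rewrite tx -{1}(cz z); ring.
have c0 z : c z != 0 by rewrite cE invr_neq0.
exists sig, tau; split.
- by [].
- move=> z; rewrite /sig one t1 t2 !mulKf ?mulf_neq0 ?pnatr_eq0//; by case: z.
- move=> w hw wx; have dn : 1 - dotp x w != 0.
    by rewrite subr_eq0 eq_sym lt_eqF// dotp_lt1// => e; apply: wx.
  have ww : dotp x w ^+ 2 + dotp e1 w ^+ 2 + dotp e2 w ^+ 2 = 1.
    by rewrite -[RHS]hw (dotp_frame w w comp) !(dotpC w) !expr2.
  have s2 : dot2 (sig w) (sig w) = (1 + dotp x w) / (1 - dotp x w).
    have e : dotp e1 w ^+ 2 + dotp e2 w ^+ 2 = (1 - dotp x w) * (1 + dotp x w).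
      have -> : dotp e1 w ^+ 2 + dotp e2 w ^+ 2 = 1 - dotp x w ^+ 2 by rewrite -ww; ring.
      by ring.
    rewrite /dot2 /sig /= ; transitivity ((1 - dotp x w)^-1 ^+ 2 * (dotp e1 w ^+ 2 + dotp e2 w ^+ 2)); first by ring.
    by rewrite e expr2 -!mulrA mulKf// mulrC.
  have cs : c (sig w) = (1 - dotp x w) / 2.
    rewrite cE s2; have -> : (1 + dotp x w) / (1 - dotp x w) + 1 = 2 / (1 - dotp x w) by field.
    by rewrite invf_div.
  rewrite [RHS](comp w) /tau cs s2 /sig/=.
  have -> : (1 - dotp x w) / 2 * 2 * ((1 - dotp x w)^-1 * dotp e1 w) = dotp e1 w by field.
  have -> : (1 - dotp x w) / 2 * 2 * ((1 - dotp x w)^-1 * dotp e2 w) = dotp e2 w by field.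
  have -> : (1 - dotp x w) / 2 * ((1 + dotp x w) / (1 - dotp x w) - 1) = dotp x w by field.
  by rewrite -[RHS]addrA [RHS]addrC.
- move=> w hw.
  have cd (e : pt R) : dotp e @ w --> dotp e w by exact: continuous_dotpr.
  have ci : (fun w => (1 - dotp x w)^-1) @ w --> (1 - dotp x w)^-1.
    apply: cvgV; first by rewrite subr_eq0 eq_sym; apply/eqP.
    by apply: cvgB; [exact: cvg_cst|exact: cd].
  by apply: (cvg_pair (cvgM ci (cd e1)) (cvgM ci (cd e2))).
- split; first by move=> z; rewrite tx mulrAC cz mul1r.
  move=> y; exists (dotp y e1), (dotp y e2) => z.
  rewrite (dotp_frame y (tau z) comp) tx t1 t2 (dotpC y x).
  transitivity ((c z * (dot2 z z + 1)) * (2 * (z.1 * dotp y e1 + z.2 * dotp y e2) + (dot2 z z - 1) * dotp x y)); first by ring.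
  by rewrite cz mul1r.
Qed.

End Stereographic.

Section CircleParameter.
Variable R : realType.

Lemma circle_param (z : R * R) (a : R) : @circle R z -> exists2 t, a <= t <= a + pi *+ 2 & z = (cos t, sin t).
Proof.
move=> hz; have z0 : z <> 0 by move=> e; move: hz; rewrite e /circle/= expr0n/= addr0 => /eqP; rewrite eq_sym oner_eq0.
have [t [c c0 ez]] := is_arg_ex z0.
have c1 : c = 1.
  have : c ^+ 2 = 1 by rewrite -[RHS]hz ez/= !exprMn -mulrDr cos2Dsin2 mulr1.
  by move=> /eqP; rewrite sqrf_eq1 => /orP[/eqP//|/eqP e]; move: c0; rewrite e ltr0N1.
have p2 : 0 < (pi : R) *+ 2 by rewrite mulrn_wgt0// pi_gt0.
pose n := Num.floor ((a - t) / (pi *+ 2)).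
have /andP[n1 n2] : n%:~R <= (a - t) / (pi *+ 2) < (n + 1)%:~R.
  by rewrite ge_floor/= -floor_lt_int ltzD1.
rewrite ler_pdivlMr// in n1; rewrite ltr_pdivrMr// in n2.
exists (t + (n + 1)%:~R * (pi *+ 2)).
  rewrite -lerBlDl (ltW n2)/= intrD mulrDl mul1r addrA lerD2r.
  by rewrite -lerBrDl.
have [d d0 e] : is_arg z (t + (n + 1)%:~R * (pi *+ 2)) by apply: is_arg2pi; exists c.
have d1 : d = 1.
  have : d ^+ 2 = 1 by rewrite -[RHS]hz e/= !exprMn -mulrDr cos2Dsin2 mulr1.
  by move=> /eqP; rewrite sqrf_eq1 => /orP[/eqP//|/eqP h]; move: d0; rewrite h ltr0N1.
by rewrite e d1 !mul1r.
Qed.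

Lemma circle_param_inj (s t : R) : `|s - t| < pi *+ 2 -> cos s = cos t -> sin s = sin t -> s = t.
Proof.
move=> st cst sst; have p2 : 0 < (pi : R) *+ 2 by rewrite mulrn_wgt0// pi_gt0.
have [||n e] := @is_arg_uniq R (cos t, sin t) s t.
- by exists 1; rewrite // !mul1r cst sst.
- by exists 1; rewrite // !mul1r.
move: st; rewrite e addrC addKr normrM (gtr0_norm p2) -[X in _ < X]mul1r ltr_pM2r//.
rewrite -intr_norm ltrz1 => h.
have -> : n = 0 by apply/eqP; rewrite -normr_le0 -ltzD1 add0r.
by rewrite mul0r addr0.
Qed.

End CircleParameter.

(** * Discs and curves in a chart *)

Section Chart.
Variables (R : realType) (x : pt R) (sig : pt R -> R * R) (tau : R * R -> pt R).
Hypothesis (hx : sphere x) (ctau : continuous tau) (stau : forall z, sphere (tau z)).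
Hypothesis (sigK : forall z, sig (tau z) = z) (tauK : forall w, sphere w -> w <> x -> tau (sig w) = w).
Hypothesis (csig : forall w, dotp x w <> 1 -> {for w, continuous sig}).
Hypothesis (taux : forall z, dotp x (tau z) * (dot2 z z + 1) = dot2 z z - 1).
Hypothesis (tauy : forall y : pt R, exists y1 y2 : R, forall z,
  dotp y (tau z) * (dot2 z z + 1) = 2 * (z.1 * y1 + z.2 * y2) + (dot2 z z - 1) * dotp x y).

Lemma dot2_ge0 (z : R * R) : 0 <= dot2 z z.
Proof. by rewrite /dot2 -!expr2 addr_ge0 ?sqr_ge0. Qed.

Lemma preimage_tau (T : set (pt R)) : T `<=` @sphere R -> ~ T x -> tau @^-1` T = sig @` T.
Proof.
move=> TS Tx; apply/seteqP; split => z.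
  by move=> Tz; exists (tau z).
by move=> [w Tw <-]; rewrite /= tauK//; [exact: TS|move=> e; apply: Tx; rewrite -e].
Qed.

Lemma dotp_tau_ge c z : (c <= dotp x (tau z)) = (1 + c <= dot2 z z * (1 - c)).
Proof.
have D0 := dot2_ge0 z; have e := taux z.
apply/idP/idP => h; first by nra.
by rewrite -(@ler_pM2r _ (dot2 z z + 1)) ?e; lra.
Qed.

Lemma dotp_tau_gt c z : (c < dotp x (tau z)) = (1 + c < dot2 z z * (1 - c)).
Proof.
have D0 := dot2_ge0 z; have e := taux z.
apply/idP/idP => h; first by nra.
by rewrite -(@ltr_pM2r _ (dot2 z z + 1)) ?e; lra.
Qed.

(* A spiral inside the disc [dotp x w >= c], which in the chart is the exterior of a
   circle, from a fixed point to a prescribed boundary point. *)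
Lemma spiral c : -1 < c < 1 -> exists z0 : R * R, forall w, sphere w -> dotp x w = c ->
  exists e : R -> R * R, [/\ continuous e, e 0 = z0, tau (e 1) = w &
    forall s, 0 <= s <= 1 -> c <= dotp x (tau (e s)) /\ (s < 1 -> c < dotp x (tau (e s)))].
Proof.
move=> /andP[cm c1]; pose D0 := (1 + c) / (1 - c).
have d1 : 0 < 1 - c by rewrite subr_gt0.
have D0p : 0 < D0 by rewrite divr_gt0//; lra.
have D0e : D0 * (1 - c) = 1 + c by rewrite divfK// gt_eqF.
pose k := Num.sqrt D0; have k0 : 0 < k by rewrite sqrtr_gt0.
have k2 : k ^+ 2 = D0 by rewrite sqr_sqrtr// ltW.
(* [k] is the radius of the image of the circle [dotp x w = c]; the spirals start at radius [2 * k]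
   and reach [k] only at time 1. *)
exists (2 * k, 0) => w hw xw.
have wx : w <> x by move=> e; move: xw; rewrite e (hx : dotp x x = 1) => e1; move: c1; rewrite -e1 ltxx.
have Dw : dot2 (sig w) (sig w) = D0.
  by have := taux (sig w); rewrite tauK// xw => e; apply: (mulIf (lt0r_neq0 d1)); rewrite D0e; lra.
have sw0 : sig w <> 0.
  by move=> e; move: Dw; rewrite e /dot2 /= !mulr0 addr0 => e0; move: D0p; rewrite -e0 ltxx.
have [t [k' k'0 ew]] := is_arg_ex sw0.
have kk : k' = k.
  apply/eqP; rewrite -(@eqrXn2 _ 2)// ?ltW// k2 -Dw ew /dot2/=.
  by apply/eqP; rewrite -[LHS]mulr1 -(cos2Dsin2 t); ring.
exists (fun s => ((2 - s) * k * cos (s * t), (2 - s) * k * sin (s * t))); split.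
- by continuity.
- by rewrite subr0 mul0r cos0 sin0 mulr1 mulr0.
- have -> : 2 - 1 = 1 :> R by ring.
  by rewrite !mul1r -kk -ew tauK.
- move=> s /andP[s0 s1].
  have De : dot2 ((2 - s) * k * cos (s * t), (2 - s) * k * sin (s * t))
      ((2 - s) * k * cos (s * t), (2 - s) * k * sin (s * t)) * (1 - c) = (2 - s) ^+ 2 * (1 + c).
    by rewrite -D0e -k2 -[in RHS](mulr1 (_ ^+ 2)) -(cos2Dsin2 (s * t)) /dot2/=; ring.
  have c0 : 0 < 1 + c by lra.
  rewrite dotp_tau_ge dotp_tau_gt De; split; first by apply: ler_peMl; [exact: ltW|apply: exprn_ege1; lra].
  by move=> s1'; rewrite ltr_pMl//; apply: exprn_egt1 => //; lra.
Qed.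

(** [(dotp y (tau z) - c) * (dot2 z z + 1)] is quadratic with leading coefficient
    [dotp x y - c < 0], hence concave along segments. *)
Lemma chart_convex y c z z' s : sphere y -> dotp x y < c ->
  c < dotp y (tau z) -> dotp y (tau z') = c -> 0 <= s <= 1 ->
  c <= dotp y (tau (z + s *: (z' - z))) /\ (s < 1 -> c < dotp y (tau (z + s *: (z' - z)))).
Proof.
move=> hy d hz hz' /andP[s0 s1].
have [a [b h]] := tauy y; set z'' := z + _.
have g (w : R * R) : (dotp y (tau w) - c) * (dot2 w w + 1) =
    2 * (w.1 * a + w.2 * b) + (dot2 w w - 1) * dotp x y - c * (dot2 w w + 1).
  by rewrite mulrBl h.
have D0 := dot2_ge0 z; have D0' := dot2_ge0 z'; have D0'' := dot2_ge0 z''.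
have e1 := g z; have e2 := g z'; have e3 := g z''.
have cv : (dotp y (tau z'') - c) * (dot2 z'' z'' + 1) =
   (1 - s) * ((dotp y (tau z) - c) * (dot2 z z + 1)) + s * ((dotp y (tau z') - c) * (dot2 z' z' + 1))
   + (c - dotp x y) * (s * (1 - s)) * dot2 (z - z') (z - z').
  by rewrite e1 e2 e3 /z'' /dot2/= /GRing.scale/=; ring.
rewrite hz' subrr mul0r mulr0 addr0 in cv.
have q0 : 0 <= (c - dotp x y) * (s * (1 - s)) * dot2 (z - z') (z - z').
  by rewrite !mulr_ge0 ?dot2_ge0// subr_ge0// ltW.
have D1 : 0 < dot2 z'' z'' + 1 by lra.
have p0 : 0 < (dotp y (tau z) - c) * (dot2 z z + 1) by rewrite mulr_gt0 ?subr_gt0//; lra.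
split.
  by rewrite -subr_ge0 -(@pmulr_lge0 _ (dot2 z'' z'' + 1))// cv addr_ge0// mulr_ge0 ?subr_ge0// ltW.
move=> s1'; rewrite -subr_gt0 -(@pmulr_lgt0 _ (dot2 z'' z'' + 1))// cv ltr_pwDl//.
by rewrite mulr_gt0 ?subr_gt0.
Qed.

(** The hubs are the disc around [x] with spirals from [z0], the disc around [y] with segments from
    [sig y], and the common origin of the paths [h]. Spokes of different hubs run in disjoint
    regions; spirals and segments are strictly inside their disc before time 1, so they meet no
    foreign [T l]. *)
Lemma K33_chart (y : pt R) (c : R) (T : nat -> set (pt R)) (h : nat -> R -> R * R) :
  sphere y -> -1 < c < 1 -> (forall w, sphere w -> c <= dotp x w -> c <= dotp y w -> False) ->
  (forall j, (j < 3)%N -> [/\ compact (T j), connected (T j), T j `<=` @sphere R &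
    forall w, T j w -> dotp x w <= c /\ dotp y w <= c]) ->
  (forall j, (j < 3)%N -> (exists2 w, T j w & dotp x w = c) /\ (exists2 w, T j w & dotp y w = c)) ->
  (forall j l, (j < 3)%N -> (l < 3)%N -> j != l -> T j `&` T l = set0) ->
  (forall j, (j < 3)%N -> [/\ continuous (h j), h j 0 = h 0%N 0, T j (tau (h j 1)) &
    forall s, 0 <= s <= 1 -> [/\ dotp x (tau (h j s)) < c, dotp y (tau (h j s)) < c &
      forall l, (l < 3)%N -> j != l -> ~ T l (tau (h j s))]]) ->
  False.
Proof.
move=> hy c11 dis hT hm Td hh; have /andP[cm c1] := c11.
have I1 : 0 <= (1 : R) <= 1 by rewrite lexx ler01.
have yx : y <> x.
  by move=> e; apply: (dis x hx); rewrite ?e ?(hx : dotp x x = 1) ltW.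
have xyc : dotp x y < c.
  by rewrite ltNge; apply/negP => xy; apply: (dis y hy) => //; rewrite (hy : dotp y y = 1) ltW.
have Tx j : (j < 3)%N -> ~ T j x.
  by move=> j3 Tjx; have [_ _ _ /(_ _ Tjx)[]] := hT _ j3; rewrite (hx : dotp x x = 1) leNgt c1.
have [z0 hz0] := spiral c11.
have [e0 he0] : exists e : nat -> R -> R * R, forall j, (j < 3)%N -> [/\ continuous (e j), e j 0 = z0,
    T j (tau (e j 1)) & forall s, 0 <= s <= 1 -> c <= dotp x (tau (e j s)) /\ (s < 1 -> c < dotp x (tau (e j s)))].
  suff ex (j : nat) : exists e : R -> R * R, (j < 3)%N -> [/\ continuous e, e 0 = z0,
    T j (tau (e 1)) & forall s, 0 <= s <= 1 -> c <= dotp x (tau (e s)) /\ (s < 1 -> c < dotp x (tau (e s)))].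
    by have [e he] := choice ex; exists e.
  have [j3|_] := boolP (j < 3)%N; last by exists (fun=> 0).
  have [[w Tw xw] _] := hm j j3; have [_ _ TS _] := hT j j3.
  by have [e [ce e0 e1 he]] := hz0 w (TS _ Tw) xw; exists e => _; split => //; rewrite e1.
have [e1 he1] : exists e : nat -> R -> R * R, forall j, (j < 3)%N -> [/\ continuous (e j), e j 0 = sig y,
    T j (tau (e j 1)) & forall s, 0 <= s <= 1 -> c <= dotp y (tau (e j s)) /\ (s < 1 -> c < dotp y (tau (e j s)))].
  suff ex (j : nat) : exists e : R -> R * R, (j < 3)%N -> [/\ continuous e, e 0 = sig y,
    T j (tau (e 1)) & forall s, 0 <= s <= 1 -> c <= dotp y (tau (e s)) /\ (s < 1 -> c < dotp y (tau (e s)))].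
    by have [e he] := choice ex; exists e.
  have [j3|_] := boolP (j < 3)%N; last by exists (fun=> 0).
  have [_ [w Tw yw]] := hm j j3; have [_ _ TS _] := hT j j3.
  have tw : tau (sig w) = w by apply: tauK; [exact: TS|move=> e; apply: (Tx j) => //; rewrite -e].
  exists (fun s => sig y + s *: (sig w - sig y)) => _; split.
  - by continuity.
  - by rewrite scale0r addr0.
  - by rewrite scale1r addrC subrK tw.
  - move=> s s01; apply: chart_convex => //; last by rewrite tw.
    by rewrite tauK// (hy : dotp y y = 1).
pose e i j := nth (fun=> 0) [:: e0 j; e1 j; h j] i.
have at1 (g : R -> pt R) (v : pt R) j s : (j < 3)%N -> 0 <= s <= 1 -> (s < 1 -> c < dotp v (g s)) ->
    T j (g 1) -> forall l, (l < 3)%N -> j != l -> (forall w, T l w -> dotp v w <= c) -> ~ T l (g s).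
  move=> j3 /andP[s0 s1] gs Tg l l3 jl Tl Tgs.
  move: s1; rewrite le_eqVlt => /orP[/eqP s1|/gs]; last by rewrite ltNge Tl.
  by have : (T j `&` T l) (g 1); [split => //; rewrite -s1|rewrite Td].
have tr (g : R -> R * R) z : trace g z -> exists2 s, 0 <= s <= 1 & z = g s.
  by move=> [s]; rewrite /= in_itv/= => s01 <-; exists s.
apply: (@no_spokes_K33 R e _ (fun j => tau @^-1` T j)).
- move=> i j; case: i => [|[|[|//]]] _ j3 /=.
  + by have [] := he0 j j3.
  + by have [] := he1 j j3.
  + by have [] := hh j j3.
- split.
  + move=> i j; case: i => [|[|[|//]]] _ j3 /=.
    * by have [] := he0 j j3.
    * by have [] := he1 j j3.
    * by have [] := hh j j3.
  + move=> j j3; apply: preimage_closed; first by move=> z _; exact: ctau.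
    by have [cT _ _ _] := hT j j3; exact: compact_closed_normed.
  + by move=> j l j3 l3 jl; rewrite -preimage_setI Td// preimage_set0.
  + move=> i j l; case: i => [|[|[|//]]] _ j3 l3 jl /=; rewrite -subset0 => z [/tr[s s01 ->]] /=.
    * have [_ _ h1 /(_ s s01)[_ hs]] := he0 j j3.
      move=> Tz; apply: (@at1 (fun s => tau (e0 j s)) x j s j3 s01 hs h1 l l3 jl _ Tz) => w.
      by have [_ _ _ h'] := hT l l3; case/h'.
    * have [_ _ h1 /(_ s s01)[_ hs]] := he1 j j3.
      move=> Tz; apply: (@at1 (fun s => tau (e1 j s)) y j s j3 s01 hs h1 l l3 jl _ Tz) => w.
      by have [_ _ _ h'] := hT l l3; case/h'.
    * by have [_ _ _ /(_ s s01)[_ _]] := hh j j3; apply.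
- move=> j j3; have [cT conT TS _] := hT j j3; rewrite preimage_tau//; last exact: Tx.
  apply: connected_continuous_connected => //; apply: continuous_in_subspaceT => w; rewrite inE => Tw.
  by apply: csig => e'; apply: (Tx j j3); rewrite (dotp_eq1 hx (TS _ Tw) e').
- move=> i j; case: i => [|[|[|//]]] _ j3 /=.
  + by have [_ a _ _] := he0 j j3; have [_ b _ _] := he0 0%N isT; exact: etrans a (esym b).
  + by have [_ a _ _] := he1 j j3; have [_ b _ _] := he1 0%N isT; exact: etrans a (esym b).
  + by have [_ a _ _] := hh j j3.
- have e01 j l s t : (j < 3)%N -> (l < 3)%N -> 0 <= s <= 1 -> 0 <= t <= 1 -> e0 j s = e1 l t -> False.
    move=> j3 l3 s01 t01 E; have [_ _ _ /(_ s s01)[h1 _]] := he0 j j3.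
    have [_ _ _ /(_ t t01)[h2 _]] := he1 l l3.
    by apply: (dis (tau (e0 j s))) => //; rewrite E.
  have e02 j l s t : (j < 3)%N -> (l < 3)%N -> 0 <= s <= 1 -> 0 <= t <= 1 -> e0 j s = h l t -> False.
    move=> j3 l3 s01 t01 E; have [_ _ _ /(_ s s01)[h1 _]] := he0 j j3.
    by have [_ _ _ /(_ t t01)[h2 _ _]] := hh l l3; move: h1; rewrite E leNgt h2.
  have e12 j l s t : (j < 3)%N -> (l < 3)%N -> 0 <= s <= 1 -> 0 <= t <= 1 -> e1 j s = h l t -> False.
    move=> j3 l3 s01 t01 E; have [_ _ _ /(_ s s01)[h1 _]] := he1 j j3.
    by have [_ _ _ /(_ t t01)[_ h2 _]] := hh l l3; move: h1; rewrite E leNgt h2.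
  move=> i j k l i3 j3 k3 l3 ik jl; rewrite -subset0 => z [/tr[s s01 ->] /tr[t t01]].
  case: i i3 ik => [|[|[|//]]] _; case: k k3 => [|[|[|//]]] _ //= _ E.
  + exact: e01 E.
  + exact: e02 E.
  + exact: e01 (esym E).
  + exact: e12 E.
  + exact: e02 (esym E).
  + exact: e12 (esym E).
Qed.

(** A short piece of the curve around [f c0] plays the arc of [local_sides]. The set [X1] consists
    of the rest of the curve within the ball, which contains both ends of the piece, and of the
    boundary of the ball, which confines the paths. *)
Lemma curve_local_sides (f : R * R -> pt R) (c0 : R * R) (e : R) :
  {within @circle R, continuous f} -> set_inj (@circle R) f ->
  (forall c, circle c -> sphere (f c)) -> circle c0 -> f c0 <> x -> 0 < e ->
  let G := [set z | `|z - sig (f c0)| < e /\ ~ (f @` @circle R) (tau z)] in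
  exists2 d, 0 < d <= e & forall q0 q1 q2,
    `|q0 - sig (f c0)| < d -> `|q1 - sig (f c0)| < d -> `|q2 - sig (f c0)| < d ->
    ~ (f @` @circle R) (tau q0) -> ~ (f @` @circle R) (tau q1) -> ~ (f @` @circle R) (tau q2) ->
    [\/ joined G q0 q1, joined G q0 q2 | joined G q1 q2].
Proof.
move=> cf injf sf cc0 fx e0 G; set P := sig (f c0); set J := f @` _.
have p0 : 0 < (pi : R) by exact: pi_gt0.
have [t0 _ ec0] := circle_param 0 cc0.
pose F u := f (cos (t0 + u), sin (t0 + u)).
have Fc u : @circle R (cos (t0 + u), sin (t0 + u)) by exact: cos_sin_circle.
have cF : continuous F.
  have h : {within setT, continuous (f \o (fun u => (cos (t0 + u), sin (t0 + u))))}.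
    apply: within_comp cf; last by move=> s _; exact: Fc.
    by apply: continuous_subspaceT; continuity.
  by move=> t; move: (h t); rewrite /continuous_at nbhs_subspaceT.
have F0 : F 0 = f c0 by rewrite /F addr0 ec0.
have xne w : sphere w -> dotp x w < 1 -> w <> x.
  by move=> _ h ew; move: h; rewrite ew (hx : dotp x x = 1) ltxx.
have xF0 : dotp x (F 0) < 1 by rewrite F0; apply: dotp_lt1 => //; [exact: sf|move=> h; exact: fx].
have near0 : \forall u \near (0 : R), dotp x (F u) < 1 /\ `|sig (F u) - P| < e.
  near=> u; split; near: u.
    have cd : {for 0, continuous (dotp x \o F)} by apply: continuous_comp; [exact: cF|exact: continuous_dotpr].
    exact: (cvgr_lt _ cd _ xF0).
  have cs : {for 0, continuous (sig \o F)}.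
    by apply: continuous_comp; [exact: cF|apply: csig => h; move: xF0; rewrite h ltxx].
  have cs' : sig (F u) @[u --> 0] --> P by rewrite /P -F0; exact: cs.
  exact: (@cvgr_distC_lt _ _ _ _ _ (sig \o F) P cs' _ e0).
have [r r0 hr] := (nbhs_ballP _ _).1 near0.
(* [eta < r] keeps the piece in the ball and away from the pole; [eta < pi] leaves the complementary
   parameter interval from [eta] to [pi *+ 2 - eta]. *)
pose eta := Num.min r pi / 2.
have rp : 0 < Num.min r pi by rewrite lt_min r0.
have eta0 : 0 < eta by rewrite divr_gt0.
have etalt : eta < Num.min r pi by rewrite ltr_pdivrMr// ltr_pMr// ltr1n.
have [etar etap] : eta < r /\ eta < pi by move: etalt; rewrite lt_min => /andP[].
have hF u : - eta <= u <= eta -> dotp x (F u) < 1 /\ `|sig (F u) - P| < e.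
  move=> ue; apply: hr; rewrite -ball_normE /= sub0r normrN.
  by rewrite (le_lt_trans _ etar)// ler_norml.
have Finj u v : - eta <= u <= pi *+ 2 - eta -> - eta <= v <= pi *+ 2 - eta ->
    F u = F v -> `|u - v| < pi *+ 2 -> u = v.
  move=> _ _ Fuv uv; have := injf _ _ (mem_set (Fc u)) (mem_set (Fc v)) Fuv => -[h1 h2].
  apply: (@addrI _ t0); apply: circle_param_inj => //.
  by rewrite opprD addrACA subrr add0r.
(* Affine from [0, 1] onto [- eta, eta], and clamped so that [alpha] is continuous on the whole
   line. *)
pose k (s : R) := eta * (2 * Num.max 0 (Num.min s 1) - 1).
have ck : continuous k by rewrite /k; continuity.
have kI s : - eta <= k s <= eta.
  have h : 0 <= Num.max 0 (Num.min s 1) <= 1 by rewrite le_max lexx ge_max ler01 ge_min lexx orbT.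
  by move: h; rewrite /k; move: (Num.max _ _) => m /andP[m0 m1]; apply/andP; split; nra.
have kE s : 0 <= s <= 1 -> k s = eta * (2 * s - 1).
  by move=> /andP[s0 s1]; rewrite /k (min_idPl s1) (max_idPr s0).
pose alpha s := sig (F (k s)).
have xk s : dotp x (F (k s)) < 1 by have [] := hF _ (kI s).
have Fx s : tau (alpha s) = F (k s).
  by apply: tauK; [exact/sf/Fc|apply: xne => //; exact/sf/Fc].
have ca : continuous alpha.
  move=> s; apply: (@continuous_comp _ _ _ (F \o k) sig); first by apply: continuous_comp; [exact: ck|exact: cF].
  by apply: csig => h; have := xk s; rewrite h ltxx.
have p2 : (pi : R) *+ 2 = pi + pi by rewrite mulr2n.
have ia s t : 0 <= s <= 1 -> 0 <= t <= 1 -> alpha s = alpha t -> s = t.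
  move=> s01 t01 st; have Fst : F (k s) = F (k t) by rewrite -!Fx st.
  have ks := kI s; have kt := kI t.
  have : k s = k t.
    apply: Finj => //; first by rewrite p2; lra.
      by rewrite p2; lra.
    by rewrite p2 ltr_norml; lra.
  rewrite !kE// => /(mulfI (lt0r_neq0 eta0))/(addIr (-1))/mulfI; apply.
  by rewrite pnatr_eq0.
pose A' := F @` `[eta, pi *+ 2 - eta].
have cA' : compact A'.
  by apply: continuous_compact; [exact: continuous_subspaceT|exact: segment_compact].
pose X1 := [set z | A' (tau z) /\ `|z - P| <= e] `|` [set z | `|z - P| = e].
have cn : continuous (fun z : R * R => `|z - P|).
  by move=> z; apply: (@continuous_comp _ _ _ (fun z : R * R => z - P) (fun z : R * R => `|z|));
    [apply: cvgB; [exact: cvg_id|exact: cvg_cst]|exact: norm_continuous].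
have clX1 : closed X1.
  apply: closedU; last by apply: closed_eq_fun => //; exact: continuous_fun_const.
  apply: closedI; first by apply: preimage_closed; [move=> z _; exact: ctau|exact: compact_closed_normed].
  by apply: (@closed_comp _ _ (fun z : R * R => `|z - P|) [set t | t <= e]); [move=> ? _; exact: cn|exact: closed_le].
have cX1 : compact X1.
  apply: (@closed_bounded_compact2 R _ (`|P| + e)) => // z hz.
  have h : `|z| <= `|P| + e.
    rewrite -(subrK P z) addrC (le_trans (ler_normD _ _))// lerD2l.
    by case: hz => [[_ //]|/= ->].
  by move: h; rewrite prod_normE ge_max => /andP[].
have A'inj u : - eta < u < eta -> ~ A' (F u).
  move=> ue [v]; rewrite /= in_itv/= => ve Fuv.
  have uv : v = u.
    apply: Finj => //; first by lra.
      by rewrite p2; lra.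
    by move: ve; rewrite p2 ltr_norml => ve; lra.
  by move: ue ve; rewrite uv => /andP[_ h] /andP[h' _]; move: h; rewrite ltNge h'.
have nX1 : ~ X1 P.
  move=> [[]|/=]; rewrite ?subrr ?normr0; last by move=> h; move: e0; rewrite -h ltxx.
  have -> : tau P = F 0 by rewrite /P tauK ?F0//; exact: sf.
  by move=> h _; apply: (A'inj 0) h; apply/andP; split; lra.
have [d' d'0 hd'] := open_norm_ball (closed_openC clX1) nX1.
exists (Num.min d' e); first by rewrite lt_min d'0 e0 ge_min lexx orbT.
move=> q0 q1 q2 q0d q1d q2d nJ0 nJ1 nJ2.
have de : Num.min d' e <= e by rewrite ge_min lexx orbT.
have dX z : `|z - P| < Num.min d' e -> ~ X1 z by rewrite lt_min => /andP[/hd'].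
have aq s q : ~ J (tau q) -> alpha s <> q.
  by move=> nJ ea; apply: nJ; rewrite -ea Fx; exists (cos (t0 + k s), sin (t0 + k s)).
have kin s : 0 < s < 1 -> - eta < k s < eta.
  by move=> /andP[s0 s1]; rewrite kE ?ltW//; apply/andP; split; nra.
have Xa0 : X1 (alpha 0).
  left; split; last by apply: ltW; have [] := hF _ (kI 0).
  rewrite Fx kE ?lexx ?ler01// mulr0 add0r mulrN1.
  exists (pi *+ 2 - eta); first by rewrite /= in_itv/= lexx p2; lra.
  rewrite /F; have -> : t0 + (pi *+ 2 - eta) = (t0 - eta) + pi *+ 2 by ring.
  by rewrite cosD2pi sinD2pi.
have Xa1 : X1 (alpha 1).
  left; split; last by apply: ltW; have [] := hF _ (kI 1).
  rewrite Fx kE ?lexx ?ler01//; have -> : eta * (2 * 1 - 1) = eta by ring.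
  by exists eta => //; rewrite /= in_itv/= lexx p2; lra.
have Xas s : 0 < s < 1 -> ~ X1 (alpha s).
  move=> s01 [[]|/=]; first by rewrite Fx => /A'inj h _; apply/h/kin.
  by have [_ h] := hF _ (kI s) => e1; move: h; rewrite -/(alpha s) e1 ltxx.
pose O := ~` (X1 `|` alpha @` `[0, 1]).
have conv q q' : `|q - P| < Num.min d' e -> joined O q q' -> joined G q q'.
  move=> qd [g [cg g0 g1 gO]]; exists g; split => // s s01.
  have ge : `|g s - P| < e.
    apply: (path_in_ball cg) => //; first by rewrite g0 (lt_le_trans qd).
    by move=> t /gO Ogt h; apply: Ogt; left; right.
  split => // -[c cc ec]; apply: (gO _ s01).
  have [t /andP[tl tu] ect] := circle_param (t0 - eta) cc.
  have tw : tau (g s) = F (t - t0) by rewrite -ec ect /F [t0 + _]addrC subrK.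
  have [h|h] := lerP t (t0 + eta).
    right; exists ((t - t0 + eta) / (eta + eta)).
      by rewrite /= in_itv/= divr_ge0 ?ler_pdivrMr ?addr_gt0//; lra.
    rewrite -[RHS]sigK tw /alpha kE; last by rewrite divr_ge0 ?ler_pdivrMr ?addr_gt0//; lra.
    by congr (sig (F _)); field; apply: lt0r_neq0; lra.
  left; left; split; last exact: ltW.
  by rewrite tw; exists (t - t0) => //; rewrite /= in_itv/=; lra.
have [j|j|j] := local_sides ca ia cX1 Xa0 Xa1 Xas (fun z h => or_intror h) de dX q0d q1d q2d
  (fun s _ => And3 (aq s q0 nJ0) (aq s q1 nJ1) (aq s q2 nJ2)).
- by constructor 1; exact: conv.
- by constructor 2; exact: conv.
- by constructor 3; exact: conv.
Unshelve. all: by end_near.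
Qed.

End Chart.

(** * Points of the closed relation have many crossing components *)

Section Core.
Variable R : realType.

(** Points unrelated to [q 0] are related to one another. Of the other four, either two are related
    to [q 0], or three are unrelated to it and hence related among themselves. *)
Lemma three_of_five (T : Type) (S : T -> T -> Prop) (q : nat -> T) :
  (forall i j k, (i < 5)%N -> (j < 5)%N -> (k < 5)%N -> [\/ S (q i) (q j), S (q i) (q k) | S (q j) (q k)]) ->
  exists i j k, [/\ (i < j)%N, (j < k)%N, (k < 5)%N, S (q i) (q j) & S (q i) (q k)].
Proof.
move=> h.
have n0 i j : (i < 5)%N -> (j < 5)%N -> ~ S (q 0%N) (q i) -> ~ S (q 0%N) (q j) -> S (q i) (q j).
  by move=> i5 j5 ni nj; case: (h 0%N i j isT i5 j5).
have [h1|h1] := pselect (S (q 0%N) (q 1%N)); have [h2|h2] := pselect (S (q 0%N) (q 2%N)).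
- by exists 0%N, 1%N, 2%N.
- have [h3|h3] := pselect (S (q 0%N) (q 3%N)); first by exists 0%N, 1%N, 3%N.
  have [h4|h4] := pselect (S (q 0%N) (q 4%N)); first by exists 0%N, 1%N, 4%N.
  by exists 2%N, 3%N, 4%N; split => //; exact: n0.
- have [h3|h3] := pselect (S (q 0%N) (q 3%N)); first by exists 0%N, 2%N, 3%N.
  have [h4|h4] := pselect (S (q 0%N) (q 4%N)); first by exists 0%N, 2%N, 4%N.
  by exists 1%N, 3%N, 4%N; split => //; exact: n0.
- have [h3|h3] := pselect (S (q 0%N) (q 3%N)); last by exists 1%N, 2%N, 3%N; split => //; exact: n0.
  have [h4|h4] := pselect (S (q 0%N) (q 4%N)); first by exists 0%N, 3%N, 4%N.
  by exists 1%N, 2%N, 4%N; split => //; exact: n0.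
Qed.

(** [f c0] is an accumulation point of the exits [p i] on the curve parametrised by [f], and [J'] is
    the other curve. The [T i] reach level [c'] while the exits stay at level at most [c]; so some
    ball around [f c0] in the chart is free of both hubs and of [J']. *)
Lemma no_crossings_accumulating_at (x y : pt R) (c c' : R) (f : R * R -> pt R) (c0 : R * R) (J' U : set (pt R))
    (T : nat -> set (pt R)) (p : nat -> pt R) :
  sphere x -> sphere y -> -1 < c -> c < c' -> c' < 1 ->
  (forall w, sphere w -> c <= dotp x w -> c <= dotp y w -> False) ->
  {within @circle R, continuous f} -> set_inj (@circle R) f -> (forall c, circle c -> sphere (f c)) ->
  circle c0 -> dotp x (f c0) <= c -> dotp y (f c0) <= c ->
  closed J' -> ~ J' (f c0) ->
  (forall w, closure U w -> [\/ U w, (f @` @circle R) w | J' w]) ->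
  f @` @circle R `<=` closure U ->
  (forall B, connected B -> B `<=` @sphere R `\` (f @` @circle R `|` J') -> B `&` U !=set0 -> B `<=` U) ->
  (forall i, [/\ compact (T i), connected (T i), T i `<=` @sphere R, T i `<=` closure U &
    forall w, T i w -> dotp x w <= c' /\ dotp y w <= c']) ->
  (forall i, (exists2 w, T i w & dotp x w = c') /\ (exists2 w, T i w & dotp y w = c')) ->
  (forall i j, i != j -> T i `&` T j = set0) ->
  (forall i, [/\ T i (p i), dotp x (p i) <= c & closure (@sphere R `\` closure U) (p i)]) ->
  (forall V N, nbhs (f c0) V -> exists2 i, (N <= i)%N & V (p i)) ->
  False.
Proof.
move=> hx hy cm1 cc' c'1 dis cf injf sf cc0 xf yf cJ' nJ' clU JU conU hT hm Td hp clu.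
have [sig [tau [[ctau stau] sigK tauK csig [taux tauy]]]] := stereographic hx.
set J := f @` _ in JU clU conU; set P := sig (f c0).
have nex w v : dotp x w <= v -> v < 1 -> w <> x.
  by move=> h v1 e; move: h; rewrite e (hx : dotp x x = 1) leNgt v1.
have c1 : c < 1 by exact: lt_trans c'1.
have fx : f c0 <> x by exact: (nex _ c).
have tP : tau P = f c0 by rewrite /P tauK//; exact: sf.
pose O1 := [set z | dotp x (tau z) < c'] `&` [set z | dotp y (tau z) < c'] `&` ~` (tau @^-1` J').
have oO1 : open O1.
  have o v : open [set z | dotp v (tau z) < c'].
    have cv : continuous (fun z => dotp v (tau z)) by apply: continuous_dotp => //; exact: continuous_fun_const.
    apply: (@open_comp _ _ (fun z => dotp v (tau z)) [set t | t < c']); last exact: open_lt.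
    by move=> z _; exact: cv.
  apply: openI; first by apply: openI; exact: o.
  by apply: closed_openC; apply: preimage_closed => // z _; exact: ctau.
have O1P : O1 P by split; [split; rewrite /= tP (le_lt_trans _ cc')|rewrite /= tP].
have [eta eta0 heta] := open_norm_ball oO1 O1P.
have [d /andP[d0 de] hd] := curve_local_sides hx ctau sigK tauK csig cf injf sf cc0 fx eta0.
rewrite -/P -/J in hd.
have csig' w v : dotp x w <= v -> v < 1 -> sig @ w --> sig w.
  by move=> h v1; apply: csig => e; move: h; rewrite e leNgt v1.
have nV : nbhs (f c0) [set w | `|sig w - P| < d].
  exact: (@cvgr_distC_lt _ _ _ _ _ sig P (csig' _ _ xf c1) _ d0).
(* Exits [q k] off the closure of [U] next to five of the [p i]; three lie on one side of [J]. *)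
have [nx hnx] : exists nx : nat -> nat, forall N, (N <= nx N)%N /\ `|sig (p (nx N)) - P| < d.
  have ex N : exists i, (N <= i)%N /\ `|sig (p i) - P| < d.
    by have [i Ni hi] := clu _ N nV; exists i.
  by have [nx hnx] := choice ex; exists nx.
pose iota := fix F k := if k is k.+1 then nx (F k).+1 else nx 0%N.
have iotaS k : (iota k < iota k.+1)%N by exact: (hnx _).1.
have iota_lt k l : (k < l)%N -> (iota k < iota l)%N.
  elim: l => // l IH; rewrite ltnS leq_eqVlt => /orP[/eqP ->|/IH h]; first exact: iotaS.
  exact: ltn_trans h (iotaS _).
have iota_inj k l : k != l -> iota k != iota l.
  by rewrite neq_ltn => /orP[/iota_lt|/iota_lt] h; rewrite neq_ltn h ?orbT.
have iotaP k : `|sig (p (iota k)) - P| < d by case: k => [|k]; exact: (hnx _).2.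
have closedT i : closed (T i) by apply: compact_closed_normed; have [] := hT i.
have Tp i : T i (p i) by have [] := hp i.
have tp i : tau (sig (p i)) = p i.
  have [Ti h _] := hp i; apply: tauK; last exact: (nex _ c).
  by have [_ _ + _ _] := hT i; apply.
(* The other four continua are closed and miss [p (iota k)], so a point off [closure U] close enough
   to it is joined to it by a segment that avoids them. *)
have [q hq] : exists q : nat -> R * R, forall k, [/\ `|q k - P| < d, ~ closure U (tau (q k)) &
    forall s, 0 <= s <= 1 -> `|q k + s *: (sig (p (iota k)) - q k) - P| < d /\
      forall l, (l < 5)%N -> l != k -> ~ T (iota l) (tau (q k + s *: (sig (p (iota k)) - q k)))].
  suff ex (k : nat) : exists q : R * R, [/\ `|q - P| < d, ~ closure U (tau q) &
    forall s, 0 <= s <= 1 -> `|q + s *: (sig (p (iota k)) - q) - P| < d /\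
      forall l, (l < 5)%N -> l != k -> ~ T (iota l) (tau (q + s *: (sig (p (iota k)) - q)))].
    by have [q hq] := choice ex; exists q.
  pose O l : set (R * R) := [set z | l != k -> ~ T (iota l) (tau z)].
  have oO l : open (O l).
    have [e|lk] := eqVneq l k.
      rewrite (_ : O l = setT); first exact: openT.
      by apply/seteqP; split => // z _; rewrite /O/= e eqxx.
    rewrite (_ : O l = ~` (tau @^-1` T (iota l))).
      by apply: closed_openC; apply: preimage_closed => // z _; exact: ctau.
    by apply/seteqP; split => z /= h; [exact: h|move=> _].
  have Op l : O l (sig (p (iota k))).
    move=> lk; rewrite tp => h; have : (T (iota l) `&` T (iota k)) (p (iota k)) by [].
    by rewrite Td// iota_inj.
  have oO' : open (O 0%N `&` O 1%N `&` O 2%N `&` O 3%N `&` O 4%N `&` [set z | `|z - P| < d]).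
    do 4?[apply: openI => //]; last first.
      apply: (@open_comp _ _ (fun z : R * R => `|z - P|) [set t | t < d]); last exact: open_lt.
      move=> z _; apply: (@continuous_comp _ _ _ (fun z : R * R => z - P) (fun z : R * R => `|z|)).
        by apply: cvgB; [exact: cvg_id|exact: cvg_cst].
      exact: norm_continuous.
    exact: openI.
  have [|e e0 he] := open_norm_ball oO' (z := sig (p (iota k))).
    by do ![split]; try exact: Op; exact: iotaP.
  have [_ xp clp] := hp (iota k).
  have nW : nbhs (p (iota k)) ([set w | `|sig w - sig (p (iota k))| < e] `&` [set w | dotp x w < c']).
    apply: filterI.
      exact: (@cvgr_distC_lt _ _ _ _ _ sig _ (csig' _ _ xp c1) _ e0).
    apply: open_nbhs_nbhs; split; last by rewrite /= (le_lt_trans xp).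
    by apply: (@open_comp _ _ (dotp x) [set t | t < c']); [move=> ? _; exact: continuous_dotpr|exact: open_lt].
  have [w [[sw nUw] [ew xw]]] := clp _ nW.
  have tw : tau (sig w) = w by apply: tauK => //; apply: (nex _ c') => //; exact: ltW.
  have seg s : 0 <= s <= 1 -> `|sig w + s *: (sig (p (iota k)) - sig w) - sig (p (iota k))| < e.
    by move=> s01; apply: segment_ball; rewrite // subrr normr0.
  exists (sig w); rewrite tw; split => //; first by have [] := he _ ew.
  move=> s s01; have [] := he _ (seg s s01); move=> [] [] [] [] h0 h1 h2 h3 h4 hd'; split => // l.
  by case: l => [|[|[|[|[|//]]]]] _; [exact: h0|exact: h1|exact: h2|exact: h3|exact: h4].
set G := [set z | `|z - P| < eta /\ ~ J (tau z)] in hd.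
have nJq k : ~ J (tau (q k)) by have [_ h _] := hq k; move=> /JU.
have [|i [j [k [ij jk k5 Sij Sik]]]] := @three_of_five _ (joined G) q.
  by move=> i j k _ _ _; apply: hd; rewrite ?nJq//; have [] := hq i; have [] := hq j; have [] := hq k.
pose idx m := nth 0%N [:: i; j; k] m.
have idx5 m : (m < 3)%N -> (idx m < 5)%N.
  by case: m => [|[|[|//]]] _ //=; [apply: ltn_trans k5; exact: ltn_trans jk|exact: ltn_trans k5].
have idxI m l : (m < 3)%N -> (l < 3)%N -> m != l -> idx m != idx l.
  have ik := ltn_trans ij jk.
  by case: m => [|[|[|//]]] _; case: l => [|[|[|//]]] _ //= _; rewrite neq_ltn ?ij ?jk ?ik ?orbT.
have Sidx m : (m < 3)%N -> joined G (q i) (q (idx m)).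
  case: m => [|[|[|//]]] _ //=; apply: joined_refl; have [h _ _] := hq i.
  by split; [exact: lt_le_trans de|exact: nJq].
pose H m := [set z | `|z - P| < eta /\ forall l, (l < 3)%N -> m != l -> ~ T (iota (idx l)) (tau z)].
have path m : (m < 3)%N -> joined (H m) (q i) (sig (p (iota (idx m)))).
  move=> m3; apply: (@joined_trans _ _ _ _ (q (idx m))).
    have [g [cg g0 g1 gG]] := Sidx m m3; exists g; split => // s s01.
    have [gs _] := gG s s01; split => // l l3 ml Tg.
    (* The path avoids both curves, so one of its points in [closure U] would force the whole path
       into [U], including its origin [q i]. Hence this part of the third hub meets no [T], all of
       which lie in [closure U]. *)
    have nU : ~ closure U (tau (g s)).
      move=> /clU; have [_ nJs] := gG s s01; have [_ nJ's] := heta _ gs; case => // Ugs.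
      have B : (tau \o g) @` `[0, 1]%classic `<=` U.
        apply: conU.
        - apply: connected_continuous_connected; first exact: segment_connected.
          by apply: continuous_subspaceT => t; apply: continuous_comp; [exact: cg|exact: ctau].
        - move=> w [t]; rewrite /= in_itv/= => /gG[gt nJt] <-; split => // -[//|].
          by have [_] := heta _ gt.
        - by exists (tau (g s)); split => //; exists s; rewrite //= in_itv.
      have [_ + _] := hq i; apply; apply: subset_closure; apply: B.
      by exists 0; rewrite /= ?g0// in_itv/= lexx ler01.
    by apply: nU; have [_ _ _ + _] := hT (iota (idx l)); apply.
  apply: joined_segment => s s01; have [_ _ /(_ s s01)[h1 h2]] := hq (idx m).
  split; first exact: lt_le_trans de.
  by move=> l l3 ml; apply: h2; [exact: idx5|rewrite eq_sym; exact: idxI].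
have [h hh] : exists h : nat -> R -> R * R, forall m, (m < 3)%N -> [/\ continuous (h m), h m 0 = q i,
    h m 1 = sig (p (iota (idx m))) & forall s, 0 <= s <= 1 -> H m (h m s)].
  suff ex (m : nat) : exists h : R -> R * R, (m < 3)%N -> [/\ continuous h, h 0 = q i,
    h 1 = sig (p (iota (idx m))) & forall s, 0 <= s <= 1 -> H m (h s)].
    by have [h hh] := choice ex; exists h.
  have [m3|_] := boolP (m < 3)%N; last by exists (fun=> 0).
  by have [h hh] := path m m3; exists h.
have dis' w : sphere w -> c' <= dotp x w -> c' <= dotp y w -> False.
  by move=> sw h1 h2; apply: (dis w sw); [exact: le_trans (ltW cc') h1|exact: le_trans (ltW cc') h2].
apply: (@K33_chart R x sig tau hx ctau stau sigK tauK csig taux tauy y c' (fun m => T (iota (idx m))) h) => //.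
- by rewrite (lt_trans cm1 cc').
- by move=> m m3; have [? ? ? _ ?] := hT (iota (idx m)).
- by move=> m l m3 l3 ml; apply/Td/iota_inj/idxI.
- move=> m m3; have [ch h0 h1 hH] := hh m m3; split => //.
  + by have [_ -> _ _] := hh 0%N isT.
  + by rewrite h1 tp.
  + move=> s s01; have [hs1 hs2] := hH s s01; have [[xs ys] _] := heta _ hs1.
    by split => // l l3 ml; exact: hs2.
Qed.

End Core.

Section Forward.
Variable R : realType.
Implicit Types (x y w : pt R).

Lemma finite_pigeonhole (T : Type) (S : set T) (F : nat -> T) : finite_set S -> (forall n, S (F n)) ->
  exists2 iota : nat -> nat, {homo iota : i j / (i < j)%N} & forall k, F (iota k) = F (iota 0%N).
Proof.
move=> fS SF.
have [C _ hC] : exists2 C, S C & ~ finite_set (F @^-1` [set C]).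
  apply: contrapT => no; apply: (@infinite_nat).
  rewrite (_ : setT = \bigcup_(C in S) (F @^-1` [set C])); last first.
    by apply/seteqP; split => // n _; exists (F n).
  by apply: bigcup_finite => // C SC; apply: contrapT => h; apply: no; exists C.
have ex N : exists n, (N <= n)%N /\ F n = C.
  apply: contrapT => no; apply: hC; apply: (@sub_finite_set _ _ `I_N); last exact: finite_II.
  by move=> n /= Fn; rewrite ltnNge; apply/negP => Nn; apply: no; exists n.
have [nx hnx] := choice ex.
pose iota := fix f k := if k is k.+1 then nx (f k).+1 else nx 0%N.
have hF k : F (iota k) = C by case: k => [|k]; exact: (hnx _).2.
exists iota; last by move=> k; rewrite !hF.
move=> i j; elim: j => // j IH; rewrite ltnS leq_eqVlt => /orP[/eqP ->|/IH h].
  exact: (hnx _).1.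
exact: ltn_trans h (hnx _).1.
Qed.

(** [cos t *: x + sin t *: v] is the great circle that starts at [x] and passes through [w] at time
    [r]; circles around [x] are crossed along it. *)
Lemma meridian (r : R) x w : sphere x -> sphere w -> sin r != 0 -> dotp x w = cos r ->
  exists v, [/\ dotp x v = 0, dotp v v = 1 & cos r *: x + sin r *: v = w].
Proof.
move=> hx hw sr xw; exists ((sin r)^-1 *: (w + (- cos r) *: x)); split.
- by rewrite dotpZr dotpDr dotpZr (hx : dotp x x = 1) xw mulr1 subrr mulr0.
- rewrite !(dotpZl, dotpZr, dotpDl, dotpDr) (hx : dotp x x = 1) (hw : dotp w w = 1) (dotpC w x) xw.
  have e : 1 - cos r ^+ 2 = sin r ^+ 2 by rewrite -(cos2Dsin2 r) addrAC subrr add0r.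
  transitivity ((sin r)^-1 ^+ 2 * (1 - cos r ^+ 2)); first by ring.
  by rewrite e exprVn mulVf// expf_neq0.
- by rewrite scalerA mulfV// scale1r scaleNr addrC subrK.
Qed.

Lemma meridian_sphere (t : R) x v : sphere x -> dotp x v = 0 -> dotp v v = 1 ->
  sphere (cos t *: x + sin t *: v) /\ dotp x (cos t *: x + sin t *: v) = cos t.
Proof.
move=> hx xv vv; split; last by rewrite dotpDr !dotpZr (hx : dotp x x = 1) xv mulr0 addr0 mulr1.
rewrite /sphere /= !(dotpZl, dotpZr, dotpDl, dotpDr) (hx : dotp x x = 1) vv (dotpC v x) xv.
by transitivity (cos t ^+ 2 + sin t ^+ 2); [ring|exact: cos2Dsin2].
Qed.

Lemma sbd_Dr (r : R) x : sphere x -> 0 < r < pi -> sbd (Dr r x) = [set w | sphere w /\ dotp x w = cos r].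
Proof.
move=> hx /andP[r0 rpi]; have rI : 0 <= r <= pi by rewrite !ltW.
apply/seteqP; split => w.
  move=> [clw nin].
  have h : closure [set w | sphere w /\ cos r <= dotp x w] w.
    by apply: closureS clw => v; rewrite DrE// => -[sv /ltW].
  have cl : closed [set w | sphere w /\ cos r <= dotp x w].
    apply: (@closedI _ (@sphere R) [set w | cos r <= dotp x w]); first exact: closed_sphere.
    by apply: (@closed_comp _ _ (dotp x) [set t | cos r <= t]); [move=> ? _; exact: continuous_dotpr|exact: closed_ge].
  move: h; rewrite -((closure_id _).1 cl) => -[sw cw].
  split => //; apply: le_anti; rewrite cw andbT leNgt; apply/negP => h; apply: nin.
  split; first by rewrite DrE.
  have oO : open [set v | cos r < dotp x v].
    by apply: (@open_comp _ _ (dotp x) [set t | cos r < t]); [move=> ? _; exact: continuous_dotpr|exact: open_gt].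
  have [e e0 he] := Dr_sub_open oO sw h.
  by exists e; split => // v hv; rewrite DrE//; split; [case: hv|exact: he].
move=> [sw xw]; split; last first.
  by move=> []; rewrite DrE// => -[_]; rewrite xw ltxx.
have sr : 0 < sin r by apply: sin_gt0_pi; rewrite r0.
have [v [xv vv wv]] := meridian hx sw (lt0r_neq0 sr) xw.
pose g (t : R) := cos t *: x + sin t *: v.
have cg : continuous g by rewrite /g; continuity.
have gr : g r = w by [].
have sg t : sphere (g t) by have [] := meridian_sphere t hx xv vv.
have xg t : dotp x (g t) = cos t by have [] := meridian_sphere t hx xv vv.
move=> V nV; have nV' : \forall t \near r, V (g t) by rewrite -gr in nV; exact: cg.
have [e e0 he] := (nbhs_ballP _ _).1 nV'.
(* A time slightly before [r] gives a point of the open disc close to [w]. *)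
pose t := Num.max (r - e / 2) 0.
have t0 : 0 <= t by rewrite le_max lexx orbT.
have tr : t < r by rewrite gt_max r0 andbT gtrBl divr_gt0.
exists (g t); split.
  rewrite DrE//; split => //; rewrite xg ltr_cos// in_itv/= ?t0 ?r0 ?(ltW r0) ?ltW//.
  exact: lt_trans rpi.
apply: he; rewrite -ball_normE /= ger0_norm ?subr_ge0 ?ltW//.
rewrite ltrBlDr -ltrBlDl; apply: (@lt_le_trans _ _ (r - e / 2)); last by rewrite /t le_max lexx.
by rewrite ltrD2l ltrN2 ltr_pdivrMr// ltr_pMr// ltr1n.
Qed.

Lemma caps_disjoint (r : R) x y w : sphere x -> sphere y -> sphere w -> 0 < r -> r < rho x y / 2 ->
  cos r <= dotp x w -> cos r <= dotp y w -> False.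
Proof.
move=> hx hy hw r0 rr h1 h2; have /andP[_ rpi] := rho_itv hx hy.
have rI : 0 <= r <= pi by rewrite ltW//=; have := @pi_gt0 R; lra.
rewrite -rho_le// in h1; rewrite -rho_le// in h2.
have := rho_triangle hx hw hy; rewrite (rhoC w y) => h3.
have : rho x y < rho x y by lra.
by rewrite ltxx.
Qed.

Lemma crossings_of_RK_closure (K : set (pt R)) x y (r : R) : K `<=` @sphere R -> compact K -> K x -> K y ->
  RK_closure K (x, y) -> 0 < r -> r < rho x y / 2 ->
  ~ finite_set [set C | component_of (K `\` (Dr r x `|` Dr r y)) C /\
                        C `&` sbd (Dr r x) !=set0 /\ C `&` sbd (Dr r y) !=set0].
Proof.
move=> KS cK Kx Ky [clR _] r0 rr fin.
have hx := KS _ Kx; have hy := KS _ Ky.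
have /andP[_ rpi] := rho_itv hx hy; have pi0 := @pi_gt0 R.
have r2 : r < pi / 2 by lra.
have rpi' : r < pi by lra.
have rI : 0 <= r <= pi by rewrite !ltW.
have dis w := @caps_disjoint r x y w hx hy ^~ r0 ^~ rr.
set c := cos r in dis.
have c0 : 0 < c by apply: cos_gt0_pihalf; rewrite r2 andbT; lra.
have le_cl v (a : R) : closed [set w : pt R | dotp v w <= a].
  by apply: (@closed_comp _ _ (dotp v) [set t | t <= a]); [move=> ? _; exact: continuous_dotpr|exact: closed_le].
have gt_op v (a : R) : open [set w : pt R | a < dotp v w].
  by apply: (@open_comp _ _ (dotp v) [set t | a < t]); [move=> ? _; exact: continuous_dotpr|exact: open_gt].
have c1 : c < 1 by rewrite /c -(@cos0 R) ltr_cos// in_itv/= ?lexx ?ltW.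
have [[x' y'] [RKxy [/= xx' yy']]] : (RK K `&` ([set w | c < dotp x w] `*` [set w | c < dotp y w])) !=set0.
  apply: clR; exists ([set w | c < dotp x w], [set w | c < dotp y w]) => //.
  by split; apply: open_nbhs_nbhs; split => //=; rewrite ?(hx : dotp x x = 1) ?(hy : dotp y y = 1).
have [/= Kx' [Ky' [_ [J1 [J2 [U [[J1S [f1 [cf1 [if1 ef1]]]] [[J2S [f2 [cf2 [if2 ef2]]]] [J12 [_ [_ [[cU sU] [P [iP [hP [L [hL [Lx' Ly']]]]]]]]]]]]]]]]]] := RKxy.
pose m := Num.min (dotp x x') (dotp y y').
have cm : c < m by rewrite lt_min xx'.
(* A level strictly between [c] and [m]: the discs of level [c'] still contain [x'] and [y'] in
   their interior, so [P n] enters both for large [n]. *)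
pose c' := (c + m) / 2.
have cc' : c < c' by rewrite /c'; lra.
have c'm : c' < m by rewrite /c'; lra.
have [c'x c'y] : c' < dotp x x' /\ c' < dotp y y' by move: c'm; rewrite lt_min => /andP[].
have c'1 : c' < 1 by apply: lt_le_trans c'x _; case/andP: (dotp_itv hx (KS _ Kx')).
set E := closure U in hP; pose W := E `&` K.
have cE : closed E by exact: closed_closure.
have cW : compact W by rewrite /W setIC; exact: compact_closedI.
have Pcomp n : compact (P n) /\ connected (P n).
  have [[z [_ ->]] _] := hP n; split; [exact: component_compact|exact: component_connected].
have PW n : P n `<=` W by have [[z [_ ->]] _] := hP n; exact: connected_component_sub.
have [LS [_ [_ hL']]] := hL.
have [e1 e10 he1] := Dr_sub_open (gt_op x c') (KS _ Kx') c'x.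
have [e2 e20 he2] := Dr_sub_open (gt_op y c') (KS _ Ky') c'y.
have [N1 hN1] := hL' _ e10; have [N2 hN2] := hL' _ e20.
(* [A'] crosses between the smaller circles [dotp _ _ = c'], so that it touches the discs
   used as hubs; its subcontinuum [Q] crosses between the circles of radius [r]. *)
have crossing n : exists Az : set (pt R) * pt R, [/\ [/\ compact Az.1, connected Az.1, Az.1 `<=` P (n + maxn N1 N2)%N &
    forall w, Az.1 w -> dotp x w <= c' /\ dotp y w <= c'],
    (exists2 w, Az.1 w & dotp x w = c') /\ (exists2 w, Az.1 w & dotp y w = c'), Az.1 Az.2 &
    exists Q : set (pt R), [/\ Q Az.2, connected Q, Q `<=` P (n + maxn N1 N2)%N, (forall w, Q w -> dotp x w <= c /\ dotp y w <= c) &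
      (exists2 w, Q w & dotp x w = c) /\ (exists2 w, Q w & dotp y w = c)]].
  set k := (n + _)%N; have [cP conP] := Pcomp k.
  have [|||A' [AP cA conA Ale [Ax Ay]]] := @crossing_continuum R (pt R) (P k) (dotp x) (dotp y) c' cP conP
      (@continuous_dotpr _ x) (@continuous_dotpr _ y).
  - have [|_ /(_ _ Lx')[_ [w Pw hw]]] := hN1 k; first by rewrite (leq_trans (leq_maxl N1 N2))// leq_addl.
    by exists w => //; apply: he1; split => //; apply: KS; exact: (PW _ _ Pw).2.
  - have [|_ /(_ _ Ly')[_ [w Pw hw]]] := hN2 k; first by rewrite (leq_trans (leq_maxr N1 N2))// leq_addl.
    by exists w => //; apply: he2; split => //; apply: KS; exact: (PW _ _ Pw).2.
  - move=> w /PW[_ /KS sw] h1 h2; apply: (dis w sw); [exact: le_trans (ltW cc') h1|exact: le_trans (ltW cc') h2].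
  have [|||Q [QA cQ conQ Qle [Qx Qy]]] := @crossing_continuum R (pt R) A' (dotp x) (dotp y) c cA conA
      (@continuous_dotpr _ x) (@continuous_dotpr _ y).
  - by have [w Aw e] := Ax; exists w; rewrite ?e.
  - by have [w Aw e] := Ay; exists w; rewrite ?e.
  - by move=> w /AP/PW[_ /KS sw]; exact: dis.
  have [w Qw e] := Qx; exists (A', w); split => //=; first exact: QA.
  by exists Q; split => //; first exact: subset_trans AP.
have [Az hAz] := choice crossing.
pose X := K `\` (Dr r x `|` Dr r y).
have XE : X = K `&` ([set w | dotp x w <= c] `&` [set w | dotp y w <= c]).
  apply/seteqP; split => w.
    move=> [Kw nD]; split => //; have sw := KS _ Kw.
    by split; rewrite /= leNgt; apply/negP => h; apply: nD; [left|right]; rewrite DrE.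
  by move=> [Kw [h1 h2]]; split => // -[|]; rewrite DrE// => -[_]; rewrite ltNge; [move: h1|move: h2] => /= ->.
have cX : compact X by rewrite XE; apply: compact_closedI => //; apply: closedI; exact: le_cl.
have QX n Q : Q `<=` P n -> (forall w, Q w -> dotp x w <= c /\ dotp y w <= c) -> Q `<=` X.
  by move=> QP Qle w Qw; rewrite XE; split; [exact: (PW _ _ (QP _ Qw)).2|exact: Qle].
(* Under the finiteness assumption infinitely many of the crossing pieces lie in one component [C];
   [iota] enumerates them. *)
have [|iota hiota eiota] := finite_pigeonhole (F := fun n => connected_component X (Az n).2) fin.
  move=> n /=; have [_ _ _ [Q [Qz conQ QP Qle [[w1 Qw1 e1'] [w2 Qw2 e2']]]]] := hAz n.
  have QX' := QX _ _ QP Qle.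
  have QC : Q `<=` connected_component X (Az n).2 by exact: connected_component_max.
  split; first by exists (Az n).2; split => //; exact: QX'.
  split.
    exists w1; split; first exact: QC.
    by rewrite sbd_Dr ?r0//; split => //; apply: KS; have := QX' _ Qw1; rewrite XE => -[].
  exists w2; split; first exact: QC.
  by rewrite sbd_Dr ?r0//; split => //; apply: KS; have := QX' _ Qw2; rewrite XE => -[].
pose N := maxn N1 N2.
pose z k := (Az (iota k)).2; pose A k := (Az (iota k)).1; pose P' k := P (iota k + N)%N.
set C := connected_component X (Az (iota 0%N)).2 in eiota.
have Xz k : X (z k).
  have [_ _ _ [Q [Qz conQ QP Qle _]]] := hAz (iota k); exact: QX QP Qle _ Qz.
have Cz k : C (z k).
  have : connected_component X (z k) (z k) by exact: connected_component_refl.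
  by rewrite eiota.
have conC : connected C by exact: component_connected.
have cC : compact C by exact: component_compact.
have CX : C `<=` X by exact: connected_component_sub.
have CK : C `<=` K by move=> w /CX; rewrite XE => -[].
have Cle w : C w -> dotp x w <= c /\ dotp y w <= c by move=> /CX; rewrite XE => -[_ []].
have Az' k : A k (z k) by have [_ _ ? _] := hAz (iota k).
have AP k : A k `<=` P' k by have [[_ _ ? _] _ _ _] := hAz (iota k).
have PE k : P' k = connected_component W (z k).
  rewrite /P'; have := AP _ _ (Az' k); rewrite /P'.
  have [[v [_ ->]] _] := hP (iota k + N)%N => h; exact: same_connected_component.
have iinj i j : i != j -> P' i <> P' j.
  rewrite neq_ltn => ij /iP/eqP; rewrite eqn_add2r => /eqP e.
  by case/orP: ij => /hiota; rewrite e ltnn.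
have Wz k : W (z k) by apply: (PW (iota k + N)%N); exact: AP.
(* Inside [E] the connected set [C] would join the different components [P' 0] and [P' 1] of [W]. *)
have nCE : ~ (C `<=` E).
  move=> CE; apply: (iinj 0%N 1%N) => //; rewrite !PE; apply: same_connected_component.
  by exists C; [split => // w Cw; split; [exact: CE|exact: CK]|exact: Cz].
(* [S k] leads inside [C] from the crossing piece to an exit from [E]. It stays in [P' k], so the
   continua [T k], which add it to [A k], remain pairwise disjoint. *)
pose S k := connected_component (C `&` E) (z k).
have Ez k : E (z k) by case: (Wz k).
have [p hp] : exists p : nat -> pt R, forall k, (S k `&` closure (C `\` E)) (p k).
  have ex k : exists w, (S k `&` closure (C `\` E)) w by exact: component_meets_closure.
  by have [p hp] := choice ex; exists p.
have Sz k : S k (z k) by apply: connected_component_refl; split.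
have SCE k : S k `<=` C `&` E by exact: connected_component_sub.
have SP k : S k `<=` P' k.
  rewrite PE; apply: connected_component_max => //; last exact: component_connected.
  by move=> w /SCE[Cw Ew]; split => //; exact: CK.
pose T k := A k `|` S k.
have TP k : T k `<=` P' k by move=> w [/AP|/SP].
have openU w : U w -> exists2 e : R, 0 < e & Dr e w `<=` U.
  move=> Uw; apply: contrapT => no; have : sbd U w.
    by split; [exact: subset_closure|move=> [_ [e [e0 he]]]; apply: no; exists e].
  rewrite sU; have [v [_ eU]] := cU; move: Uw; rewrite eU => /connected_component_sub[_].
  by move=> h /h.
have clU w : closure U w -> [\/ U w, J1 w | J2 w].
  move=> cw; have [Uw|nU] := pselect (U w); first by constructor 1.
  have : sbd U w by split => // -[].
  by rewrite sU => -[|]; [constructor 2|constructor 3].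
have JU : J1 `|` J2 `<=` closure U by rewrite -sU => w [].
have conU B : connected B -> B `<=` @sphere R `\` (J1 `|` J2) -> B `&` U !=set0 -> B `<=` U.
  move=> conB BS [b [Bb Ub]]; have [v [_ eU]] := cU.
  have -> : U = connected_component (@sphere R `\` (J1 `|` J2)) b.
    by rewrite eU; apply: same_connected_component; rewrite -eU.
  exact: connected_component_max.
have pC k : C (p k) /\ E (p k) by have [/SCE[]] := hp k.
have clp k : closure (@sphere R `\` closure U) (p k).
  by have [_] := hp k; apply: closureS => w [Cw nE]; split => //; apply: KS; exact: CK.
(* The exit is in [closure U] and is a limit of points off it, so it cannot lie in [U], which is
   open in the sphere. *)
have pJ k : (J1 `|` J2) (p k).
  have [Cp /clU[Up| |]] := pC k; [|by left|by right].
  exfalso; have [e e0 he] := openU _ Up.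
  have [V [oV Vp VD]] := Dr_nbhs (KS _ (CK _ Cp)) e0.
  have [w [[sw nw] Vw]] := clp k V (open_nbhs_nbhs (conj oV Vp)).
  by apply: nw; apply: subset_closure; apply: he; apply: VD.
have cJ1 : compact J1 by rewrite -ef1; apply: continuous_compact => //; exact: circle_compact.
have cJ2 : compact J2 by rewrite -ef2; apply: continuous_compact => //; exact: circle_compact.
pose Y := (J1 `|` J2) `&` ([set w | dotp x w <= c] `&` [set w | dotp y w <= c]).
have cY : compact Y by apply: compact_closedI; [exact: compactU|apply: closedI; exact: le_cl].
have [q [[Jq [xq yq]] clq]] : Y `&` cluster (p @ \oo) !=set0.
  apply: cY; exists 0%N => // k _; split; first exact: pJ.
  by have [/Cle[]] := pC k.
have clu V n : nbhs q V -> exists2 i, (n <= i)%N & V (p i).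
  move=> nV; have [w [[i ni <-] Vw]] : (p @` [set i | (n <= i)%N]) `&` V !=set0.
    by apply: clq => //; exists n => // i ni; exists i.
  by exists i.
have hT i : [/\ compact (T i), connected (T i), T i `<=` @sphere R, T i `<=` closure U &
    forall w, T i w -> dotp x w <= c' /\ dotp y w <= c'].
  have [[cA conA _ Ale] _ _ _] := hAz (iota i); split.
  - by apply: compactU => //; apply: component_compact; exact: compact_closedI.
  - apply: connectedU => //; last exact: component_connected.
    by exists (z i); split; [exact: Az'|exact: Sz].
  - by move=> w /TP/PW[_ /KS].
  - by move=> w /TP/PW[].
  - move=> w [/Ale//|/SCE[/Cle[h1 h2] _]].
    by split; [exact: le_trans h1 (ltW cc')|exact: le_trans h2 (ltW cc')].
have hm i : (exists2 w, T i w & dotp x w = c') /\ (exists2 w, T i w & dotp y w = c').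
  have [_ [[w1 A1 h1] [w2 A2 h2]] _ _] := hAz (iota i).
  by split; [exists w1|exists w2] => //; left.
have Td i j : i != j -> T i `&` T j = set0.
  move=> ij; rewrite -subset0 => w [/TP h1 /TP h2]; apply: (iinj i j ij).
  move: h1 h2; rewrite !PE => /same_connected_component -> /same_connected_component ->.
  by [].
have hp' i : [/\ T i (p i), dotp x (p i) <= c & closure (@sphere R `\` closure U) (p i)].
  split; [by right; have [] := hp i|by have [/Cle[]] := pC i|exact: clp].
have cm1 : -1 < c by apply: lt_trans c0; rewrite ltrN10.
case: Jq => Jq.
- move: (Jq); rewrite -ef1 => -[c0' cc0' e0']; rewrite -e0' in xq yq clu Jq.
  apply: (@no_crossings_accumulating_at R x y c c' f1 c0' J2 U T p hx hy cm1 cc' c'1 dis cf1 if1 _ cc0' xq yq _ _ _ _ _ hT hm Td hp' clu).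
  + by move=> v cv; apply: J1S; rewrite -ef1; exists v.
  + exact: compact_closed_normed.
  + by move=> h; have : (J1 `&` J2) (f1 c0') by []; rewrite J12.
  + by rewrite ef1.
  + by rewrite ef1 => w h; apply: JU; left.
  + by rewrite ef1.
- move: (Jq); rewrite -ef2 => -[c0' cc0' e0']; rewrite -e0' in xq yq clu Jq.
  apply: (@no_crossings_accumulating_at R x y c c' f2 c0' J1 U T p hx hy cm1 cc' c'1 dis cf2 if2 _ cc0' xq yq _ _ _ _ _ hT hm Td hp' clu).
  + by move=> v cv; apply: J2S; rewrite -ef2; exists v.
  + exact: compact_closed_normed.
  + by move=> h; have : (J1 `&` J2) (f2 c0') by []; rewrite J12.
  + by rewrite ef2 => w /clU[]; [constructor 1|constructor 3|constructor 2].
  + by rewrite ef2 => w h; apply: JU; right.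
  + by rewrite ef2 setUC.
Qed.

End Forward.

(** * Many crossing components give points of the closed relation *)

Section HausdorffLimits.
Variable R : realType.
Implicit Types (P : nat -> set (pt R)) (w z : pt R).

Section Ultralimit.
Variables (P : nat -> set (pt R)) (F : set_system nat).
Hypotheses (UF : UltraFilter F) (PS : forall n, P n `<=` @sphere R).

(** Along an ultrafilter a sequence of nonempty subsets of the sphere converges in the Hausdorff
    sense without diagonal extraction; a subsequence is chosen only at the end. *)
Definition ultralimit : set (pt R) :=
  [set z | sphere z /\ forall e : R, 0 < e -> F [set n | Dr e z `&` P n !=set0]].

Lemma ultra_pick (Y : set (pt R)) (w : nat -> pt R) : closed Y -> Y `<=` @sphere R ->
  F [set n | Y (w n)] -> exists2 z, Y z & forall V, nbhs z V -> F [set n | V (w n)].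
Proof.
move=> cY YS FY; have cpY : compact Y by exact: (subclosed_compact cY (@compact_sphere R) YS).
have PF : ProperFilter F by exact: ultra_proper.
have [z [Yz clz]] : Y `&` cluster (w @ F) !=set0 by exact: (cpY (w @ F) _ FY).
exists z => // V nV; have [//|FV] := in_ultra_setVsetC [set n | V (w n)] UF.
by have [v [nv Vv]] : (~` V) `&` V !=set0 by exact: (clz (~` V) V FV nV).
Qed.

Lemma ultralimit_pick (Y : set (pt R)) (w : nat -> pt R) : closed Y -> Y `<=` @sphere R ->
  F [set n | Y (w n) /\ P n (w n)] ->
  exists z, [/\ Y z, ultralimit z & forall V, nbhs z V -> F [set n | V (w n)]].
Proof.
move=> cY YS FY; have PF : ProperFilter F by exact: ultra_proper.
have [|z Yz hz] := @ultra_pick Y w cY YS; first by apply: filterS FY => n [].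
exists z; split => //; split; first exact: YS.
move=> e e0; have [V [oV Vz VD]] := Dr_nbhs (YS _ Yz) e0.
apply: filterS (filterI (hz V (open_nbhs_nbhs (conj oV Vz))) FY) => n [/= Vw [_ Pw]].
by exists (w n); split => //; apply: VD; split => //; exact: PS Pw.
Qed.

Lemma closed_ultralimit : closed ultralimit.
Proof.
have PF : ProperFilter F by exact: ultra_proper.
move=> z cz; have sz : sphere z.
  by rewrite ((closure_id _).1 (@closed_sphere R)); apply: closureS cz => v [sv _].
split => // e e0; have e20 : 0 < e / 2 by rewrite divr_gt0.
have [V [oV Vz VD]] := Dr_nbhs sz e20.
have [v [[sv /(_ _ e20) hv] Vv]] := cz V (open_nbhs_nbhs (conj oV Vz)).
have [_ zv] : Dr (e / 2) z v by apply: VD.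
apply: filterS hv => n [u [[su vu] Pu]]; exists u; split => //; split => //.
apply: (le_lt_trans (rho_triangle sz sv su)).
by rewrite [ltRHS]splitr ltrD.
Qed.

Lemma ultralimit_sphere : ultralimit `<=` @sphere R.
Proof. by move=> z []. Qed.

Lemma compact_ultralimit : compact ultralimit.
Proof. exact: (subclosed_compact closed_ultralimit (@compact_sphere R) ultralimit_sphere). Qed.

(** If an inclusion failed along the ultrafilter, the points of failure would converge to a point of
    the ultralimit, near which the inclusion holds. *)
Lemma ultralimit_near (e : R) : 0 < e ->
  F [set n | P n `<=` nbhd_rho e ultralimit /\ ultralimit `<=` nbhd_rho e (P n)].
Proof.
have PF : ProperFilter F by exact: ultra_proper.
move=> e0; apply: filterI.
- have [//|FC] := in_ultra_setVsetC [set n | P n `<=` nbhd_rho e ultralimit] UF.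
  have ex n : exists w, ~ (P n `<=` nbhd_rho e ultralimit) -> P n w /\ ~ nbhd_rho e ultralimit w.
    have [h|h] := pselect (P n `<=` nbhd_rho e ultralimit); first by exists (0, 0, 0).
    have [w [Pw nw]] : exists w, P n w /\ ~ nbhd_rho e ultralimit w.
      apply: contrapT => no; apply: h => w Pw; apply: contrapT => nw; apply: no; by exists w.
    by exists w.
  have [w hw] := choice ex.
  have [|z [_ Lz hz]] := @ultralimit_pick (@sphere R) w (@closed_sphere R) (fun _ h => h).
    by apply: filterS FC => n /hw[Pw _]; split => //; exact: PS Pw.
  have [V [oV Vz VD]] := Dr_nbhs (ultralimit_sphere Lz) e0.
  have [n [/= Vw /hw[Pw]]] := @filter_ex _ F PF _ (@filterI _ F _ _ _ (hz V (open_nbhs_nbhs (conj oV Vz))) FC).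
  have sw := PS Pw; case; split => //; exists z => //.
  by rewrite rhoC; have [] : Dr e z (w n) by apply: VD.
- have [//|FC] := in_ultra_setVsetC [set n | ultralimit `<=` nbhd_rho e (P n)] UF.
  have ex n : exists w, ~ (ultralimit `<=` nbhd_rho e (P n)) -> ultralimit w /\ ~ nbhd_rho e (P n) w.
    have [h|h] := pselect (ultralimit `<=` nbhd_rho e (P n)); first by exists (0, 0, 0).
    have [w [Pw nw]] : exists w, ultralimit w /\ ~ nbhd_rho e (P n) w.
      apply: contrapT => no; apply: h => w Pw; apply: contrapT => nw; apply: no; by exists w.
    by exists w.
  have [w hw] := choice ex.
  have [|z Lz hz] := @ultra_pick ultralimit w closed_ultralimit ultralimit_sphere.
    by apply: filterS FC => n /hw[].
  have e20 : 0 < e / 2 by rewrite divr_gt0.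
  have [V [oV Vz VD]] := Dr_nbhs (ultralimit_sphere Lz) e20.
  have [n [[/= Vw /hw[Lw nw]] [u [[su zu] Pu]]]] := @filter_ex _ F PF _
    (@filterI _ F _ _ _ (@filterI _ F _ _ _ (hz V (open_nbhs_nbhs (conj oV Vz))) FC) (Lz.2 _ e20)).
  exfalso; apply: nw; have sw := ultralimit_sphere Lw; split => //; exists u => //.
  have [_ zw] : Dr (e / 2) z (w n) by apply: VD.
  apply: (le_lt_trans (rho_triangle sw (ultralimit_sphere Lz) su)).
  by rewrite [ltRHS]splitr ltrD// rhoC.
Qed.

End Ultralimit.

(* Blaschke's selection theorem on the sphere. *)
Lemma hausdorff_subsequence P : (forall n, P n `<=` @sphere R) -> (forall n, P n !=set0) ->
  exists (iota : nat -> nat) (L : set (pt R)), [/\ {homo iota : i j / (i < j)%N},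
    hausdorff_limit (P \o iota) L &
    forall Y, closed Y -> Y `<=` @sphere R -> (forall n, P n `&` Y !=set0) -> L `&` Y !=set0].
Proof.
move=> PS P0; have [F [UF sF]] := ultraFilterLemma (F := @nbhs nat _ \oo) _.
have PF : ProperFilter F by exact: ultra_proper.
pose L := ultralimit P F.
have pick Y : closed Y -> Y `<=` @sphere R -> (forall n, P n `&` Y !=set0) -> L `&` Y !=set0.
  move=> cY YS PY; have [w hw] := choice PY.
  have [|z [Yz Lz _]] := @ultralimit_pick P F UF PS Y w cY YS; last by exists z.
  by apply: filterS filterT => n _; have [] := hw n.
have ex (mN : nat * nat) : exists n, (mN.2 <= n)%N /\
    (P n `<=` nbhd_rho (mN.1.+1%:R^-1) L /\ L `<=` nbhd_rho (mN.1.+1%:R^-1) (P n)).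
  have e0 : 0 < mN.1.+1%:R^-1 :> R by rewrite invr_gt0.
  have FN : F [set n | (mN.2 <= n)%N] by apply: sF; exists mN.2.
  by have [n [/= Nn hn]] := @filter_ex _ F PF _ (@filterI _ F _ _ _ FN (ultralimit_near UF PS e0)); exists n.
have [nx hnx] := choice ex.
(* The k-th index lies beyond the previous one and has accuracy [1 / (k + 1)]. *)
pose iota := fix f k := if k is k.+1 then nx (k.+1, (f k).+1) else nx (0%N, 0%N).
have hi k : P (iota k) `<=` nbhd_rho (k.+1%:R^-1) L /\ L `<=` nbhd_rho (k.+1%:R^-1) (P (iota k)).
  by case: k => [|k]; [exact: (hnx (0%N, 0%N)).2|exact: (hnx (k.+1, (iota k).+1)).2].
exists iota, L; split => //.
  move=> i j; elim: j => // j IH; rewrite ltnS leq_eqVlt => /orP[/eqP ->|/IH h].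
    exact: (hnx (j.+1, (iota j).+1)).1.
  exact: ltn_trans h (hnx (j.+1, (iota j).+1)).1.
split; first exact: ultralimit_sphere.
split; first exact: (compact_ultralimit UF).
split.
  have [|z [Lz _]] := pick _ (@closed_sphere R) (fun _ h => h); last by exists z.
  by move=> n; have [z Pz] := P0 n; exists z; split => //; exact: PS Pz.
move=> e e0; exists (Num.truncn e^-1) => n Nn.
have ne : n.+1%:R^-1 <= e.
  rewrite -[leRHS]invrK lef_pV2 ?posrE ?invr_gt0//; apply: ltW.
  by apply: (lt_le_trans (truncnS_gt _)); rewrite ler_nat.
have mono (A : set (pt R)) : nbhd_rho (n.+1%:R^-1) A `<=` nbhd_rho e A.
  by move=> z [sz [w Aw h]]; split => //; exists w => //; exact: lt_le_trans ne.
by have [h1 h2] := hi n; split; [exact: subset_trans (mono _)|exact: subset_trans (mono _)].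
Qed.

End HausdorffLimits.

(** * The region between two circles *)

Section Backward.
Variable R : realType.
Implicit Types (x y w u v : pt R).

Lemma latitude_image x (c : R) : sphere x -> -1 <= c <= 1 -> exists f : R * R -> pt R,
  [/\ continuous f, f @` @circle R = [set w | sphere w /\ dotp x w = c] &
      -1 < c < 1 -> injective f].
Proof.
move=> hx /andP[cm c1]; have [e1 [e2 [[x1 x2 e12] e11 e22 comp]]] := frame hx.
have xx : dotp x x = 1 by [].
have s0 : 0 <= 1 - c ^+ 2 by nra.
pose s := Num.sqrt (1 - c ^+ 2); have s2 : s ^+ 2 = 1 - c ^+ 2 by rewrite sqr_sqrtr.
pose f (z : R * R) : pt R := c *: x + (s * z.1) *: e1 + (s * z.2) *: e2.
have fx z : dotp x (f z) = c by rewrite /f !dotpDr !dotpZr xx x1 x2; ring.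
have f1 z : dotp e1 (f z) = s * z.1.
  by rewrite /f !dotpDr !dotpZr e11 e12 (dotpC e1 x) x1; ring.
have f2 z : dotp e2 (f z) = s * z.2.
  by rewrite /f !dotpDr !dotpZr e22 (dotpC e2 e1) e12 (dotpC e2 x) x2; ring.
have norm w : dotp w w = dotp x w ^+ 2 + dotp e1 w ^+ 2 + dotp e2 w ^+ 2.
  by rewrite (dotp_frame w w comp) !(dotpC w) !expr2.
exists f; split.
- by rewrite /f; continuity.
- apply/seteqP; split => w.
    move=> [z cz <-]; split => //; rewrite /sphere/= norm fx f1 f2.
    transitivity (c ^+ 2 + s ^+ 2 * (z.1 ^+ 2 + z.2 ^+ 2)); first by ring.
    by rewrite cz s2; ring.
  move=> [sw xw]; have := norm w; rewrite (sw : dotp w w = 1) xw => nw.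
  have [s00|s00] := eqVneq s 0.
    exists (1, 0); first by rewrite /circle/= expr1n expr0n addr0.
    rewrite s00 expr0n/= in s2.
    have : dotp e1 w ^+ 2 + dotp e2 w ^+ 2 = 0 by lra.
    move=> /eqP; rewrite paddr_eq0 ?sqr_ge0// !sqrf_eq0 => /andP[/eqP w1 /eqP w2].
    by rewrite [RHS](comp w) xw w1 w2 /f s00 !mul0r.
  exists (dotp e1 w / s, dotp e2 w / s).
    rewrite /circle /= !expr_div_n -mulrDl s2 -(_ : dotp e1 w ^+ 2 + dotp e2 w ^+ 2 = 1 - c ^+ 2); last by lra.
    rewrite divff// (_ : _ + _ = s ^+ 2) ?expf_neq0//; rewrite s2; lra.
  by rewrite [RHS](comp w) xw /f/= ![s * _]mulrC !divfK.
- move=> /andP[cm' c1'] z z' e.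
  have s00 : s != 0 by rewrite gt_eqF// sqrtr_gt0; nra.
  have := f1 z; rewrite e f1 => /(mulfI s00) h1.
  have := f2 z; rewrite e f2 => /(mulfI s00) h2.
  by case: z z' h1 h2 {e} => [a b] [a' b'] /= -> ->.
Qed.

Lemma latitude_simple_closed_curve x (c : R) : sphere x -> -1 < c < 1 ->
  simple_closed_curve [set w | sphere w /\ dotp x w = c].
Proof.
move=> hx cI; have [|f [cf ef injf]] := @latitude_image x c hx; first by case/andP: cI => /ltW -> /ltW ->.
split; first by move=> w [].
exists f; split; first exact: continuous_subspaceT.
by split => // z z' _ _; exact: injf.
Qed.

Lemma connected_circle : connected (@circle R).
Proof.
have -> : @circle R = (fun t : R => (cos t, sin t)) @` setT.
  apply/seteqP; split => z; last by move=> [t _ <-]; exact: cos_sin_circle.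
  by move=> /(circle_param 0)[t _ ->]; exists t.
apply: connected_continuous_connected; first exact/connected_intervalP.
by apply: continuous_subspaceT; continuity.
Qed.

Lemma connected_section u (k : R) : 0 < dotp u u -> connected [set w | sphere w /\ dotp u w = k].
Proof.
move=> u0; pose n := Num.sqrt (dotp u u); have n0 : 0 < n by rewrite sqrtr_gt0.
have n2 : n ^+ 2 = dotp u u by rewrite sqr_sqrtr// ltW.
have nn : n != 0 by rewrite gt_eqF.
have sv : sphere (n^-1 *: u).
  by rewrite /sphere/= dotpZl dotpZr -n2 expr2 mulKf// mulVf.
have -> : [set w | sphere w /\ dotp u w = k] = [set w | sphere w /\ dotp (n^-1 *: u) w = n^-1 * k].
  apply/seteqP; split => w [sw h]; split => //; first by rewrite dotpZl h.
  by move: h; rewrite dotpZl => /mulfI; apply; rewrite invr_neq0.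
have [e|/set0P[w [sw xw]]] := eqVneq [set w | sphere w /\ dotp (n^-1 *: u) w = n^-1 * k] set0.
  by rewrite e; exact: connected0.
have [|f [cf <- _]] := @latitude_image _ (n^-1 * k) sv; first by rewrite -xw dotp_itv.
by apply: connected_continuous_connected; [exact: connected_circle|exact: continuous_subspaceT].
Qed.

Section Annulus.
Variables (x y : pt R) (r : R).
Hypotheses (hx : sphere x) (hy : sphere y) (xy : x <> y) (r0 : 0 < r) (rr : r < rho x y / 2).

Let c := cos r.
Let U := [set w | sphere w /\ dotp x w < c /\ dotp y w < c].

Lemma annulus_radius : [/\ 0 <= r <= pi, 0 < r < pi, r < rho x y - r & rho x y - r <= pi].
Proof.
have /andP[_ h] := rho_itv hx hy; have p0 := @pi_gt0 R; have h1 := r0; have h2 := rr.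
by split; try (apply/andP; split); lra.
Qed.

Lemma annulus_lt w : sphere w -> c <= dotp x w -> dotp y w < c.
Proof.
by move=> sw h; rewrite ltNge; apply/negP; apply: (caps_disjoint hx hy sw r0 rr).
Qed.

(** When [y] is antipodal to [x], every tangent direction at [x] leads to [y]. *)
Lemma opposite_meridian : exists v, [/\ dotp x v = 0, dotp v v = 1 & cos (rho x y) *: x + sin (rho x y) *: v = y].
Proof.
have /andP[h0 hpi] := rho_itv hx hy.
have [e|n] := eqVneq (sin (rho x y)) 0; last by apply: meridian => //; rewrite cos_rho.
have [e1 [e2 [[x1 _ _] e11 _ _]]] := frame hx.
exists e1; split => //; rewrite e scale0r addr0 cos_rho//.
have : dotp x y ^+ 2 = 1.
  by rewrite -cos_rho// -[RHS](cos2Dsin2 (rho x y)) e expr0n/= addr0.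
move/eqP; rewrite sqrf_eq1 => /orP[/eqP h|/eqP h].
  by case: xy; exact: dotp_eq1.
rewrite h; have sy : sphere (-1 *: y).
  by rewrite /sphere/= dotpZl dotpZr (hy : dotp y y = 1); ring.
rewrite (@dotp_eq1 _ x (-1 *: y) hx sy) ?dotpZr ?h; last by ring.
by rewrite scalerA mulrNN mulr1 scale1r.
Qed.

(* [U] is swept out by the sections of the sphere with the planes of the pencil through
   the line common to the two bounding planes, and each section crosses the arc [xy]. *)
Lemma connected_annulus : connected U.
Proof.
have [rI rI' rr' rpi] := annulus_radius; have /andP[_ rpi'] := rI'.
have [v [xv vv ey]] := opposite_meridian; set rh := rho x y in ey rr' rpi.
pose tau t := cos t *: x + sin t *: v.
have ctau : continuous tau by rewrite /tau; continuity.
have st t : sphere (tau t) by have [] := meridian_sphere t hx xv vv.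
have xt t : dotp x (tau t) = cos t by have [] := meridian_sphere t hx xv vv.
have yt t : dotp y (tau t) = cos (rh - t).
  rewrite -ey /tau !(dotpDl, dotpDr, dotpZl, dotpZr) (hx : dotp x x = 1) vv xv (dotpC v x) xv cosB.
  by ring.
have cosl t : r < t -> t <= pi -> cos t < c.
  by move=> rt tpi; rewrite ltr_cos// in_itv/= ?rI// (ltW (lt_trans r0 rt)).
pose seg := tau @` [set` `]r, (rh - r)[].
have segU : seg `<=` U.
  move=> w [t]; rewrite /= in_itv/= => /andP[t1 t2] <-; split => //; rewrite xt yt.
  by split; apply: cosl; lra.
have conseg : connected seg.
  apply: connected_continuous_connected; last exact: continuous_subspaceT.
  exact/connected_intervalP/interval_is_interval.
(* The plane of the pencil through [w]: on it [c - dotp x u] and [c - dotp y u] keep the ratio they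
   have at [w]. So they have the same sign, and by disjointness of the discs this sign is
   positive. *)
pose Gam w := [set u | sphere u /\ dotp ((c - dotp y w) *: x + (- (c - dotp x w)) *: y) u =
  c * ((c - dotp y w) - (c - dotp x w))].
have GamE w u : Gam w u <-> sphere u /\ (c - dotp y w) * (c - dotp x u) = (c - dotp x w) * (c - dotp y u).
  by rewrite /Gam/= dotpDl !dotpZl; split => -[su h]; split => //; lra.
have GamU w : U w -> Gam w `<=` U.
  move=> [sw [xw yw]] u /GamE[su h]; split => //.
  have a0 : 0 < c - dotp y w by rewrite subr_gt0.
  have b0 : 0 < c - dotp x w by rewrite subr_gt0.
  have xu : dotp x u < c.
    rewrite ltNge; apply/negP => cu; have yu := annulus_lt su cu.
    have : (c - dotp x w) * (c - dotp y u) <= 0 by rewrite -h pmulr_rle0// subr_le0.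
    by rewrite leNgt mulr_gt0// subr_gt0.
  by split => //; rewrite -subr_gt0 -(pmulr_rgt0 _ b0) -h mulr_gt0// subr_gt0.
have Gamw w : U w -> Gam w w by move=> [sw _]; apply/GamE; split => //; ring.
have conGam w : U w -> connected (Gam w).
  move=> [sw [xw yw]]; apply: connected_section.
  set a := c - dotp y w; set b := - (c - dotp x w).
  have a0 : 0 < a by rewrite subr_gt0.
  have b0 : b < 0 by rewrite oppr_lt0 subr_gt0.
  rewrite !(dotpDl, dotpDr, dotpZl, dotpZr) (hx : dotp x x = 1) (hy : dotp y y = 1) (dotpC y x).
  have d1 : dotp x y < 1 by exact: dotp_lt1.
  rewrite [X in _ < X](_ : _ = (a + b) ^+ 2 + 2 * ((- b) * a * (1 - dotp x y))); last by ring.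
  by rewrite ltr_wpDl ?sqr_ge0// !mulr_gt0 ?oppr_gt0// subr_gt0.
have cross w : U w -> Gam w `&` seg !=set0.
  move=> [sw [xw yw]].
  (* [h t] vanishes where the arc meets [Gam w]; at either end of the arc one term is zero, and the
     signs are opposite. *)
  pose h t := (c - dotp y w) * (c - dotp x (tau t)) - (c - dotp x w) * (c - dotp y (tau t)).
  have ch : {within `[r, rh - r], continuous h}.
    have cd u : continuous (fun t => dotp u (tau t)) by apply: continuous_dotp => //; exact: continuous_fun_const.
    have cdx := cd x; have cdy := cd y; apply: continuous_subspaceT; rewrite /h => t.
    by apply: cvgB; apply: cvgM; try exact: cvg_cst; apply: cvgB; try exact: cvg_cst; [exact: cdx|exact: cdy].
  have hr : h r < 0.
    rewrite /h xt yt subrr mulr0 sub0r oppr_lt0 mulr_gt0// subr_gt0//.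
    exact: cosl.
  have hr' : 0 < h (rh - r).
    rewrite /h xt yt subKr subrr mulr0 subr0 mulr_gt0// subr_gt0//.
    exact: cosl.
  have [|t] := IVT (ltW rr') ch (v := 0).
    by rewrite ge_min le_max (ltW hr) (ltW hr') orbT.
  rewrite in_itv/= => /andP[t1 t2] ht; exists (tau t); split.
    by apply/GamE; split => //; apply/eqP; rewrite -subr_eq0; apply/eqP.
  exists t => //; rewrite /= in_itv/= !lt_neqAle t1 t2 !andbT; apply/andP; split; apply/eqP => et.
    by move: hr; rewrite et ht ltxx.
  by move: hr'; rewrite -et ht ltxx.
have -> : U = \bigcup_(w in U) (Gam w `|` seg).
  apply/seteqP; split => w; first by move=> Uw; exists w => //; left; exact: Gamw.
  by move=> [w' Uw' [|/segU//]]; exact: GamU.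
apply: bigcup_connected.
  exists (tau (rh / 2)) => w _; right; exists (rh / 2) => //.
  by rewrite /= in_itv/=; apply/andP; split; lra.
by move=> w Uw; apply: connectedU; [exact: cross|exact: conGam|].
Qed.

Lemma annulus_nonempty : exists w, U w.
Proof.
have [rI rI' rr' rpi] := annulus_radius; have /andP[_ rpi'] := rI'.
have [v [xv vv ey]] := opposite_meridian; set rh := rho x y in ey rr' rpi.
pose t := rh / 2; exists (cos t *: x + sin t *: v).
have [st xt] := meridian_sphere t hx xv vv; split => //; rewrite xt.
have ct : cos t < c by rewrite ltr_cos ?in_itv/= ?rI//; rewrite /t; try (apply/andP; split); lra.
split => //; rewrite -ey !(dotpDl, dotpDr, dotpZl, dotpZr) (hx : dotp x x = 1) vv xv (dotpC v x) xv.
apply: le_lt_trans ct; rewrite [leRHS](_ : _ = cos (rh - t)); last by congr cos; rewrite /t; lra.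
by rewrite cosB; lra.
Qed.

(** Off the two circles strict and weak inequalities agree, so [U] is open and closed in the
    complement. *)
Lemma annulus_component : component_of (@sphere R `\` ([set w | sphere w /\ dotp x w = c] `|`
  [set w | sphere w /\ dotp y w = c])) U.
Proof.
have [m Um] := annulus_nonempty; exists m.
set X := _ `\` _; have UX : U `<=` X.
  move=> w [sw [xw yw]]; split => // -[[_ h]|[_ h]]; first by move: xw; rewrite h ltxx.
  by move: yw; rewrite h ltxx.
split; first exact: UX.
apply/seteqP; split; first by apply: connected_component_max => //; exact: connected_annulus.
set B := connected_component X m.
have BX : B `<=` X by exact: connected_component_sub.
have opn v (a : R) : open [set w : pt R | dotp v w < a].
  by apply: (@open_comp _ _ (dotp v) [set t | t < a]); [move=> ? _; exact: continuous_dotpr|exact: open_lt].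
have cls v (a : R) : closed [set w : pt R | dotp v w <= a].
  by apply: (@closed_comp _ _ (dotp v) [set t | t <= a]); [move=> ? _; exact: continuous_dotpr|exact: closed_le].
suff <- : B `&` U = B by move=> w [].
apply: component_connected.
- by exists m; split => //; apply: connected_component_refl; exact: UX.
- exists ([set w | dotp x w < c] `&` [set w | dotp y w < c]); first exact: openI.
  by apply/seteqP; split => w [Bw]; [case=> _ []|case=> h1 h2; split => //; split => //; case: (BX _ Bw)].
- exists ([set w | dotp x w <= c] `&` [set w | dotp y w <= c]); first exact: closedI.
  apply/seteqP; split => w [Bw]; first by case=> _ [/ltW h1 /ltW h2].
  case=> /= h1 h2; split => //; have [sw nw] := BX _ Bw; split => //.
  by split; rewrite lt_neqAle ?h1 ?h2 andbT; apply/eqP => e; apply: nw; [left|right].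
Qed.

(** The meridian from [u] continued slightly beyond [w] leaves the disc. *)
Lemma latitude_approach u (a : R) w (V : set (pt R)) : sphere u -> 0 < a < pi -> sphere w ->
  dotp u w = cos a -> nbhs w V -> exists w', [/\ V w', sphere w' & dotp u w' < cos a].
Proof.
move=> hu /andP[a0 api] hw uw nV; have sa : 0 < sin a by apply: sin_gt0_pi; rewrite a0.
have [v [xv vv wv]] := meridian hu hw (lt0r_neq0 sa) uw.
pose g (t : R) := cos t *: u + sin t *: v.
have cg : continuous g by rewrite /g; continuity.
have nV' : \forall t \near a, V (g t) by rewrite -wv -/(g a) in nV; exact: cg.
have [e e0 he] := (nbhs_ballP _ _).1 nV'.
pose t := Num.min (a + e / 2) pi.
have ta : a < t by rewrite lt_min api andbT ltrDl divr_gt0.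
have [sg xg] := meridian_sphere t hu xv vv.
exists (g t); split => //.
- apply: he; rewrite -ball_normE /= distrC ger0_norm ?subr_ge0 ?ltW//.
  rewrite ltrBlDl; apply: (@le_lt_trans _ _ (a + e / 2)); first by rewrite /t ge_min lexx.
  by rewrite ltrD2l ltr_pdivrMr// ltr_pMr// ltr1n.
- by rewrite xg ltr_cos// in_itv/= ?(ltW a0) ?(ltW api)// (ltW (lt_trans a0 ta)) /t ge_min lexx orbT.
Qed.

Lemma closure_annulus : closure U = [set w | sphere w /\ dotp x w <= c /\ dotp y w <= c].
Proof.
have [_ rI' _ _] := annulus_radius.
have cls v (a : R) : closed [set w : pt R | dotp v w <= a].
  by apply: (@closed_comp _ _ (dotp v) [set t | t <= a]); [move=> ? _; exact: continuous_dotpr|exact: closed_le].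
have opn v (a : R) : open [set w : pt R | dotp v w < a].
  by apply: (@open_comp _ _ (dotp v) [set t | t < a]); [move=> ? _; exact: continuous_dotpr|exact: open_lt].
apply/seteqP; split => w.
  have cl : closed (@sphere R `&` ([set w | dotp x w <= c] `&` [set w | dotp y w <= c])).
    by apply: closedI; [exact: closed_sphere|exact: closedI].
  move=> h; have : closure (@sphere R `&` ([set w | dotp x w <= c] `&` [set w | dotp y w <= c])) w.
    by apply: closureS h => v [sv [/ltW h1 /ltW h2]].
  by rewrite -((closure_id _).1 cl).
have bd (x' y' : pt R) : sphere x' -> (dotp x' w = c -> dotp y' w < c) -> sphere w -> dotp x' w = c ->
    forall V, nbhs w V -> exists w', [/\ V w', sphere w', dotp x' w' < c & dotp y' w' < c].
  move=> hx' yw sw xw V nV.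
  have nW : nbhs w (V `&` [set v | dotp y' v < c]).
    by apply: filterI => //; apply: open_nbhs_nbhs; split => //; exact: yw.
  by have [w' [[Vw' yw'] sw' xw']] := latitude_approach hx' rI' sw xw nW; exists w'.
move=> [sw [xw yw]] V nV.
move: xw; rewrite le_eqVlt => /orP[/eqP xw|xw].
  have [//|w' [Vw' sw' h1 h2]] := bd x y hx _ sw xw V nV; last by exists w'.
  by move=> e; apply: annulus_lt => //; rewrite e.
move: yw; rewrite le_eqVlt => /orP[/eqP yw|yw]; last first.
  by exists w; split; [split|exact: nbhs_singleton].
by have [//|w' [Vw' sw' h1 h2]] := bd y x hy _ sw yw V nV; exists w'.
Qed.

Lemma annulus_is_U : is_U [set w | sphere w /\ dotp x w = c] [set w | sphere w /\ dotp y w = c] U.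
Proof.
split; first exact: annulus_component.
have opn v (a : R) : open [set w : pt R | dotp v w < a].
  by apply: (@open_comp _ _ (dotp v) [set t | t < a]); [move=> ? _; exact: continuous_dotpr|exact: open_lt].
rewrite /sbd closure_annulus; apply/seteqP; split => w.
  move=> [[sw [xw yw]] nin].
  have [xl|xl] := boolP (dotp x w < c); last first.
    by left; split => //; apply: le_anti; rewrite xw leNgt xl.
  have [yl|yl] := boolP (dotp y w < c); last first.
    by right; split => //; apply: le_anti; rewrite yw leNgt yl.
  exfalso; apply: nin; split => //.
  have [e e0 he] := @Dr_sub_open R ([set v | dotp x v < c] `&` [set v | dotp y v < c]) w
    (openI (opn x c) (opn y c)) sw (conj xl yl).
  by exists e; split => // v hv; split; [case: hv|exact: he].
case=> -[sw h]; split.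
- split => //; split; first by rewrite h.
  by apply/ltW/annulus_lt => //; rewrite h.
- by move=> [[_ [xw _]] _]; move: xw; rewrite h ltxx.
- split => //; split; last by rewrite h.
  by rewrite leNgt; apply/negP => /ltW/(annulus_lt sw); rewrite h ltxx.
- by move=> [[_ [_ yw]] _]; move: yw; rewrite h ltxx.
Qed.

(** The last clause of [hausdorff_subsequence], applied to the part of [K] on each circle, places
    [x'] and [y'] in the limit. *)
Lemma RK_of_crossings (K : set (pt R)) : K `<=` @sphere R -> compact K ->
  ~ finite_set [set C | component_of (K `\` (Dr r x `|` Dr r y)) C /\
                        C `&` sbd (Dr r x) !=set0 /\ C `&` sbd (Dr r y) !=set0] ->
  exists x' y', [/\ RK K (x', y'), K x', K y', dotp x x' = c & dotp y y' = c].
Proof.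
move=> KS cK inf; have [rI rI' rr' rpi] := annulus_radius.
have /andP[_ rpi'] := rI'.
have c1 : c < 1 by rewrite /c -(@cos0 R) ltr_cos// in_itv/= ?lexx ?rI// pi_ge0.
have cm1 : -1 < c by rewrite /c -(@cospi R) ltr_cos// in_itv/= ?lexx ?rI// pi_ge0.
have [P [Pin iP]] : exists P : nat -> set (pt R), (forall n, component_of (K `\` (Dr r x `|` Dr r y)) (P n) /\
   P n `&` sbd (Dr r x) !=set0 /\ P n `&` sbd (Dr r y) !=set0) /\ injective P.
  move/infiniteP/pcard_leP : inf => [P]; exists P; split; last by move=> i j; apply: inj; rewrite inE.
  by move=> n; have : [set: nat] n by []; move/(@funS _ _ _ _ P).
pose X := K `\` (Dr r x `|` Dr r y).
have XE : closure U `&` K = X.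
  rewrite closure_annulus; apply/seteqP; split => w.
    move=> [[sw [xw yw]] Kw]; split => // -[|]; rewrite DrE// => -[_]; rewrite ltNge.
      by rewrite xw.
    by rewrite yw.
  move=> [Kw nD]; have sw := KS _ Kw; split => //; split => //.
  by split; rewrite leNgt; apply/negP => h; apply: nD; [left|right]; rewrite DrE.
have clX : closed X by rewrite -XE; apply: closedI; [exact: closed_closure|exact: compact_closed_normed].
have PX n : P n `<=` X by have [[z [_ ->]] _] := Pin n; exact: connected_component_sub.
have PK n : P n `<=` K by move=> w /PX[].
have PJ n : P n `&` [set w | sphere w /\ dotp x w = c] !=set0 /\ P n `&` [set w | sphere w /\ dotp y w = c] !=set0.
  by have [_] := Pin n; rewrite !sbd_Dr.
have [|n|iota [L [hiota hL pick]]] := @hausdorff_subsequence R P.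
- by move=> n w /PK/KS.
- by have [[w [Pw _]] _] := PJ n; exists w.
have clJ v : closed [set w | sphere w /\ dotp v w = c].
  apply: (@closedI _ (@sphere R) [set w | dotp v w = c]); first exact: closed_sphere.
  by apply: closed_eq_fun; [exact: continuous_dotpr|exact: continuous_fun_const].
have clK : closed K by exact: compact_closed_normed.
have pickJ v : (forall n, P n `&` [set w | sphere w /\ dotp v w = c] !=set0) -> exists w, [/\ L w, K w, sphere w & dotp v w = c].
  move=> PJv; have [||n|w [Lw [Kw [sw vw]]]] := pick (K `&` [set w | sphere w /\ dotp v w = c]).
  - by apply: closedI => //; exact: clJ.
  - by move=> w [_ []].
  - by have [w [Pw Jw]] := PJv n; exists w; split => //; split => //; exact: PK Pw.
  - by exists w.
have [x' [Lx' Kx' sx' xx']] := pickJ x (fun n => (PJ n).1).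
have [y' [Ly' Ky' sy' yy']] := pickJ y (fun n => (PJ n).2).
exists x', y'; split => //; split => //; split => //; split => /=.
  move=> e; have : dotp y x' < c by apply: annulus_lt => //; rewrite xx'.
  by rewrite e yy' ltxx.
exists [set w | sphere w /\ dotp x w = c], [set w | sphere w /\ dotp y w = c], U.
split; first by apply: latitude_simple_closed_curve => //; rewrite cm1.
split; first by apply: latitude_simple_closed_curve => //; rewrite cm1.
split.
  rewrite -subset0 => w [[sw h1] [_ h2]]; have : dotp y w < c by apply: annulus_lt => //; rewrite h1.
  by rewrite h2 ltxx.
split => //; split => //; split; first exact: annulus_is_U.
exists (P \o iota); split.
  move=> i j /iP e; apply/eqP; case: (ltngtP i j) => // /hiota; by rewrite e ltnn.
split; last by exists L.
move=> n; have [cP _] := Pin (iota n); split; last exact: PJ.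
by rewrite XE.
Qed.

End Annulus.

Lemma RK_closure_of_crossings (K : set (pt R)) x y : K `<=` @sphere R -> compact K -> K x -> K y -> x <> y ->
  (forall r : R, 0 < r -> r < rho x y / 2 ->
     ~ finite_set [set C | component_of (K `\` (Dr r x `|` Dr r y)) C /\
                           C `&` sbd (Dr r x) !=set0 /\ C `&` sbd (Dr r y) !=set0]) ->
  RK_closure K (x, y).
Proof.
move=> KS cK Kx Ky xy inf; have hx := KS _ Kx; have hy := KS _ Ky; split => //.
move=> V [[V1 V2] [/= nV1 nV2] VV].
have op (W : set (pt R)) w : sphere w -> nbhs w W -> exists2 e : R, 0 < e & Dr e w `<=` W.
  move=> sw nW; have [e e0 he] := Dr_sub_open (@open_interior _ W) sw nW.
  by exists e => //; apply: subset_trans he _; exact: interior_subset.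
have [e1 e10 he1] := op _ _ hx nV1; have [e2 e20 he2] := op _ _ hy nV2.
have rho0 : 0 < rho x y.
  by rewrite /rho acos_gt0//; have /andP[-> _] := dotp_itv hx hy; rewrite dotp_lt1.
(* [x'] and [y'] are at distance exactly [r] from [x] and [y], so [r] has to be strictly below [e1]
   and [e2]; hence the half. *)
pose r := Num.min (Num.min e1 e2) (rho x y / 2) / 2.
have m0 : 0 < Num.min (Num.min e1 e2) (rho x y / 2) by rewrite !lt_min e10 e20 divr_gt0.
have r0 : 0 < r by rewrite divr_gt0.
have : r < Num.min (Num.min e1 e2) (rho x y / 2) by rewrite ltr_pdivrMr// ltr_pMr// ltr1n.
rewrite !lt_min => /andP[/andP[re1 re2] rr].
have [rI _ _ _] := annulus_radius hx hy r0 rr.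
have [x' [y' [RKxy Kx' Ky' xx' yy']]] := RK_of_crossings hx hy xy r0 rr KS cK (inf r r0 rr).
exists (x', y'); split => //; apply: VV; split => /=.
- apply: he1; split; first exact: KS.
  by apply: le_lt_trans re1; rewrite rho_le ?xx'//; exact: KS.
- apply: he2; split; first exact: KS.
  by apply: le_lt_trans re2; rewrite rho_le ?yy'//; exact: KS.
Qed.

End Backward.

Theorem theorem3 (R : realType) (K : set (pt R)) (x y : pt R) :
  K `<=` @sphere R -> compact K -> K x -> K y -> x <> y ->
  (RK_closure K (x, y) <->
   forall r : R, 0 < r -> r < rho x y / 2 ->
     ~ finite_set [set C | component_of (K `\` (Dr r x `|` Dr r y)) C /\
                           C `&` sbd (Dr r x) !=set0 /\
                           C `&` sbd (Dr r y) !=set0]).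
Proof.
move=> KS cK Kx Ky xy; split; last exact: RK_closure_of_crossings.
by move=> h r r0 rr; exact: crossings_of_RK_closure.
Qed.
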